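(* Let $\mathfrak M^*$ be a manifold with finitely many elements, let $\mathfrak M$ be connected, and let $\boldsymbol A(\mathfrak M)=\mathfrak M^*$ be a covering which is branched along exactly the surface pieces $f_1^*,\dots,f_n^*$ of $\mathfrak M^*$ ($n\ge 1$), with order $k_i-1$ along $f_i^*$; that is, every surface piece of $\mathfrak M$ over $f_i^*$ has branching number $k_i-1\ge 1$, the numbering being such that $k_i\le k_{i+1}$, and all surface pieces over the remaining surface pieces of $\mathfrak M^*$ have branching number $0$. Then there is a covering $\boldsymbol A(\mathfrak N)=\mathfrak N^*$, elementarily related to the given one, in which $\mathfrak N^*$ contains one point and (up to orientation) exactly $n$ surface pieces $f_1^*,\dots,f_n^*$, branched with orders $k_1-1,\dots,k_n-1$ respectively, such that $f_i^*$ ($i=1,\dots,n-1$) has as simple boundary path a single segment $s_i^*$, and $f_n^*$ has the simple boundary path $$s_1^*s_2^*\cdots s_{n-1}^*\,r^*,$$ where $r^*$ is the boundary path of a normal polygon.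
   Context: A line segment complex consists of (finitely or denumerably many) points and directed segments; each segment $s$ has an initial and a final point and an oppositely directed segment $s^{-1}\ne s$, with $(s^{-1})^{-1}=s$, whose initial (final) point is the final (initial) point of $s$. Paths are finite sequences of segments, each beginning where the preceding one ends. A surface complex is a line segment complex together with surface pieces $f$; each $f$ has an opposite $f^{-1}\neq f$, $(f^{-1})^{-1}=f$, and a nonempty closed path, determined up to cyclic interchange, circumscribing $f$ once positively (a simple positive boundary path of $f$); if $w$ is one for $f$, then $w^{-1}$ is one for $f^{-1}$. A manifold is a surface complex, with at least one segment, such that: (1) the line segment complex is connected; (2) every segment occurs in the boundary of some surface piece; (3) a simple boundary path runs through a segment (in either direction) at most twice; if the boundary path of $f$ runs through $s$ once, there is, up to orientation, exactly one surface piece $f'\neq f^{\pm1}$ whose boundary runs through $s$, and it does so once; if the boundary path of $f$ runs through $s$ twice, $s$ bounds only $f^{\pm1}$; (4) at every point $p$, any two segments beginning at $p$ can be joined by a sequence of segments $s_1,s_2,\dots,s_m$ beginning at $p$ such that consecutive pairs satisfy: $s_i^{-1}s_{i+1}$ is a (cyclic) subpath of a boundary path, and $s_{i-1},s_{i+1}$ come from the two different passages of boundary paths through $s_i$. Covering (possibly branched) $\boldsymbol A(\mathfrak C)=\mathfrak C^*$ of surface complexes: a map of points, segments, surface pieces, surjective on points, such that (a) initial points are preserved, $\boldsymbol A(s^{-1})=\boldsymbol A(s)^{-1}$, $\boldsymbol A(f^{-1})=\boldsymbol A(f)^{-1}$, and the segments beginning at $p$ are mapped bijectively onto those beginning at $\boldsymbol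 A(p)$; (b) if $r$ is a simple positive boundary path of $f$, then $\boldsymbol A(r)={r^*}^k$ for a simple positive boundary path $r^*$ of $\boldsymbol A(f)$, and, writing $r=w_1\cdots w_k$ with $\boldsymbol A(w_i)=r^*$, the $w_i$ are pairwise distinct; (c) if $r^*$ is a simple positive boundary path of $f^*$ and $w'$ is a path with $\boldsymbol A(w')=r^*$, there is exactly one surface piece $f'$ over $f^*$ in whose simple positive boundary path $r'$ (suitably cyclically interchanged) $w'$ occurs as initial subpath. If $\boldsymbol A(r')={r^*}^k$, then $k-1$ is the branching number of $f'$. Elementarily related coverings: coverings connected by a finite chain of the following modifications and their inverses. (i) A segment $s^*$ (with $s^{*-1}$) of $\mathfrak M^*$ is replaced by a path of two segments through a new point, and every segment over $s^*$ is correspondingly replaced by such a path lying over it. (ii) A surface piece $f^*$ with simple positive boundary path $w_1^*w_2^*$ is replaced by two surface pieces with boundary paths $w_1^*s'^{*-1}$ and $s'^*w_2^*$, where $s'^*$ is a new segment with the same initial and final point as $w_1^*$; correspondingly, for every path $w_1$ over $w_1^*$ a segment over $s'^*$ with the same initial and final points is added, and each $f$ over $f^*$ with boundary path $(w_{11}w_{21})\cdots(w_{1k}w_{2k})$, where $\boldsymbol A(w_{ij})=w_i^*$, is replaced by one surface piece with boundary path $s'_1w_{21}\cdots s'_kw_{2k}$ and $k$ surface pieces with boundary paths $w_{1j}s_j'^{-1}$, $j=1,\dots,k$ (or the same with the roles of the two parts exchanged); the covering is extended in the obvious way. A normal polygon is a manifold with exactly one point and one surface piece pair $f^{\pm1}$;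 its boundary path is the simple boundary path of $f$. When $\mathfrak M^*$ is a sphere, $r^*$ is the empty path.
   Formalization: In the definition of covering, the subpaths over a boundary path of f* are counted by their places on the boundary path of f, not merely as paths; this differs from (b),(c) only when that boundary path is a proper power (projective plane with one surface piece), where the literal claim fails. *)

(* Defs.v *)
From HB Require Import structures.
From mathcomp Require Import all_boot.
From Stdlib Require Import Relation_Operators.

Set Implicit Arguments.
Unset Strict Implicit.
Unset Printing Implicit Defensive.

Record lineComplex := LineComplex {
  point : countType;
  segment : countType;
  ini : segment -> point;
  sinv : segment -> segment;
  sinvK : involutive sinv;
  sinv_neq : forall s, sinv s != s
}.

Section Paths.
Variable K : lineComplex.
Implicit Types (p q : point K) (s t : segment K) (w : seq (segment K)).

Definition fin s : point K := ini (sinv s).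

Definition follows s t : bool := ini t == fin s.

Definition is_path w : bool := sorted follows w.

(* [w] is a path from [p] to [q]; the empty path joins [p] to itself. *)
Fixpoint joins p w q : bool :=
  if w is s :: w' then (ini s == p) && joins (fin s) w' q else p == q.

Definition path_inv w := rev (map (@sinv K) w).

Definition connected := forall p q, exists w, joins p w q.

End Paths.

(* The boundary path of a piece matters only up to cyclic interchange: [bd f]
   is one representative, the simple positive boundary paths of [f] are all its
   rotations (see [simple_boundary]). The representatives of [f] and of its
   opposite are chosen inverse to each other. *)
Record surfaceComplex := SurfaceComplex {
  skeleton :> lineComplex;
  piece : countType;
  pinv : piece -> piece;
  bd : piece -> seq (segment skeleton);
  pinvK : involutive pinv;
  pinv_neq : forall f, pinv f != f;
  bd_nonempty : forall f, bd f != [::];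
  bd_closed : forall f, cycle (@follows skeleton) (bd f);
  bd_pinv : forall f, bd (pinv f) = path_inv (bd f)
}.

Section Manifolds.
Variable K : surfaceComplex.
Implicit Types (f g : piece K) (s t u : segment K).

Definition simple_boundary f (r : seq (segment K)) : Prop :=
  exists i, r = rot i (bd f).

(* equality of pieces up to orientation *)
Definition same_piece f g : bool := (g == f) || (g == pinv f).

(* number of times the boundary of [f] runs through [s], in either direction *)
Definition passes f s : nat :=
  count_mem s (bd f) + count_mem (sinv s) (bd f).

(* A passage [(f, j)] is the [j]-th place of [bd f]. The same passage, read in
   the opposite direction, belongs to [pinv f]. *)
Definition passage : Type := piece K * nat.

Definition passage_opp (c : passage) : passage :=
  (pinv c.1, (size (bd c.1)).-1 - c.2).

Definition passage_next (c : passage) : passage :=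
  (c.1, c.2.+1 %% size (bd c.1)).

Definition runs_through (c : passage) s : Prop := onth (bd c.1) c.2 = Some s.

(* [s^-1 t] is a cyclic subpath of a boundary path, at the places [c] and
   [passage_next c]. *)
Definition corner (c : passage) s t : Prop :=
  runs_through c (sinv s) /\ runs_through (passage_next c) t.

(* [fan s c t]: segments [s = s_1, ..., s_m = t] (m >= 2) such that consecutive
   ones form corners, the last of which is [c]. At an intermediate segment [t]
   the corner [c] arrives through the passage [passage_next c] of [t], and the
   corner [c'] leaves through [c'], i.e. through [passage_opp c'] read in the
   direction of [t]. *)
Inductive fan : segment K -> passage -> segment K -> Prop :=
| fan_corner s c t : corner c s t -> fan s c t
| fan_step s c t c' u :
    fan s c t -> corner c' t u -> passage_next c <> passage_opp c' ->
    fan s c' u.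

Record manifold : Prop := Manifold {
  mf_segment : exists s : segment K, True;
  mf_connected : connected K;
  mf_bounds : forall s, exists f, 0 < passes f s;
  mf_le2 : forall f s, passes f s <= 2;
  mf_once : forall f s, passes f s = 1 ->
    exists f', [/\ ~~ same_piece f f', passes f' s = 1 &
      forall g, ~~ same_piece f g -> 0 < passes g s -> same_piece f' g];
  mf_twice : forall f s, passes f s = 2 ->
    forall g, 0 < passes g s -> same_piece f g;
  mf_star : forall s t, ini s = ini t -> s = t \/ exists c, fan s c t
}.

Definition finitely_many (T : eqType) : Prop :=
  exists e : seq T, forall x, x \in e.

Definition finite_complex : Prop :=
  [/\ finitely_many (point K), finitely_many (segment K) &
      finitely_many (piece K)].

Definition one_point : Prop := exists x : point K, forall y : point K, y = x.

Definition normal_polygon f : Prop :=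
  [/\ manifold, one_point & forall g, same_piece f g].

Definition digon : Prop :=
  manifold /\ exists f s,
    (forall g, same_piece f g) /\ simple_boundary f [:: s; sinv s].

End Manifolds.

(* The segments of the polygon are identified with segments of [K]. *)
Definition normal_polygon_boundary (K : surfaceComplex) (r : seq (segment K)) :=
  exists (P : surfaceComplex) (f : piece P) (h : segment P -> segment K),
    [/\ normal_polygon f, injective h,
        forall s, h (sinv s) = sinv (h s) &
        exists2 w, simple_boundary f w & r = map h w].

(* Coverings. [lift_bd f] is the simple positive boundary path of [f] that lies
   over a power of the representative [bd (cpiece f)]. If [bd (cpiece f)] is not
   itself a proper power, this path is unique up to rotation by full laps, and
   [cov_laps] and [cov_lift] just say that
   - the boundary path of [f] consists of pairwise distinct laps over a boundary
     path of its image,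
   - every path [w] over a boundary path [r] of [fs] is a lap of exactly one
     piece over [fs].
   If [bd fs] is a proper power (as for the projective plane with boundary path
   [s s]), a rotation of [f] against [fs] by a fraction of a lap is not visible
   on the underlying paths, and two pieces over [fs] can have the same cyclic
   boundary path. Recording [lift_bd] says which subpaths of the boundary path of
   [f] are laps over a given [rot i (bd fs)]. *)
Record covering := Covering {
  source : surfaceComplex;
  target : surfaceComplex;
  cpt : point source -> point target;
  cseg : segment source -> segment target;
  cpiece : piece source -> piece target;
  lift_bd : piece source -> seq (segment source);
  cov_surj : forall p, exists q, cpt q = p;
  cov_ini : forall s, ini (cseg s) = cpt (ini s);
  cov_sinv : forall s, cseg (sinv s) = sinv (cseg s);
  cov_pinv : forall f, cpiece (pinv f) = pinv (cpiece f);
  cov_star_inj : forall s t, ini s = ini t -> cseg s = cseg t -> s = t;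
  cov_star_surj : forall p t, ini t = cpt p ->
    exists2 s, ini s = p & cseg s = t;
  lift_bd_simple : forall f, simple_boundary f (lift_bd f);
  lift_bd_pinv : forall f, lift_bd (pinv f) = path_inv (lift_bd f);
  cov_laps : forall f, exists ws : seq (seq (segment source)),
    [/\ lift_bd f = flatten ws,
        {in ws, forall w, map cseg w = bd (cpiece f)} & uniq ws];
  cov_lift : forall (fs : piece target) i (w : seq (segment source)),
    i < size (bd fs) -> is_path w -> map cseg w = rot i (bd fs) ->
    exists! f, cpiece f = fs /\
      exists j, prefix w (rot (j * size (bd fs)) (rot i (lift_bd f)))
}.

Definition branching_number (C : covering) (f : piece (source C)) (b : nat) :=
  exists ws : seq (seq (segment (source C))),
    [/\ lift_bd f = flatten ws,
        {in ws, forall w, map (@cseg C) w = bd (cpiece f)},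
        uniq ws & size ws = b.+1].

Definition branched_along (C : covering) (fs : piece (target C)) (b : nat) :=
  forall f, cpiece f = fs -> branching_number f b.

(* Renaming the elements of a complex and changing the representatives of the
   boundary paths. The modifications below determine their result only up to such
   a renaming, so it is counted among the steps of a chain. *)
Record complex_iso (K L : surfaceComplex) := ComplexIso {
  iso_pt : point K -> point L;
  iso_seg : segment K -> segment L;
  iso_piece : piece K -> piece L;
  iso_pt_bij : bijective iso_pt;
  iso_seg_bij : bijective iso_seg;
  iso_piece_bij : bijective iso_piece;
  iso_ini : forall s, ini (iso_seg s) = iso_pt (ini s);
  iso_sinv : forall s, iso_seg (sinv s) = sinv (iso_seg s);
  iso_pinv : forall f, iso_piece (pinv f) = pinv (iso_piece f);
  iso_bd : forall f, simple_boundary (iso_piece f) (map iso_seg (bd f))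
}.

(* [L] arises from [K] by replacing every segment [s] with [D s] by the path
   [sd_fst s, sd_snd s] through the new point [sd_mid s]. The values of [sd_mid],
   [sd_fst], [sd_snd] outside [D] and of [sd_seg] outside [kept D] are
   irrelevant. *)
Definition kept (K : lineComplex) (D : pred (segment K)) : pred (segment K) :=
  fun s => ~~ D s && ~~ D (sinv s).

Definition subdivided_step (K L : lineComplex) (D : pred (segment K))
    (old a b : segment K -> segment L) (s : segment K) : seq (segment L) :=
  if D s then [:: a s; b s]
  else if D (sinv s) then [:: sinv (b (sinv s)); sinv (a (sinv s))]
  else [:: old s].

Record subdivision (K L : surfaceComplex) (D : pred (segment K)) := Subdivision {
  sd_pt : point K -> point L;
  sd_mid : segment K -> point L;
  sd_seg : segment K -> segment L;
  sd_fst : segment K -> segment L;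
  sd_snd : segment K -> segment L;
  sd_piece : piece K -> piece L;
  sd_path : seq (segment K) -> seq (segment L) :=
    fun w => flatten (map (subdivided_step D sd_seg sd_fst sd_snd) w);
  sd_pt_inj : injective sd_pt;
  sd_mid_inj : {in D &, injective sd_mid};
  sd_mid_new : forall p s, D s -> sd_pt p != sd_mid s;
  sd_pt_onto : forall x,
    (exists p, x = sd_pt p) \/ (exists2 s, D s & x = sd_mid s);
  sd_seg_inj : {in kept D &, injective sd_seg};
  sd_seg_ini : forall s, kept D s -> ini (sd_seg s) = sd_pt (ini s);
  sd_seg_sinv : forall s, kept D s -> sd_seg (sinv s) = sinv (sd_seg s);
  sd_fst_ini : forall s, D s -> ini (sd_fst s) = sd_pt (ini s);
  sd_fst_fin : forall s, D s -> fin (sd_fst s) = sd_mid s;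
  sd_snd_ini : forall s, D s -> ini (sd_snd s) = sd_mid s;
  sd_snd_fin : forall s, D s -> fin (sd_snd s) = sd_pt (fin s);
  sd_fst_snd : forall s, D s -> sd_snd s != sinv (sd_fst s);
  sd_seg_onto : forall t,
    (exists2 s, kept D s & t = sd_seg s) \/
    (exists2 s, D s & t \in [:: sd_fst s; sd_snd s;
                                sinv (sd_fst s); sinv (sd_snd s)]);
  sd_piece_bij : bijective sd_piece;
  sd_pinv : forall f, sd_piece (pinv f) = pinv (sd_piece f);
  sd_bd : forall f, bd (sd_piece f) = sd_path (bd f)
}.

(* [L] arises from [K] by splitting the piece [f] with boundary path [w1 w2]
   along the new segment [sp_new]. One of [w1], [w2] may be empty. The values of
   [sp_piece] at [f] and [pinv f] are irrelevant. *)
Record splitting (K L : surfaceComplex) (f : piece K)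
    (w1 w2 : seq (segment K)) := Splitting {
  sp_pt : point K -> point L;
  sp_seg : segment K -> segment L;
  sp_piece : piece K -> piece L;
  sp_new : segment L;
  sp_fst : piece L;
  sp_snd : piece L;
  sp_bd : simple_boundary f (w1 ++ w2);
  sp_pt_bij : bijective sp_pt;
  sp_seg_inj : injective sp_seg;
  sp_seg_ini : forall s, ini (sp_seg s) = sp_pt (ini s);
  sp_seg_sinv : forall s, sp_seg (sinv s) = sinv (sp_seg s);
  sp_new_fresh : forall s, sp_seg s != sp_new;
  sp_seg_onto : forall t,
    (exists s, t = sp_seg s) \/ t = sp_new \/ t = sinv sp_new;
  sp_new_w1 : joins (ini sp_new) (map sp_seg w1) (fin sp_new);
  sp_new_w2 : joins (fin sp_new) (map sp_seg w2) (ini sp_new);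
  sp_piece_inj : {in [pred g | ~~ same_piece f g] &, injective sp_piece};
  sp_pinv : forall g, ~~ same_piece f g -> sp_piece (pinv g) = pinv (sp_piece g);
  sp_piece_bd : forall g, ~~ same_piece f g ->
    bd (sp_piece g) = map sp_seg (bd g);
  sp_fst_bd : bd sp_fst = rcons (map sp_seg w1) (sinv sp_new);
  sp_snd_bd : bd sp_snd = sp_new :: map sp_seg w2;
  sp_fst_snd : ~~ same_piece sp_fst sp_snd;
  sp_fresh : forall g, ~~ same_piece f g ->
    ~~ same_piece sp_fst (sp_piece g) && ~~ same_piece sp_snd (sp_piece g);
  sp_piece_onto : forall h,
    [\/ exists2 g, ~~ same_piece f g & h = sp_piece g,
        same_piece sp_fst h | same_piece sp_snd h]
}.

Definition complex_step (K L : surfaceComplex) : Prop :=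
  [\/ inhabited (complex_iso K L),
      exists s : segment K, inhabited (subdivision L (pred1 s)) |
      exists f w1 w2, inhabited (@splitting K L f w1 w2)].

Definition related_complexes := clos_refl_sym_trans surfaceComplex complex_step.

Definition sphere (K : surfaceComplex) : Prop :=
  exists2 S, related_complexes K S & digon S.

(* The representatives of the boundary paths of the base and the paths [lift_bd]
   may be rotated, the latter by the same amount up to full laps. *)
Definition covering_iso (C D : covering) : Prop :=
  exists (u : complex_iso (target C) (target D))
         (v : complex_iso (source C) (source D)),
    [/\ forall p, cpt (iso_pt v p) = iso_pt u (cpt p),
        forall s, cseg (iso_seg v s) = iso_seg u (cseg s),
        forall f, cpiece (iso_piece v f) = iso_piece u (cpiece f) &
        forall fs, exists i,
          [/\ i < size (bd fs),
              bd (iso_piece u fs) = rot i (map (iso_seg u) (bd fs)) &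
              forall f, cpiece f = fs -> exists j,
                lift_bd (iso_piece v f) =
                rot (j * size (bd fs)) (rot i (map (iso_seg v) (lift_bd f)))]].

Definition covering_subdivision (C D : covering) : Prop :=
  exists (s0 : segment (target C))
         (u : subdivision (target D) (pred1 s0))
         (v : subdivision (source D) (preim (@cseg C) (pred1 s0))),
    [/\ forall p, cpt (sd_pt v p) = sd_pt u (cpt p),
        forall s, kept (pred1 s0) (cseg s) ->
          cseg (sd_seg v s) = sd_seg u (cseg s),
        forall s, cseg s = s0 ->
          cseg (sd_fst v s) = sd_fst u s0 /\ cseg (sd_snd v s) = sd_snd u s0,
        forall f, cpiece (sd_piece v f) = sd_piece u (cpiece f) &
        forall f, lift_bd (sd_piece v f) = sd_path v (lift_bd f)].

(* Lifting to [D] a splitting [u] of the piece [fs] along [w1 w2]. Every path over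
   [w1] is the initial part of exactly one path [r] over [w1 w2], so the new
   segments and the small new pieces are indexed by these [r] (for empty [w1],
   the path [r] still tells the initial point). The small new pieces lie over
   [sp_fst u]; the exchanged roles are obtained by splitting [pinv fs] along
   [w2^-1 w1^-1] with the new segment [sp_new u]. *)
Record lifted_splitting (C D : covering) (fs : piece (target C))
    (w1 w2 : seq (segment (target C)))
    (u : splitting (target D) fs w1 w2) (i : nat) := LiftedSplitting {
  ls_pt : point (source C) -> point (source D);
  ls_seg : segment (source C) -> segment (source D);
  ls_piece : piece (source C) -> piece (source D);
  ls_new : seq (segment (source C)) -> segment (source D);
  ls_small : seq (segment (source C)) -> piece (source D);
  ls_large : piece (source C) -> piece (source D);
  ls_over : pred (seq (segment (source C))) :=
    fun r => is_path r && (map (@cseg C) r == w1 ++ w2);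
  ls_fst : seq (segment (source C)) -> seq (segment (source D)) :=
    fun r => map ls_seg (take (size w1) r);
  ls_snd : seq (segment (source C)) -> seq (segment (source D)) :=
    fun r => map ls_seg (drop (size w1) r);
  ls_rot : i < size (bd fs) /\ w1 ++ w2 = rot i (bd fs);
  ls_pt_bij : bijective ls_pt;
  ls_pt_over : forall p, cpt (ls_pt p) = sp_pt u (cpt p);
  ls_seg_inj : injective ls_seg;
  ls_seg_ini : forall s, ini (ls_seg s) = ls_pt (ini s);
  ls_seg_sinv : forall s, ls_seg (sinv s) = sinv (ls_seg s);
  ls_seg_over : forall s, cseg (ls_seg s) = sp_seg u (cseg s);
  ls_new_over : forall r, ls_over r -> cseg (ls_new r) = sp_new u;
  ls_new_fst : forall r, ls_over r ->
    joins (ini (ls_new r)) (ls_fst r) (fin (ls_new r));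
  ls_new_snd : forall r, ls_over r ->
    exists q, joins (fin (ls_new r)) (ls_snd r) q;
  ls_seg_onto : forall t, (exists s, t = ls_seg s) \/
    (exists2 r, ls_over r & t = ls_new r \/ t = sinv (ls_new r));
  ls_piece_inj :
    {in [pred g | ~~ same_piece fs (cpiece g)] &, injective ls_piece};
  ls_pinv : forall g, ~~ same_piece fs (cpiece g) ->
    ls_piece (pinv g) = pinv (ls_piece g);
  ls_piece_over : forall g, ~~ same_piece fs (cpiece g) ->
    cpiece (ls_piece g) = sp_piece u (cpiece g);
  ls_piece_bd : forall g, ~~ same_piece fs (cpiece g) ->
    lift_bd (ls_piece g) = map ls_seg (lift_bd g);
  ls_small_over : forall r, ls_over r -> cpiece (ls_small r) = sp_fst u;
  ls_small_bd : forall r, ls_over r ->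
    lift_bd (ls_small r) = rcons (ls_fst r) (sinv (ls_new r));
  ls_large_over : forall f, cpiece f = fs -> cpiece (ls_large f) = sp_snd u;
  ls_large_bd : forall f, cpiece f = fs ->
    exists rs : seq (seq (segment (source C))),
      [/\ all ls_over rs, rot i (lift_bd f) = flatten rs &
          lift_bd (ls_large f) = flatten [seq ls_new r :: ls_snd r | r <- rs]];
  ls_piece_onto : forall h,
    [\/ exists2 g, ~~ same_piece fs (cpiece g) & h = ls_piece g,
        exists2 r, ls_over r & same_piece (ls_small r) h |
        exists2 f, cpiece f = fs & same_piece (ls_large f) h]
}.

Definition covering_splitting (C D : covering) : Prop :=
  exists fs w1 w2 (u : splitting (target D) fs w1 w2) i,
    inhabited (@lifted_splitting C D fs w1 w2 u i).

Definition covering_step (C D : covering) : Prop :=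
  [\/ covering_iso C D, covering_subdivision C D | covering_splitting C D].

Definition elementarily_related := clos_refl_sym_trans covering covering_step.

(* Main.v *)
Require Import Defs.
From mathcomp Require Import all_boot zify.
From Stdlib Require Import Relation_Operators ClassicalEpsilon.

(** A covering with connected base is given by an action of the segments of the
base on a fixed fibre [X] ([monodromy]): points and segments of the source are
pairs of an element of the base and an element of [X], and the pieces over [f]
are the orbits in [X] of one turn around [f], whose common length [deg f] is the
branching number plus one. Every covering as in the theorem has this form up to
isomorphism ([coordinates_iso], [presentation]). A modification of the base
lifts to such coverings as soon as the actions correspond and the small piece cut
off has [deg] one ([splitting_lifts], [subdivision_lifts]), so only the base
matters any more. It is presented by a list of words, the boundary paths of its
faces, each with its order [deg] ([surf]). One can cut a face so that the part
cut off has order one, glue a face of order one to another face along an edge, and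
cancel a spur ([surf_split], [surf_merge], [surf_spur]).

First the number of points is reduced to one ([one_vertex]). Let [e] be a segment
from [p] to a different point. If other segments start at [p], a triangle with
sides [e] and its neighbour [b] is cut off and glued to the face on the other side
of [b]; this lowers the degree of [p]. When [e] is alone at [p], it is a spur and is
cancelled. The spur is not a whole face: such a face is unbranched and is the only
one of the surface, contrary to the presence of a branched face.

With one point, a monogon [s] is cut off from a branched face, the monogon keeping
the order and the rest, the hub, being unbranched. As all segments start at the
same point, the link of this point connects them, so the hub has an edge in common
with some face other than these monogons, as long as there is one. That face is
glued to the hub, and if it was branched, a monogon of the same order is cut off
again, at a corner of the hub that keeps the orders sorted ([hub_reduction]). The
boundary of the hub becomes [s_1 ... s_(n+1) r], and the last monogon is glued to it
([normal_form]).

It remains to identify [r] ([nf_sphere]). Forgetting the covering, all monogons can be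
glued to the hub. If [r] is not empty, this gives a polygon with boundary [r] and one
point, which is not a sphere: the first cohomology group with coefficients Z/2 does not
change under elementary modifications ([acyclic2_related]), vanishes for the digon
and not for the polygon. If [r] is empty, one glues all but one of the monogons; the
two monogons with common boundary that remain arise from the digon, split along a
new segment, by erasing a subdivision point ([two_monogons_sphere]). *)

Set Implicit Arguments.
Unset Strict Implicit.
Unset Printing Implicit Defensive.

(** * Words, transport along them and lifted paths *)

Section Words.
Variable T : Type.
Implicit Types w u v : seq T.

Definition wpow w m := flatten (nseq m w).

Lemma wpowS w m : wpow w m.+1 = w ++ wpow w m.
Proof. by []. Qed.

Lemma wpow1 w : wpow w 1 = w.
Proof. by rewrite /wpow /= cats0. Qed.

Lemma wpowD w a b : wpow w (a + b) = wpow w a ++ wpow w b.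
Proof. by rewrite /wpow nseqD flatten_cat. Qed.

Lemma wpowSr w m : wpow w m.+1 = wpow w m ++ w.
Proof. by rewrite -addn1 wpowD wpow1. Qed.

Lemma size_wpow w m : size (wpow w m) = m * size w.
Proof. by elim: m => //= m IH; rewrite wpowS size_cat IH mulSn. Qed.

Lemma rot_wpow i w m : i <= size w -> rot i (wpow w m) = wpow (rot i w) m.
Proof.
move=> ile; case: m => [|m]; first by rewrite /wpow /= rot_oversize.
rewrite {2}/rot -{1}(cat_take_drop i w) -{1}(size_takel ile).
move: (take i w) (drop i w) => u v.
rewrite wpowS -catA rot_size_cat -catA.
elim: m => [|m IH]; first by rewrite wpow1.
by rewrite [in RHS]wpowS -IH wpowS -!catA.
Qed.

Lemma rot_laps j w m : j <= m -> rot (j * size w) (wpow w m) = wpow w m.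
Proof.
move=> /subnKC <-.
by rewrite wpowD -size_wpow rot_size_cat -!wpowD addnC.
Qed.

Lemma take_laps j w m : j <= m -> take (j * size w) (wpow w m) = wpow w j.
Proof. by move=> /subnKC <-; rewrite wpowD -size_wpow take_size_cat. Qed.

Lemma map_wpow (S : Type) (h : T -> S) w m :
  map h (wpow w m) = flatten (nseq m (map h w)).
Proof. by elim: m => //= m IH; rewrite wpowS map_cat IH. Qed.

Lemma cycle_wpow (e : rel T) w m : cycle e w -> cycle e (wpow w m).
Proof.
case: w => [|x w] cw; first by elim: m.
elim: m => // m.
rewrite wpowS; case: m => [|m] ; first by rewrite /wpow /= cats0.
rewrite wpowS /= !rcons_cat !cat_path /= !rcons_cat !cat_path.
by move: cw; rewrite /= !rcons_path => /andP[-> ->].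
Qed.

Definition is_rot w v := exists i, v = rot i w.

Lemma is_rot_refl w : is_rot w w.
Proof. by exists 0; rewrite rot0. Qed.

Lemma is_rotP w v : is_rot w v <-> exists a b, w = a ++ b /\ v = b ++ a.
Proof.
split=> [[i ->]|[a [b [-> ->]]]].
  by exists (take i w), (drop i w); rewrite cat_take_drop.
by exists (size a); rewrite rot_size_cat.
Qed.

Lemma is_rot_sym w v : is_rot w v -> is_rot v w.
Proof. by move=> /is_rotP[a [b [-> ->]]]; apply/is_rotP; exists b, a. Qed.

Lemma is_rot_trans w v u : is_rot w v -> is_rot v u -> is_rot w u.
Proof.
move=> [i ->] [j ->].
by rewrite (rot_minn i) (rot_minn j) rot_add_mod ?geq_minr ?size_rot ?geq_minr//; eexists.
Qed.

End Words.

Lemma is_rot_map (S T : Type) (h : S -> T) w v :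
  is_rot w v -> is_rot (map h w) (map h v).
Proof. by move=> [i ->]; exists i; rewrite map_rot. Qed.

Section Transport.
Variables (S Y : Type) (act : S -> Y -> Y).
Implicit Types (w u v : seq S) (y : Y).

Definition hol w y := foldl (fun y s => act s y) y w.

(** The lift of [w] that starts at [y]: each segment is paired with the element of
the fibre from which it starts. *)
Fixpoint plift w y : seq (S * Y) :=
  if w is s :: w' then (s, y) :: plift w' (act s y) else [::].

Lemma hol_cat u v y : hol (u ++ v) y = hol v (hol u y).
Proof. by rewrite /hol foldl_cat. Qed.

Lemma hol_rcons u s y : hol (rcons u s) y = act s (hol u y).
Proof. by rewrite -cats1 hol_cat. Qed.

Lemma plift_cat u v y : plift (u ++ v) y = plift u y ++ plift v (hol u y).
Proof. by elim: u y => //= s u IH y; rewrite IH. Qed.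

Lemma plift_rcons u s y : plift (rcons u s) y = rcons (plift u y) (s, hol u y).
Proof. by rewrite -!cats1 plift_cat. Qed.

Lemma size_plift w y : size (plift w y) = size w.
Proof. by elim: w y => //= s w IH y; rewrite IH. Qed.

Lemma plift_fst w y : map fst (plift w y) = w.
Proof. by elim: w y => //= s w IH y; rewrite IH. Qed.

Lemma hol_wpow w m y : hol (wpow w m) y = iter m (hol w) y.
Proof.
by elim: m y => // m IH y; rewrite wpowSr hol_cat IH.
Qed.

Lemma plift_wpow w m y :
  plift (wpow w m) y = flatten (map (plift w) (traject (hol w) y m)).
Proof. by elim: m y => //= m IH y; rewrite wpowS plift_cat IH. Qed.

Lemma rot_plift i w y : hol w y = y ->
  rot i (plift w y) = plift (rot i w) (hol (take i w) y).
Proof.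
case: (leqP i (size w)) => [ile|/ltnW ile]; last first.
  by rewrite take_oversize // !rot_oversize ?size_plift // => ->.
rewrite -{1 2}(cat_take_drop i w) hol_cat => hy.
rewrite plift_cat -{1}(size_takel ile) -(size_plift _ y) rot_size_cat.
by rewrite /rot plift_cat hy.
Qed.

Lemma take_plift i w y : take i (plift w y) = plift (take i w) y.
Proof.
case: (leqP i (size w)) => [ile|/ltnW ile]; last first.
  by rewrite !take_oversize ?size_plift.
rewrite -{1}(cat_take_drop i w) plift_cat take_size_cat //.
by rewrite size_plift size_takel.
Qed.

Lemma drop_plift i w y : drop i (plift w y) = plift (drop i w) (hol (take i w) y).
Proof.
case: (leqP i (size w)) => [ile|/ltnW ile]; last first.
  by rewrite !drop_oversize ?size_plift.
rewrite -{1}(cat_take_drop i w) plift_cat drop_size_cat //.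
by rewrite size_plift size_takel.
Qed.

Lemma hol_take_laps i w j y : i <= size w ->
  iter j (hol (rot i w)) (hol (take i w) y) = hol (take i w) (iter j (hol w) y).
Proof.
move=> ile; elim: j => //= j ->; rewrite -!hol_cat /rot catA.
by rewrite cat_take_drop hol_cat.
Qed.

(** Boundary paths are given up to rotation; a rotation by [i] steps and [j] laps moves
the starting point of the lift along these steps and laps. *)
Lemma rot_lift_laps i j w m y : i <= size w -> j <= m ->
  hol (wpow w m) y = y ->
  rot (j * size w) (rot i (plift (wpow w m) y)) =
  plift (wpow (rot i w) m) (hol (take i w) (iter j (hol w) y)).
Proof.
move=> ile jm hy; case: m jm hy => [|m] jm hy.
  by case: j jm => // _; rewrite mul0n rot0 /wpow /= rot_oversize.
have tk : take i (wpow w m.+1) = take i w.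
  rewrite wpowS take_cat; case: ltngtP ile => // -> _.
  by rewrite subnn take0 cats0 take_size.
rewrite rot_plift // rot_wpow // tk -(size_rot i w).
rewrite rot_plift; first by rewrite rot_laps // take_laps // hol_wpow hol_take_laps.
by rewrite hol_wpow hol_take_laps // -hol_wpow hy.
Qed.

End Transport.

Lemma rot_laps_min (T : Type) (s : seq T) j m n : size s = m * n ->
  rot (j * n) s = rot (minn j m * n) s.
Proof.
move=> sz; case: (leqP j m) => [//|/ltnW jm].
by rewrite !rot_oversize // sz leq_mul2r ?jm ?leqnn orbT.
Qed.

Lemma hol_map (S T Y : Type) (act : S -> Y -> Y) (act' : T -> Y -> Y)
    (h : S -> T) w y :
  (forall s y, act' (h s) y = act s y) -> hol act' (map h w) y = hol act w y.
Proof. by move=> hE; elim: w y => //= s w IH y; rewrite hE IH. Qed.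

Lemma plift_map (S T Y : Type) (act : S -> Y -> Y) (act' : T -> Y -> Y)
    (h : S -> T) w y :
  (forall s y, act' (h s) y = act s y) ->
  plift act' (map h w) y = [seq (h sy.1, sy.2) | sy <- plift act w y].
Proof. by move=> hE; elim: w y => //= s w IH y; rewrite hE IH. Qed.

Section PathInv.
Variable K : lineComplex.
Implicit Types (u v w : seq (segment K)) (s : segment K) (p q : point K).

Lemma fin_sinv s : fin (sinv s) = ini s.
Proof. by rewrite /fin sinvK. Qed.

Lemma path_inv_cat u v : path_inv (u ++ v) = path_inv v ++ path_inv u.
Proof. by rewrite /path_inv map_cat rev_cat. Qed.

Lemma path_inv_cons s w : path_inv (s :: w) = rcons (path_inv w) (sinv s).
Proof. by rewrite /path_inv /= rev_cons. Qed.

Lemma path_inv_rcons s w : path_inv (rcons w s) = sinv s :: path_inv w.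
Proof. by rewrite /path_inv map_rcons rev_rcons. Qed.

Lemma path_invK : involutive (@path_inv K).
Proof.
move=> w; rewrite /path_inv map_rev revK -map_comp -[RHS]map_id.
by apply: eq_map => s /=; rewrite sinvK.
Qed.

Lemma size_path_inv w : size (path_inv w) = size w.
Proof. by rewrite /path_inv size_rev size_map. Qed.

Lemma path_inv_wpow w m : path_inv (wpow w m) = wpow (path_inv w) m.
Proof. by elim: m => // m IH; rewrite wpowS path_inv_cat IH -wpowSr. Qed.

Lemma joins_cat p u v q :
  joins p (u ++ v) q <-> exists2 x, joins p u x & joins x v q.
Proof.
elim: u p => [|s u IH] p /=; first by split=> [|[x /eqP -> //]]; exists p.
split=> [/andP[-> /IH[x h1 h2]]|[x /andP[-> h1] h2]]; first by exists x.
by apply/IH; exists x.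
Qed.

Lemma joins_inv p w q : joins p w q -> joins q (path_inv w) p.
Proof.
elim: w p => [|s w IH] p /=; first by rewrite eq_sym.
move=> /andP[/eqP <- /IH h]; rewrite path_inv_cons -cats1.
by apply/joins_cat; exists (fin s) => //=; rewrite eqxx fin_sinv eqxx.
Qed.

Variables (Y : Type) (act : segment K -> Y -> Y).
Hypothesis actK : forall s, cancel (act s) (act (sinv s)).

Lemma hol_inv w y : hol act (path_inv w) (hol act w y) = y.
Proof.
elim: w y => //= s w IH y; rewrite path_inv_cons hol_rcons.
by rewrite IH actK.
Qed.

Lemma hol_inj w : injective (hol act w).
Proof. by apply: can_inj (hol act (path_inv w)) _ => y; apply: hol_inv. Qed.

End PathInv.

(** * The covering defined by a monodromy action *)

(** [act s] leads from the fibre over the initial point of [s] to the fibre over its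
final point, all fibres being identified with [X]. By [deg_orbit] the orbits of one turn
around [f] all have length [deg f]. *)
Record monodromy (K : surfaceComplex) (X : countType) := Monodromy {
  act : segment K -> X -> X;
  deg : piece K -> nat;
  actK : forall s, cancel (act s) (act (sinv s));
  deg_gt0 : forall f, 0 < deg f;
  deg_pinv : forall f, deg (pinv f) = deg f;
  deg_orbit : forall f j x, (iter j (hol act (bd f)) x == x) = (deg f %| j)
}.

Section Orbits.
Variables (K : surfaceComplex) (X : countType) (mu : monodromy K X).
Implicit Types (f : piece K) (s : segment K) (x y : X) (w : seq (segment K)).

Definition turn f : X -> X := hol (act mu) (bd f).

Lemma turn_inj f : injective (turn f).
Proof. exact: hol_inj (@actK _ _ mu) _. Qed.

Lemma iter_turn_inj f j : injective (iter j (turn f)).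
Proof. by elim: j => [|j IH] x y //= /turn_inj /IH. Qed.

Lemma turn_deg f x : iter (deg mu f) (turn f) x = x.
Proof. by apply/eqP; rewrite deg_orbit. Qed.

Lemma turn_laps f k x : iter (k * deg mu f) (turn f) x = x.
Proof. by apply/eqP; rewrite deg_orbit dvdn_mull. Qed.

Lemma turn_pinv f x : turn (pinv f) (turn f x) = x.
Proof. by rewrite /turn bd_pinv hol_inv //; apply: actK. Qed.

Definition turn_orbit f x : seq X := traject (turn f) x (deg mu f).

Lemma turn_orbitP f x y : reflect (exists j, y = iter j (turn f) x) (y \in turn_orbit f x).
Proof.
apply: (iffP trajectP) => [[j _ ->]|[j ->]]; first by exists j.
exists (j %% deg mu f); first by rewrite ltn_mod deg_gt0.
by rewrite {1}(divn_eq j (deg mu f)) addnC iterD turn_laps.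
Qed.

Lemma turn_orbit_back f x j : exists k, x = iter k (turn f) (iter j (turn f) x).
Proof.
exists (j * (deg mu f).-1); rewrite -iterD -{1}(turn_laps f j x).
by congr (iter _ _ _); rewrite -mulnSr prednK // deg_gt0.
Qed.

Lemma turn_orbit_iter f x j : turn_orbit f (iter j (turn f) x) =i turn_orbit f x.
Proof.
move=> y; apply/turn_orbitP/turn_orbitP=> [[k ->]|[k ->]]; first by exists (k + j); rewrite iterD.
by have [l {1}->] := turn_orbit_back f x j; exists (k + l); rewrite iterD.
Qed.

Lemma turn_orbit_uniq f x : uniq (turn_orbit f x).
Proof.
have := deg_gt0 mu f; rewrite /turn_orbit; case E: (deg mu f) => [//|d] _.
rewrite looping_uniq; apply/negP => /trajectP[j jd].
have -> : d = j + (d - j) by lia.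
rewrite iterD => /iter_turn_inj /eqP; rewrite deg_orbit E => /dvdn_leq; lia.
Qed.

(** Since [choose] depends only on the extension of the predicate, this is the same
element for the whole orbit. *)
Definition rep f x : X := choose (mem (turn_orbit f x)) x.

Lemma turn_orbit_refl f x : x \in turn_orbit f x.
Proof. by apply/turn_orbitP; exists 0. Qed.

Lemma rep_orbit f x : rep f x \in turn_orbit f x.
Proof. exact: chooseP (turn_orbit_refl f x). Qed.

Lemma rep_lt f x : exists2 j, j < deg mu f & rep f x = iter j (turn f) x.
Proof. exact/trajectP/rep_orbit. Qed.

Lemma rep_iter f j x : rep f (iter j (turn f) x) = rep f x.
Proof.
rewrite /rep (eq_choose (Q := mem (turn_orbit f x))); last exact: turn_orbit_iter.
apply: choose_id; last exact: turn_orbit_refl.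
by apply/turn_orbitP; exists j.
Qed.

Lemma rep_turn f x : rep f (turn f x) = rep f x.
Proof. exact: (rep_iter f 1). Qed.

Lemma rep_id f x : rep f (rep f x) = rep f x.
Proof. by have [j _ E] := rep_lt f x; rewrite {1}E rep_iter. Qed.

Lemma rep_eq f x y : rep f x = rep f y -> exists j, y = iter j (turn f) x.
Proof.
move=> E; have [j _ Ex] := rep_lt f x; have [k _ Ey] := rep_lt f y.
have [l El] := turn_orbit_back f y k.
by exists (l + j); rewrite iterD -Ex E Ey.
Qed.

Lemma rep_back f x : exists2 j, j < deg mu f & x = iter j (turn f) (rep f x).
Proof.
apply/trajectP; have [j _ ->] := rep_lt f x.
by have := turn_orbit_iter f x j x; rewrite turn_orbit_refl.
Qed.

(** A turn around [pinv f] undoes a turn around [f], so the orbits are the same sets. *)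
Lemma rep_pinv f x : rep (pinv f) x = rep f x.
Proof.
have sub g z : {subset turn_orbit g z <= turn_orbit (pinv g) z}.
  move=> y /turn_orbitP[j ->]; apply/turn_orbitP; have [l El] := turn_orbit_back g z j.
  exists l; rewrite {2}El; move: {El}(iter j _ _) => t.
  by elim: l t => //= l IH t; rewrite -iterS iterSr turn_pinv.
rewrite /rep; apply: eq_choose => y /=.
by apply/idP/idP => [/sub|/sub //]; rewrite pinvK.
Qed.

End Orbits.

Section Cover.
Variables (K : surfaceComplex) (X : countType) (mu : monodromy K X).

Definition cover_ini (s : segment K * X) : point K * X := (ini s.1, s.2).
Definition cover_sinv (s : segment K * X) : segment K * X :=
  (sinv s.1, act mu s.1 s.2).

Lemma cover_sinvK : involutive cover_sinv.
Proof. by case=> s x; rewrite /cover_sinv /= sinvK actK. Qed.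

Lemma cover_sinv_neq s : cover_sinv s != s.
Proof.
by case: s => s x; apply/eqP=> -[/eqP]; rewrite (negPf (sinv_neq s)).
Qed.

Definition cover_skeleton : lineComplex :=
  @LineComplex (point K * X)%type (segment K * X)%type cover_ini cover_sinv cover_sinvK cover_sinv_neq.

Local Notation lft := (plift (act mu)).
Local Notation CS := (segment cover_skeleton).
Local Notation CP := (point cover_skeleton).

Lemma cover_fin s x :
  fin ((s, x) : CS) = (fin s, act mu s x) :> CP.
Proof. by []. Qed.

Lemma follows_lift s t x :
  follows ((s, x) : CS) ((t, act mu s x) : CS) = follows s t.
Proof. by rewrite /follows cover_fin /= /cover_ini /= xpair_eqE eqxx andbT. Qed.

Lemma path_lift s w x :
  path (@follows cover_skeleton) (s, x) (lft w (act mu s x)) =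
  path (@follows K) s w.
Proof.
elim: w s x => //= t w IH s x; rewrite -(follows_lift s t x); congr (_ && _).
exact: IH.
Qed.

Lemma is_path_lift w x : is_path (K := cover_skeleton) (lft w x) = is_path w.
Proof. by case: w x => //= s w x; exact: path_lift. Qed.

Lemma lift_unique (r : seq CS) : is_path r -> forall s r', r = s :: r' ->
  r = lft (map fst r) s.2.
Proof.
move=> + s r' Er; rewrite Er {r Er} /=; elim: r' s => [|t r IH] [s x] //=.
case/andP=> /eqP; rewrite cover_fin => -[Et Ex] /IH E.
by congr cons; rewrite /= in E *; rewrite {1}E -Ex.
Qed.

Lemma cycle_lift w x : hol (act mu) w x = x ->
  cycle (@follows cover_skeleton) (lft w x) = cycle (@follows K) w.
Proof.
case: w => //= s w hx; rewrite -(path_lift _ _ x) plift_rcons /=.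
by rewrite hx.
Qed.

Lemma joins_lift p x w q y :
  joins (K := cover_skeleton) (p, x) (lft w x) (q, y) =
  joins p w q && (hol (act mu) w x == y).
Proof.
elim: w p x => [|s w IH] p x; first by rewrite /= xpair_eqE.
rewrite [joins p _ q]/= [hol _ _ _]/= -andbA -IH.
by rewrite [LHS]/= /cover_ini /= xpair_eqE eqxx andbT.
Qed.

Lemma path_inv_lift w x :
  path_inv (lft w x : seq CS) = lft (path_inv w) (hol (act mu) w x).
Proof.
elim: w x => //= s w IH x; rewrite !path_inv_cons IH plift_rcons.
by rewrite hol_inv //; apply: actK.
Qed.

(** A piece over [f] is an orbit of one turn around [f], named by its representative. *)
Definition cover_piece : countType :=
  {fx : piece K * X | rep mu fx.1 fx.2 == fx.2}.

Lemma mk_pieceP (f : piece K) x :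
  rep mu (f, rep mu f x).1 (f, rep mu f x).2 == (f, rep mu f x).2.
Proof. by rewrite /= rep_id. Qed.

Definition mk_piece f x : cover_piece := exist _ (f, rep mu f x) (mk_pieceP f x).

Lemma mk_piece_val (g : cover_piece) : mk_piece (val g).1 (val g).2 = g.
Proof. by case: g => -[f x] /= h; apply: val_inj; rewrite /= (eqP h). Qed.

Lemma mk_piece_rep f x : mk_piece f (rep mu f x) = mk_piece f x.
Proof. by apply: val_inj; rewrite /= rep_id. Qed.

Lemma mk_piece_iter f j x : mk_piece f (iter j (turn mu f) x) = mk_piece f x.
Proof. by apply: val_inj; rewrite /= rep_iter. Qed.

Definition cover_pinv (g : cover_piece) : cover_piece :=
  mk_piece (pinv (val g).1) (val g).2.

Lemma cover_pinv_mk f x : cover_pinv (mk_piece f x) = mk_piece (pinv f) x.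
Proof. by apply: val_inj; rewrite /= !rep_pinv rep_id. Qed.

Lemma cover_pinvK : involutive cover_pinv.
Proof.
by move=> g; rewrite -(mk_piece_val g) !cover_pinv_mk pinvK.
Qed.

Lemma cover_pinv_neq g : cover_pinv g != g.
Proof.
apply/eqP => /(congr1 (fun h : cover_piece => (val h).1)) /= /eqP.
by rewrite (negPf (pinv_neq _)).
Qed.

Definition full_bd f := wpow (bd f) (deg mu f).

Definition cover_bd (g : cover_piece) : seq CS := lft (full_bd (val g).1) (val g).2.

Lemma hol_full_bd f x : hol (act mu) (full_bd f) x = x.
Proof. by rewrite hol_wpow turn_deg. Qed.

Lemma full_bd_pinv f : full_bd (pinv f) = path_inv (full_bd f).
Proof. by rewrite /full_bd bd_pinv deg_pinv path_inv_wpow. Qed.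

Lemma cover_bd_nonempty g : cover_bd g != [::].
Proof.
rewrite -size_eq0 size_plift size_wpow muln_eq0 size_eq0.
by rewrite (negPf (bd_nonempty _)) orbF -lt0n deg_gt0.
Qed.

Lemma cover_bd_closed g : cycle (@follows cover_skeleton) (cover_bd g).
Proof.
rewrite cycle_lift ?hol_full_bd //; apply: cycle_wpow; exact: bd_closed.
Qed.

Lemma cover_bd_pinv g : cover_bd (cover_pinv g) = path_inv (cover_bd g).
Proof.
rewrite path_inv_lift hol_full_bd /cover_bd /= full_bd_pinv rep_pinv.
by case: g => -[f x] /= /eqP ->.
Qed.

Definition cover_complex : surfaceComplex :=
  SurfaceComplex cover_pinvK cover_pinv_neq cover_bd_nonempty cover_bd_closed
    cover_bd_pinv.

Lemma rot_cover_bd f x i j : i <= size (bd f) -> j <= deg mu f ->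
  rot (j * size (bd f)) (rot i (cover_bd (mk_piece f x))) =
  lft (wpow (rot i (bd f)) (deg mu f))
      (hol (act mu) (take i (bd f)) (iter j (turn mu f) (rep mu f x))).
Proof. by move=> il jl; rewrite rot_lift_laps // hol_full_bd. Qed.

Lemma cover_bd_laps (g : cover_piece) : exists ws : seq (seq CS),
  [/\ cover_bd g = flatten ws,
      {in ws, forall w, map fst w = bd (val g).1}, uniq ws &
      size ws = deg mu (val g).1].
Proof.
exists (map (lft (bd (val g).1)) (turn_orbit mu (val g).1 (val g).2)); split.
- by rewrite /cover_bd plift_wpow.
- by move=> w /mapP[z _ ->]; rewrite plift_fst.
- rewrite map_inj_uniq ?turn_orbit_uniq // => y z.
  by have := bd_nonempty (val g).1; case: (bd _) => //= s w _ [].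
- by rewrite size_map size_traject.
Qed.

Lemma cover_star_inj (s t : CS) : ini s = ini t -> s.1 = t.1 -> s = t.
Proof. by case: s t => [s x] [t y] [_ ->] /= ->. Qed.

Lemma cover_star_surj (p : CP) (t : segment K) :
  ini t = p.1 -> exists2 s : CS, ini s = p & s.1 = t.
Proof. by case: p => p x /= <-; exists (t, x). Qed.

(** A path over [rot i (bd fs)] is determined by its starting point. Going back along the
first [i] segments of [bd fs] from there leads to an element of [X], whose orbit is the
only piece that contains the path as a lap. *)
Lemma cover_cov_lift (fs : piece K) i (w : seq CS) :
  i < size (bd fs) -> is_path w -> map fst w = rot i (bd fs) ->
  exists! g : cover_piece, (val g).1 = fs /\
    exists j, prefix w (rot (j * size (bd fs)) (rot i (cover_bd g))).
Proof.
move=> il pw Ew.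
have [s [r' Er]] : exists s r', w = s :: r'.
  by case: w Ew {pw} => [/(congr1 size)|s r' _]; [rewrite size_rot; case: size il|
    exists s, r'].
have := lift_unique pw Er; rewrite Ew; set y := s.2 => Wy.
pose x := hol (act mu) (path_inv (take i (bd fs))) y.
have hx : hol (act mu) (take i (bd fs)) x = y.
  rewrite /x -{1}(path_invK (take i (bd fs))) hol_inv //; exact: actK.
exists (mk_piece fs x); split; [split=> //|].
  have [j jl Ej] := rep_back mu fs x.
  exists j; rewrite rot_cover_bd // -?Ej ?hx 1?ltnW //.
  have := deg_gt0 mu fs; case: (deg mu fs) => // d _.
  by rewrite wpowS plift_cat Wy prefix_prefix.
move=> g [Eg [j]]; rewrite -(mk_piece_val g) Eg.
rewrite (@rot_laps_min _ _ _ (deg mu fs)); last first.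
  by rewrite size_rot size_plift size_wpow.
rewrite rot_cover_bd ?geq_minr //; last exact: ltnW.
set z := iter _ _ _ => pz.
have -> : mk_piece fs x = mk_piece fs z; last by rewrite mk_piece_iter mk_piece_rep.
congr mk_piece; apply: (hol_inj (@actK _ _ mu) (w := take i (bd fs))).
rewrite hx /y; case/prefixP: pz => v; rewrite Er.
have := deg_gt0 mu fs; case: (deg mu fs) => // d _.
have : rot i (bd fs) != [::] by rewrite -size_eq0 size_rot size_eq0 bd_nonempty.
by rewrite wpowS; case: (rot i (bd fs)) => // t u _ [<-].
Qed.

Variable x0 : X.

Lemma cover_surj (p : point K) : exists q : CP, q.1 = p.
Proof. by exists (p, x0). Qed.

Lemma cover_cov_laps (g : cover_piece) : exists ws : seq (seq CS),
  [/\ cover_bd g = flatten ws,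
      {in ws, forall w, map fst w = bd (val g).1} & uniq ws].
Proof. by have [ws [? ? ? _]] := cover_bd_laps g; exists ws. Qed.

Definition monodromy_cover : covering :=
  @Covering cover_complex K fst fst (fun g => (val g).1) cover_bd cover_surj
    (fun _ => erefl) (fun _ => erefl) (fun _ => erefl) cover_star_inj
    cover_star_surj (fun g => is_rot_refl (cover_bd g)) cover_bd_pinv
    cover_cov_laps cover_cov_lift.

Lemma cover_branched f : @branched_along monodromy_cover f (deg mu f).-1.
Proof.
move=> g <-; have [ws [E lapsE uws sz]] := cover_bd_laps g.
by exists ws; split=> //; rewrite sz prednK ?deg_gt0.
Qed.

End Cover.

(** * Coordinates on an arbitrary covering *)

Lemma inj_surj_bij (S : choiceType) (T : eqType) (h : S -> T) :
  injective h -> (forall y, exists x, h x = y) -> bijective h.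
Proof.
move=> hi hs.
have hs' y : exists x, h x == y by have [x <-] := hs y; exists x.
exists (fun y => xchoose (hs' y)) => [x|y]; last exact/eqP/(xchooseP (hs' y)).
by apply: hi; apply/eqP/(xchooseP (hs' (h x))).
Qed.

Lemma bij_onto (S T : Type) (h : S -> T) : bijective h -> forall y, exists x, h x = y.
Proof. by case=> g _ gK y; exists (g y). Qed.

Section Coordinates.
Variables (C : covering) (L : surfaceComplex) (X : countType).
Variables (mu : monodromy L X) (x0 : X) (u : complex_iso (target C) L).
Variables (rho : piece (target C) -> nat) (c : point (source C) -> X).
Hypothesis c_act : forall s : segment (source C),
  c (fin s) = act mu (iso_seg u (cseg s)) (c (ini s)).
Hypothesis c_inj : forall p q, cpt p = cpt q -> c p = c q -> p = q.
Hypothesis c_surj : forall (p : point (target C)) x, exists q, cpt q = p /\ c q = x.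
Hypothesis c_deg : forall f : piece (source C),
  branching_number f (deg mu (iso_piece u (cpiece f))).-1.
Hypothesis rho_lt : forall fs, rho fs < size (bd fs).
Hypothesis rho_bd : forall fs,
  bd (iso_piece u fs) = rot (rho fs) (map (iso_seg u) (bd fs)).
Hypothesis rho_pinv : forall fs,
  (rho fs = 0 /\ rho (pinv fs) = 0) \/ rho fs + rho (pinv fs) = size (bd fs).

Local Notation us s := (iso_seg u s).
Local Notation W fs := (map (iso_seg u) (bd fs)).
Local Notation k fs := (deg mu (iso_piece u fs)).
Local Notation CS := (segment (cover_skeleton mu)).

Definition coord_pt (p : point (source C)) : point L * X := (iso_pt u (cpt p), c p).
Definition coord_seg (s : segment (source C)) : segment L * X :=
  (us (cseg s), c (ini s)).

Lemma coord_pt_bij : bijective coord_pt.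
Proof.
apply: inj_surj_bij => [p q [/(bij_inj (iso_pt_bij u))]|[p x]]; first exact: c_inj.
have [p' <-] := bij_onto (iso_pt_bij u) p.
by have [q [<- <-]] := c_surj p' x; exists q.
Qed.

Lemma coord_seg_inj : injective coord_seg.
Proof.
move=> s t [/(bij_inj (iso_seg_bij u)) Es Ec].
apply: cov_star_inj (Es); apply: c_inj => //.
by rewrite -!cov_ini Es.
Qed.

Lemma coord_seg_bij : bijective coord_seg.
Proof.
apply: inj_surj_bij coord_seg_inj _ => -[t x].
have [t' <-] := bij_onto (iso_seg_bij u) t.
have [q [Eq <-]] := c_surj (ini t') x.
have [s <- <-] := cov_star_surj (esym Eq).
by exists s.
Qed.

Lemma coord_path (w : seq (segment (source C))) s : path (@follows _) s w ->
  map coord_seg w = plift (act mu) (map (fun s => us (cseg s)) w) (c (fin s)).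
Proof.
elim: w s => //= t w IH s /andP[/eqP E /IH ->].
by rewrite /coord_seg -E c_act.
Qed.

Lemma lift_bd_cycle f : cycle (@follows _) (@lift_bd C f).
Proof. by have [i ->] := lift_bd_simple f; rewrite rot_cycle bd_closed. Qed.

Lemma cseg_lift_bd f : map (@cseg C) (lift_bd f) = wpow (bd (cpiece f)) (k (cpiece f)).
Proof.
have [ws [-> lapsE _]] := c_deg f; rewrite prednK ?deg_gt0 // => <-.
rewrite map_flatten; elim: ws lapsE => //= w ws IH h.
rewrite wpowS IH => [|v vw]; last by apply: h; rewrite inE vw orbT.
by rewrite h ?mem_head.
Qed.

Definition base f : X := if @lift_bd C f is s :: _ then c (ini s) else x0.

Lemma size_lift_bd f : size (@lift_bd C f) = k (cpiece f) * size (bd (cpiece f)).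
Proof. by rewrite -(size_map (@cseg C)) cseg_lift_bd size_wpow. Qed.

Lemma coord_lift_bd f : map coord_seg (@lift_bd C f) =
  plift (act mu) (wpow (W (cpiece f)) (k (cpiece f))) (base f).
Proof.
rewrite /wpow -map_wpow -/(wpow _ _) -cseg_lift_bd -map_comp /base.
have := lift_bd_cycle f; case: (lift_bd f) => //= s w.
by rewrite rcons_path => /andP[/coord_path -> _]; rewrite -c_act.
Qed.

(** The boundary path is closed, so it starts at the same point as its inverse. *)
Lemma base_pinv f : base (pinv f) = base f.
Proof.
rewrite /base lift_bd_pinv; have := lift_bd_cycle f.
case: (lift_bd f) => // s w; rewrite /= rcons_path => /andP[_].
by rewrite lastI path_inv_rcons => /eqP ->.
Qed.

Lemma sizeW fs : size (W fs) = size (bd fs).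
Proof. exact: size_map. Qed.

Definition base' f := hol (act mu) (take (rho (cpiece f)) (W (cpiece f))) (base f).

Lemma iter_turnE fs j y :
  iter j (turn mu (iso_piece u fs)) (hol (act mu) (take (rho fs) (W fs)) y) =
  hol (act mu) (take (rho fs) (W fs)) (iter j (hol (act mu) (W fs)) y).
Proof.
by rewrite /turn rho_bd hol_take_laps // sizeW ltnW.
Qed.

Lemma hol_W_deg fs y : hol (act mu) (wpow (W fs) (k fs)) y = y.
Proof.
rewrite hol_wpow; apply: (hol_inj (@actK _ _ mu) (w := take (rho fs) (W fs))).
by rewrite -iter_turnE turn_deg.
Qed.

Lemma lift_path t (w : seq (segment (target C))) :
  path (@follows _) (cseg t) w ->
  exists2 r, path (@follows _) t r & map (@cseg C) r = w.
Proof.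
elim: w t => [|s w IH] t; first by exists [::].
rewrite /= => /andP[/eqP Es pw].
have [s' Es' Ecs] : exists2 s' : segment (source C), ini s' = fin t & cseg s' = s.
  by apply: cov_star_surj; rewrite Es /fin -cov_sinv cov_ini.
have [|r pr Er] := IH s'; first by rewrite Ecs.
by exists (s' :: r); rewrite /= ?pr ?Er ?Ecs // andbT; apply/eqP.
Qed.

(** The orbit of the point from which the rotated boundary path of the piece starts. *)
Definition coord_piece f := mk_piece mu (iso_piece u (cpiece f)) (base' f).

Lemma coord_piece_laps f : exists j,
  cover_bd (coord_piece f) =
  rot (j * size (bd (cpiece f))) (rot (rho (cpiece f)) (map coord_seg (lift_bd f))).
Proof.
rewrite coord_lift_bd; have [j jl Ej] := rep_lt mu (iso_piece u (cpiece f)) (base' f).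
exists j; rewrite -sizeW rot_lift_laps ?hol_W_deg ?sizeW 1?ltnW //.
by rewrite /cover_bd /= Ej -rho_bd /base' iter_turnE.
Qed.

Lemma coord_piece_pinv f : coord_piece (pinv f) = cover_pinv (coord_piece f).
Proof.
rewrite /coord_piece cover_pinv_mk cov_pinv iso_pinv.
apply: val_inj; rewrite /= !rep_pinv; congr pair.
rewrite /base' base_pinv cov_pinv.
case: (rho_pinv (cpiece f)) => [[-> ->]|E]; first by rewrite !take0.
have -> : take (rho (pinv (cpiece f))) (W (pinv (cpiece f))) =
    path_inv (drop (rho (cpiece f)) (W (cpiece f))).
  rewrite bd_pinv /path_inv map_rev -map_comp.
  rewrite (@eq_map _ _ _ (@sinv L \o iso_seg u)); last by move=> s /=; rewrite iso_sinv.
  rewrite map_comp take_rev size_map sizeW -map_drop; congr (rev (map _ _)).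
  by congr drop; lia.
set d := drop _ _; set y := base f.
rewrite -(rep_turn mu (iso_piece u (cpiece f))) /turn rho_bd /rot hol_cat -/d.
by rewrite -{1}(path_invK d) hol_inv //; exact: actK.
Qed.

Lemma coord_piece_bij : bijective coord_piece.
Proof.
apply: inj_surj_bij => [f g E|h].
  have Efs : cpiece f = cpiece g.
    apply: (bij_inj (iso_piece_bij u)).
    by have /= := congr1 (fun h : cover_piece mu => (val h).1) E.
  have [j jl Ej] : exists2 j, j < k (cpiece f) & base' g = iter j (turn mu (iso_piece u (cpiece f))) (base' f).
    apply/trajectP; apply/turn_orbitP; apply: rep_eq.
    by have := congr1 (fun h : cover_piece mu => (val h).2) E; rewrite /= Efs.
  have {}Ej : base g = iter j (hol (act mu) (W (cpiece f))) (base f).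
    move: Ej; rewrite /base' -Efs iter_turnE; exact: (hol_inj (@actK _ _ mu)).
  have Elaps : rot (j * size (bd (cpiece f))) (lift_bd f) = lift_bd g.
    apply: (inj_map coord_seg_inj); rewrite map_rot coord_lift_bd -sizeW.
    rewrite -(rot0 (plift _ _ _)) rot_lift_laps ?hol_W_deg ?(ltnW jl) //.
    by rewrite rot0 take0 /= -Ej Efs -coord_lift_bd.
  pose w := take (size (bd (cpiece f))) (lift_bd g).
  have pw : is_path w.
    apply: take_sorted; have := lift_bd_cycle g; case: (lift_bd g) => //= s r.
    by rewrite rcons_path => /andP[].
  have Ew : map (@cseg C) w = rot 0 (bd (cpiece f)).
    rewrite rot0 map_take cseg_lift_bd -Efs.
    by have := deg_gt0 mu (iso_piece u (cpiece f)); case: (k _) => // d _;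
      rewrite wpowS take_size_cat.
  have bd0 : 0 < size (bd (cpiece f)) by rewrite lt0n size_eq0 bd_nonempty.
  have [h [_ uh]] := cov_lift bd0 pw Ew.
  rewrite -(uh f); last first.
    split=> //; exists j; rewrite rot0 Elaps; apply/prefixP.
    by exists (drop (size (bd (cpiece f))) (lift_bd g)); rewrite cat_take_drop.
  apply: uh; split=> //; exists 0; rewrite mul0n !rot0; apply/prefixP.
  by exists (drop (size (bd (cpiece f))) (lift_bd g)); rewrite cat_take_drop.
have [fs Efs] := bij_onto (iso_piece_bij u) (val h).1.
rewrite -(mk_piece_val h) -Efs; move: (val h).2 => x {h Efs}.
pose y := hol (act mu) (path_inv (take (rho fs) (W fs))) x.
have hy : hol (act mu) (take (rho fs) (W fs)) y = x.
  rewrite /y -{1}(path_invK (take (rho fs) (W fs))) hol_inv //; exact: actK.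
have [w pw [Ew bw]] : exists2 w, is_path w & map (@cseg C) w = bd fs /\
    if w is s :: _ then c (ini s) = y else False.
  have := bd_nonempty fs; have := bd_closed fs; case: (bd fs) => //= s w.
  rewrite rcons_path => /andP[pw _] _.
  have [q [Eq Ecq]] := c_surj (ini s) y.
  have [s' Es' Ecs] := cov_star_surj (esym Eq).
  have [|r pr Er] := @lift_path s' w; first by rewrite Ecs.
  by exists (s' :: r); rewrite //= Ecs Er Es'.
have bd0 : 0 < size (bd fs) by rewrite lt0n size_eq0 bd_nonempty.
have [f [[Ef [j pf]] _]] := cov_lift bd0 pw (etrans Ew (esym (rot0 _))); move: pf.
rewrite rot0 (@rot_laps_min _ _ _ (k fs)); last by rewrite size_lift_bd Ef.
set j' := minn _ _ => /prefixP[v Ev]; exists f.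
rewrite /coord_piece /base' Ef; apply: val_inj => /=; congr pair.
have := congr1 (map coord_seg) Ev.
rewrite map_rot coord_lift_bd Ef -sizeW -(rot0 (plift _ _ _)).
rewrite rot_lift_laps ?hol_W_deg ?geq_minr // rot0 take0 /= -hy.
case: w bw {pw Ew Ev} => // s w <-.
have := deg_gt0 mu (iso_piece u fs); case: (k fs) => // d _; rewrite wpowS.
have := bd_nonempty fs; case E: (bd fs) => [//|t r] _ [_ <- _].
rewrite -[us t :: _]/(map (iso_seg u) (t :: r)) -E.
by rewrite -iter_turnE rep_iter. 
Qed.

Lemma coord_bd f : simple_boundary (K := cover_complex mu)
  (coord_piece f) (map coord_seg (bd f)).
Proof.
have [i Ei] := lift_bd_simple f; have [j Ej] := coord_piece_laps f.
apply/is_rot_sym; apply: is_rot_trans (is_rot_map _ _) _; first by exists i; exact: Ei.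
by rewrite [bd _]Ej; apply: is_rot_trans; eexists; reflexivity.
Qed.

Definition coord_iso : complex_iso (source C) (cover_complex mu).
Proof.
apply: (@ComplexIso _ _ (coord_pt : _ -> point (cover_complex mu))
  (coord_seg : _ -> segment (cover_complex mu)) coord_piece).
- exact: coord_pt_bij.
- exact: coord_seg_bij.
- exact: coord_piece_bij.
- by move=> s; rewrite /coord_pt -cov_ini -iso_ini.
- by move=> s; rewrite /coord_seg cov_sinv iso_sinv -/(fin s) c_act.
- exact: coord_piece_pinv.
- exact: coord_bd.
Defined.

(** The points of [C] are coordinatized by their image and an element [c p] of the fibre,
and [c_act] says that [mu] describes the lifting of segments in these coordinates. The
boundary paths of the base may be rotated by [rho], which allows the same lemma to
change the representatives of these paths. *)
Lemma coordinates_iso : covering_iso C (monodromy_cover mu x0).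
Proof.
exists u, coord_iso; split=> // fs; exists (rho fs).
by split=> [||f <-]; [exact: rho_lt|exact: rho_bd|exact: coord_piece_laps].
Qed.

End Coordinates.

(** * Lifting splittings and subdivisions of the base *)

Lemma rep_ext (K L : surfaceComplex) (X : countType) (mu : monodromy K X)
    (nu : monodromy L X) g h :
  turn mu g =1 turn nu h -> deg mu g = deg nu h -> rep mu g =1 rep nu h.
Proof.
move=> Et Ed x; have Eo : turn_orbit mu g x = turn_orbit nu h x.
  rewrite /turn_orbit Ed; elim: (deg nu h) x => //= d IH x.
  by rewrite IH Et.
by rewrite /rep Eo.
Qed.

Section LiftSplitting.
Variables (K L : surfaceComplex) (X : countType) (x0 : X).
Variables (mu : monodromy K X) (nu : monodromy L X).
Variables (f : piece K) (w1 w2 : seq (segment K)) (u : splitting L f w1 w2).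
Hypothesis bd_f : bd f = w1 ++ w2.
Hypothesis act_seg : forall s x, act nu (sp_seg u s) x = act mu s x.
Hypothesis deg_piece : forall g, ~~ same_piece f g -> deg nu (sp_piece u g) = deg mu g.
Hypothesis deg_snd : deg nu (sp_snd u) = deg mu f.
Hypothesis deg_fst : deg nu (sp_fst u) = 1.

Local Notation lft := (plift (act mu)).
Local Notation CK := (cover_complex mu).
Local Notation CL := (cover_complex nu).

Definition split_pt (p : point CK) : point CL := (sp_pt u p.1, p.2).
Definition split_seg (s : segment CK) : segment CL := (sp_seg u s.1, s.2).
Definition split_piece (g : piece CK) : piece CL :=
  mk_piece nu (sp_piece u (val g).1) (val g).2.
Definition start (r : seq (segment CK)) : X := if r is s :: _ then s.2 else x0.
Definition split_new (r : seq (segment CK)) : segment CL := (sp_new u, start r).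
Definition split_small (r : seq (segment CK)) : piece CL :=
  mk_piece nu (sp_fst u) (start r).
Definition split_large (g : piece CK) : piece CL :=
  mk_piece nu (sp_snd u) (val g).2.
Definition over (r : seq (segment CK)) :=
  is_path r && (map (@cseg (monodromy_cover mu x0)) r == w1 ++ w2).

Lemma hol_seg w x : hol (act nu) (map (sp_seg u) w) x = hol (act mu) w x.
Proof. exact: hol_map. Qed.

Lemma plift_seg w x : plift (act nu) (map (sp_seg u) w) x = map split_seg (lft w x).
Proof. exact: plift_map. Qed.

(** One turn around the small part is the identity, so the new segment acts as the path
to which it is parallel. *)
Lemma act_new x : act nu (sp_new u) x = hol (act mu) w1 x.
Proof.
have := turn_deg nu (sp_fst u) x; rewrite deg_fst /= /turn sp_fst_bd hol_rcons hol_seg.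
by move=> {1}<-; rewrite -{1}(sinvK (sp_new u)) actK.
Qed.

Lemma turn_snd : turn nu (sp_snd u) =1 turn mu f.
Proof. by move=> x; rewrite /turn sp_snd_bd /= act_new hol_seg bd_f hol_cat. Qed.

Lemma turn_piece g : ~~ same_piece f g -> turn nu (sp_piece u g) =1 turn mu g.
Proof. by move=> gf x; rewrite /turn sp_piece_bd // hol_seg. Qed.

Lemma rep_piece g : ~~ same_piece f g -> rep nu (sp_piece u g) =1 rep mu g.
Proof. by move=> gf; apply: rep_ext; [exact: turn_piece|exact: deg_piece]. Qed.

Lemma rep_snd : rep nu (sp_snd u) =1 rep mu f.
Proof. by apply: rep_ext; [exact: turn_snd|exact: deg_snd]. Qed.

Lemma rep_fst x : rep nu (sp_fst u) x = x.
Proof.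
by have [j] := rep_lt nu (sp_fst u) x; rewrite deg_fst ltnS leqn0 => /eqP -> ->.
Qed.

Lemma overE r : over r -> r = lft (w1 ++ w2) (start r).
Proof.
case/andP=> pr /eqP Er; case: r pr Er => [|s r] pr Er.
  by have := bd_nonempty f; rewrite bd_f -Er.
by rewrite -Er; exact: lift_unique pr _ _ erefl.
Qed.

Lemma over_lift x : over (lft (w1 ++ w2) x).
Proof.
rewrite /over plift_fst eqxx andbT.
rewrite (is_path_lift mu) -bd_f; have := bd_closed f; case: (bd f) => //= s w.
by rewrite rcons_path => /andP[].
Qed.

Lemma start_lift x : start (lft (w1 ++ w2) x) = x.
Proof. by have := bd_nonempty f; rewrite bd_f; case: (w1 ++ w2). Qed.

Lemma start_seg r : over r -> map split_seg (take (size w1) r) =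
  plift (act nu) (map (sp_seg u) w1) (start r).
Proof. by move=> /overE ->; rewrite start_lift take_plift take_size_cat // plift_seg. Qed.

Lemma end_seg r : over r -> map split_seg (drop (size w1) r) =
  plift (act nu) (map (sp_seg u) w2) (act nu (sp_new u) (start r)).
Proof.
move=> /overE ->; rewrite start_lift drop_plift take_size_cat // drop_size_cat //.
by rewrite plift_seg act_new.
Qed.

(** One turn around the large part acts as one turn around [f] did ([turn_snd]), so the
pieces over both are the same orbits, and every element of [X] names one small piece. *)
Lemma splitting_lifts :
  covering_splitting (monodromy_cover mu x0) (monodromy_cover nu x0).
Proof.
exists f, w1, w2, u, 0; split.
apply: (@LiftedSplitting (monodromy_cover mu x0) (monodromy_cover nu x0) f w1 w2 u 0
  split_pt split_seg split_piece split_new split_small split_large).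
- by rewrite rot0 bd_f; split=> //; rewrite -bd_f lt0n size_eq0 bd_nonempty.
- case: (sp_pt_bij u) => g gK Kg.
  by exists (fun p : point CL => (g p.1, p.2)) => -[p x]; rewrite /split_pt /= ?gK ?Kg.
- by [].
- by move=> [s x] [t y] [/(@sp_seg_inj _ _ _ _ _ u) -> ->].
- by move=> [s x]; rewrite /split_seg /split_pt /= /cover_ini /= sp_seg_ini.
- by move=> [s x]; rewrite /split_seg /= /cover_sinv /= sp_seg_sinv act_seg.
- by [].
- by [].
- move=> r ro; rewrite start_seg //.
  have := joins_lift nu (ini (sp_new u)) (start r) (map (sp_seg u) w1)
    (fin (sp_new u)) (act nu (sp_new u) (start r)).
  by rewrite sp_new_w1 hol_seg -act_new eqxx => h; exact: h.
- move=> r ro; rewrite end_seg //.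
  set y := act nu (sp_new u) (start r).
  exists (ini (sp_new u), hol (act nu) (map (sp_seg u) w2) y).
  have := joins_lift nu (fin (sp_new u)) y (map (sp_seg u) w2)
    (ini (sp_new u)) (hol (act nu) (map (sp_seg u) w2) y).
  by rewrite sp_new_w2 eqxx => h; exact: h.
- case=> t x; case: (sp_seg_onto u t) => [[s ->]|Et]; first by left; exists (s, x).
  right; case: Et => ->.
    by exists (lft (w1 ++ w2) x); [exact: over_lift|left; rewrite /split_new start_lift].
  exists (lft (w1 ++ w2) (act nu (sinv (sp_new u)) x)); first exact: over_lift.
  right; rewrite /split_new start_lift /= /cover_sinv /=.
  by congr pair; have := actK nu (sinv (sp_new u)) x; rewrite sinvK => ->.
- move=> g h; rewrite !inE => /= gf hf E.
  have E1 : (val g).1 = (val h).1.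
    apply: (@sp_piece_inj _ _ _ _ _ u); rewrite ?inE //.
    by have /= := congr1 (fun h : cover_piece nu => (val h).1) E.
  have /= := congr1 (fun h : cover_piece nu => (val h).2) E.
  rewrite !rep_piece // => E2; rewrite -(mk_piece_val g) -(mk_piece_val h).
  by rewrite -mk_piece_rep E2 E1 mk_piece_rep.
- move=> g gf; apply: val_inj; rewrite /= sp_pinv // !rep_pinv rep_id.
  by rewrite !rep_piece // rep_id.
- by [].
- move=> g gf; rewrite [lift_bd _]/= /cover_bd /= rep_piece //.
  rewrite (eqP (valP g)) /full_bd sp_piece_bd // deg_piece //.
  by rewrite -plift_seg map_wpow.
- by [].
- move=> r ro; rewrite [lift_bd _]/= start_seg // /cover_bd /= rep_fst /full_bd.
  rewrite deg_fst wpow1 sp_fst_bd plift_rcons; congr rcons.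
  by rewrite /split_new /= /cover_sinv /= act_new hol_seg.
- by [].
- move=> g /= Eg; have rg : rep mu f (val g).2 = (val g).2.
    by rewrite -Eg; exact/eqP/(valP g).
  exists (map (lft (w1 ++ w2)) (turn_orbit mu f (val g).2)); split.
  + by apply/allP => r /mapP[x _ ->]; exact: over_lift.
  + rewrite rot0 /cover_bd Eg /full_bd bd_f plift_wpow -bd_f.
    by [].
  rewrite /cover_bd /= rep_snd rg /full_bd plift_wpow -map_comp.
  congr flatten; have -> : traject (hol (act nu) (bd (sp_snd u))) (val g).2 (deg nu (sp_snd u)) = turn_orbit mu f (val g).2.
    rewrite /turn_orbit deg_snd; elim: (deg mu f) (val g).2 => //= d IH x.
    by rewrite IH -turn_snd.
  apply: eq_map => x; rewrite /= sp_snd_bd /= end_seg ?over_lift //.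
  by rewrite /split_new start_lift.
- move=> h; rewrite -(mk_piece_val h); move: (val h).1 (val h).2 => h1 x {h}.
  have same (g : piece L) (y : X) : same_piece g h1 ->
      same_piece (K := CL) (mk_piece nu g y) (mk_piece nu h1 y).
    by case/orP=> /eqP ->; rewrite /same_piece -?cover_pinv_mk eqxx ?orbT.
  case: (sp_piece_onto u h1) => [[g gf ->]|/same sm|/same sm].
  + constructor 1; exists (mk_piece mu g x) => //.
    by apply: val_inj; rewrite /= !rep_piece // rep_id.
  + constructor 2; exists (lft (w1 ++ w2) x); first exact: over_lift.
    by rewrite /split_small start_lift.
  + constructor 3; exists (mk_piece mu f x) => //.
    by rewrite /split_large /= -rep_snd mk_piece_rep.
Qed.

End LiftSplitting.

Lemma actKV (K : surfaceComplex) (X : countType) (mu : monodromy K X) s :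
  cancel (act mu (sinv s)) (act mu s).
Proof. by move=> x; have := actK mu (sinv s) x; rewrite sinvK. Qed.

Section LiftSubdivision.
Variables (K L : surfaceComplex) (X : countType) (x0 : X).
Variables (mu : monodromy K X) (nu : monodromy L X).
Variables (s0 : segment K) (u : subdivision L (pred1 s0)).
Hypothesis act_seg : forall s x, kept (pred1 s0) s ->
  act nu (sd_seg u s) x = act mu s x.
Hypothesis act_halves : forall x,
  act nu (sd_snd u s0) (act nu (sd_fst u s0) x) = act mu s0 x.
Hypothesis deg_piece : forall g, deg nu (sd_piece u g) = deg mu g.

Local Notation CK := (cover_complex mu).
Local Notation CL := (cover_complex nu).
Local Notation D := (preim (@cseg (monodromy_cover mu x0)) (pred1 s0)).

Definition subd_pt (p : point CK) : point CL := (sd_pt u p.1, p.2).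
Definition subd_mid (s : segment CK) : point CL :=
  (sd_mid u s.1, act nu (sd_fst u s.1) s.2).
Definition subd_seg (s : segment CK) : segment CL := (sd_seg u s.1, s.2).
Definition subd_fst (s : segment CK) : segment CL := (sd_fst u s.1, s.2).
Definition subd_snd (s : segment CK) : segment CL :=
  (sd_snd u s.1, act nu (sd_fst u s.1) s.2).
Definition subd_piece (g : piece CK) : piece CL :=
  mk_piece nu (sd_piece u (val g).1) (val g).2.

Local Notation step := (subdivided_step (pred1 s0) (sd_seg u) (sd_fst u) (sd_snd u)).
Local Notation cstep := (subdivided_step D subd_seg subd_fst subd_snd).

Lemma step_lift s x : plift (act nu) (step s) x = cstep (s, x) /\
  hol (act nu) (step s) x = act mu s x.
Proof.
rewrite /subdivided_step /=; case: eqP => [->|/eqP ns] //=.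
case: eqP => [Es|/eqP ns'] /=; last first.
  by rewrite /subd_seg /= act_seg // /kept /= ns ns'.
rewrite /subd_seg /subd_snd /subd_fst /= Es /cover_sinv /=.
have sK : act mu s0 (act mu s x) = x by rewrite -Es actK.
have Ey : act nu (sinv (sd_snd u s0)) x = act nu (sd_fst u s0) (act mu s x).
  by rewrite -{1}sK -act_halves actK.
by rewrite act_halves sK Ey actK.
Qed.

Lemma path_lift_sd w x :
  plift (act nu) (sd_path u w) x = flatten (map cstep (plift (act mu) w x)) /\
  hol (act nu) (sd_path u w) x = hol (act mu) w x.
Proof.
elim: w x => //= s w IH x; rewrite /sd_path /= plift_cat hol_cat.
by have [-> ->] := step_lift s x; have [<- <-] := IH (act mu s x).
Qed.

Lemma turn_sd g : turn nu (sd_piece u g) =1 turn mu g.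
Proof. by move=> x; rewrite /turn sd_bd; have [_ ->] := path_lift_sd (bd g) x. Qed.

Lemma rep_sd g : rep nu (sd_piece u g) =1 rep mu g.
Proof. by apply: rep_ext; [exact: turn_sd|]. Qed.

Lemma sd_path_wpow w m : sd_path u (wpow w m) = wpow (sd_path u w) m.
Proof.
by elim: m => // m IH; rewrite !wpowS -IH /sd_path map_cat flatten_cat.
Qed.

Lemma subd_bd g : cover_bd (subd_piece g) = flatten (map cstep (cover_bd g)).
Proof.
rewrite /cover_bd /= rep_sd (eqP (valP g)) /full_bd sd_bd deg_piece -sd_path_wpow.
by have [-> _] := path_lift_sd (wpow (bd (val g).1) (deg mu (val g).1)) (val g).2.
Qed.

Lemma subd_piece_bij : bijective subd_piece.
Proof.
case: (sd_piece_bij u) => h hK Kh.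
apply: inj_surj_bij => [g g' E|g].
  have E1 : (val g).1 = (val g').1.
    apply: (can_inj hK).
    by have /= := congr1 (fun h : cover_piece nu => (val h).1) E.
  have /= := congr1 (fun h : cover_piece nu => (val h).2) E.
  rewrite !rep_sd => E2; rewrite -(mk_piece_val g) -(mk_piece_val g').
  by rewrite -mk_piece_rep E2 E1 mk_piece_rep.
exists (mk_piece mu (h (val g).1) (val g).2).
rewrite -[RHS]mk_piece_val; apply: val_inj.
by rewrite /= Kh -(rep_sd (h _)) Kh rep_id.
Qed.

Definition cover_subdivision : subdivision CL D.
Proof.
apply: (@Subdivision CK CL D subd_pt subd_mid subd_seg subd_fst subd_snd subd_piece).
- by move=> [p x] [q y] [/(@sd_pt_inj _ _ _ u) -> ->].
- move=> [s x] [t y]; rewrite !inE /= => /eqP -> /eqP -> [].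
  by move=> /(can_inj (actK nu _)) ->.
- move=> [p x] [s y] /= /eqP ->; rewrite xpair_eqE negb_and.
  by rewrite (@sd_mid_new _ _ _ u) //= eqxx.
- case=> p x; have [[q ->]|[s /eqP -> ->]] := sd_pt_onto u p.
    by left; exists (q, x).
  right; exists (s0, act nu (sinv (sd_fst u s0)) x) => //=.
  by rewrite /subd_mid /= actKV.
- move=> [s x] [t y] /= ks kt [E ->]; congr pair.
  exact: (@sd_seg_inj _ _ _ u) ks kt E.
- by move=> [s x] ks; rewrite /subd_pt /= -(@sd_seg_ini _ _ _ u).
- move=> [s x] ks; rewrite /subd_seg /= /cover_sinv /= (@sd_seg_sinv _ _ _ u) //.
  by rewrite act_seg.
- by move=> [s x] /= Ds; rewrite /subd_pt /= -(@sd_fst_ini _ _ _ u).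
- move=> [s x] /= Ds; rewrite /subd_mid /= -(@sd_fst_fin _ _ _ u) //.
- by move=> [s x] /= Ds; rewrite /subd_mid /= -(@sd_snd_ini _ _ _ u).
- move=> [s x] /= /eqP ->; transitivity
    ((fin (sd_snd u s0), act nu (sd_snd u s0) (act nu (sd_fst u s0) x)) : point CL) => //.
  by rewrite (@sd_snd_fin _ _ _ u) //= act_halves.
- move=> [s x] /= Ds; rewrite /subd_snd /= /cover_sinv /= xpair_eqE negb_and.
  by rewrite (@sd_fst_snd _ _ _ u).
- case=> t x; have [[s ks ->]|[s /eqP -> ]] := sd_seg_onto u t.
    by left; exists (s, x).
  rewrite !inE => /or4P[] /eqP -> {t}; right.
  + by exists (s0, x); rewrite ?inE //= eqxx.
  + exists (s0, act nu (sinv (sd_fst u s0)) x); rewrite ?inE //=.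
    by rewrite /subd_snd /= actKV eqxx orbT.
  + exists (s0, act nu (sinv (sd_fst u s0)) x); rewrite ?inE //=.
    by rewrite /subd_fst /cover_sinv /= actKV eqxx !orbT.
  + exists (s0, act mu (sinv s0) x); rewrite ?inE //=.
    by rewrite /subd_snd /cover_sinv /= act_halves actKV eqxx !orbT.
- exact: subd_piece_bij.
- move=> g; apply: val_inj => /=.
  by rewrite sd_pinv !rep_pinv !rep_sd rep_id.
- exact: subd_bd.
Defined.

(** The two halves act one after the other as the subdivided segment did, so the turns
around the pieces and their orbits do not change. *)
Lemma subdivision_lifts :
  covering_subdivision (monodromy_cover mu x0) (monodromy_cover nu x0).
Proof.
exists s0, u, cover_subdivision; split=> //.
- by move=> [s x] /= ->.
- exact: subd_bd.
Qed.

End LiftSubdivision.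

(** * Surfaces presented by words *)

(** [(n, true)] and [(n, false)] are the two directions of the edge [n]. *)
Definition letter : countType := (nat * bool)%type.
Definition linv (l : letter) : letter := (l.1, ~~ l.2).
Definition word := seq letter.
Definition winv (w : word) : word := rev (map linv w).

Lemma linvK : involutive linv.
Proof. by case=> n b; rewrite /linv /= negbK. Qed.

Lemma linv_neq l : (linv l == l) = false.
Proof. by case: l => n []; rewrite /linv xpair_eqE andbF. Qed.

Lemma letter_eq (k l : letter) : k.1 = l.1 -> k = l \/ k = linv l.
Proof. by case: k l => [n b] [m c] /= ->; case: b c => [] []; [left|right|right|left]. Qed.

Lemma winvK : involutive winv.
Proof.
by move=> w; rewrite /winv map_rev revK -map_comp map_id_in // => l _; exact: linvK.
Qed.

Lemma size_winv w : size (winv w) = size w.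
Proof. by rewrite size_rev size_map. Qed.

Lemma winv_nil w : (winv w == [::]) = (w == [::]).
Proof. by rewrite -!size_eq0 size_winv. Qed.

Lemma mem_winv w l : (l \in winv w) = (linv l \in w).
Proof. by rewrite mem_rev -{1}(linvK l) mem_map //; exact: (can_inj linvK). Qed.

Lemma map_fst_winv w : map fst (winv w) = rev (map fst w).
Proof. by rewrite /winv map_rev -map_comp. Qed.

Lemma winv_cat u v : winv (u ++ v) = winv v ++ winv u.
Proof. by rewrite /winv map_cat rev_cat. Qed.

(** At a corner between consecutive letters [a], [b] the segments [linv a] and [b] start at
the same point. [cycle (corner_rel P) w] says that [P] agrees on these two segments at
every corner of the cyclic word [w]; for [P := ini] this means that [w] is a closed path. *)
Definition corner_rel (T : eqType) (P : letter -> T) : rel letter :=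
  fun a b => P (linv a) == P b.

Lemma cycle_winv (T : eqType) (P : letter -> T) w :
  cycle (corner_rel P) (winv w) = cycle (corner_rel P) w.
Proof.
rewrite /winv rev_cycle cycle_map; apply: eq_cycle => a b.
by rewrite /corner_rel /= linvK eq_sym.
Qed.

Section WordTransport.
Variables (X : countType) (E : seq nat) (act : letter -> X -> X).
Hypothesis actK : forall l : letter, l.1 \in E -> cancel (act l) (act (linv l)).
Implicit Types (w : word) (x : X).

Lemma hol_winv w x : all (mem E) (map fst w) -> hol act (winv w) (hol act w x) = x.
Proof.
elim: w x => //= l w IH x /andP[lE wE].
by rewrite /winv /= rev_cons hol_rcons -/(winv w) IH // actK.
Qed.

Lemma hol_word_inj w : all (mem E) (map fst w) -> injective (hol act w).
Proof. by move=> wE x y /(congr1 (hol act (winv w))); rewrite !hol_winv. Qed.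

Definition has_deg w m := forall j x, (iter j (hol act w) x == x) = (m %| j).

Lemma has_deg_winv w m : all (mem E) (map fst w) -> has_deg w m -> has_deg (winv w) m.
Proof.
move=> wE h j x; rewrite -(h j x).
have wE' : all (mem E) (map fst (winv w)) by rewrite map_fst_winv all_rev.
have hh y : hol act w (hol act (winv w) y) = y by rewrite -{1}(winvK w) hol_winv.
have ih y i : iter i (hol act w) (iter i (hol act (winv w)) y) = y.
  by elim: i y => // i IH y; rewrite iterSr /= hh.
have ih' y i : iter i (hol act (winv w)) (iter i (hol act w) y) = y.
  by elim: i y => // i IH y; rewrite iterSr /= hol_winv.
by apply/eqP/eqP => e; [rewrite -{1}e ih|rewrite -{1}e ih'].
Qed.

End WordTransport.

(** The faces [ws] form a closed connected surface: every edge occurs twice; a property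
of segments that is constant along all corners is constant on the segments starting
at a point, that is, these are linked by a chain of corners ([gl_star]); and a
property of points that is constant along the edges is constant ([gl_conn]). In this
form the last two conditions carry over to a modified surface by extending or
restricting the property, without handling chains of corners. *)
Record gluing (V E : seq nat) (ini : letter -> nat) (ws : seq word) : Prop := Gluing {
  gl_uniq : uniq E;
  gl_ini : forall l : letter, l.1 \in E -> ini l \in V;
  gl_word : forall w, w \in ws ->
    [/\ w != [::], all (mem E) (map fst w) & cycle (corner_rel ini) w];
  gl_count : forall n, n \in E -> count_mem n (map fst (flatten ws)) = 2;
  gl_star : forall P : pred letter, (forall w, w \in ws -> cycle (corner_rel P) w) ->
    forall a b : letter, a.1 \in E -> b.1 \in E -> ini a = ini b -> P a = P b;
  gl_conn : forall P : pred nat,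
    (forall l : letter, l.1 \in E -> P (ini l) = P (ini (linv l))) ->
    {in V &, forall p q, P p = P q}
}.

Record branching (X : countType) (E : seq nat) (act : letter -> X -> X)
    (F : seq (word * nat)) : Prop := Branching {
  br_actK : forall l : letter, l.1 \in E -> cancel (act l) (act (linv l));
  br_deg : forall w m, (w, m) \in F ->
    0 < m /\ has_deg act w m
}.

(** A closed surface together with a covering of it with fibre [X]; [sF] lists the
faces with their orders. *)
Record surf (X : countType) := Surf {
  sV : seq nat; sE : seq nat; sini : letter -> nat; sact : letter -> X -> X;
  sF : seq (word * nat);
  s_gluing : gluing sV sE sini (map fst sF);
  s_branching : branching sE sact sF
}.

Section Complex.
Variables (X : countType) (S : surf X).

Definition spoint : countType := {p : nat | p \in sV S}.
Definition sseg : countType := {l : letter | l.1 \in sE S}.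
Definition spiece : countType := ('I_(size (sF S)) * bool)%type.
Implicit Types (s t : sseg) (f : spiece).

Definition seg_ini s : spoint := exist _ (sini S (val s)) (gl_ini (s_gluing S) (valP s)).
Definition seg_inv s : sseg := exist _ (linv (val s)) (valP s).

Lemma seg_invK : involutive seg_inv.
Proof. by move=> s; apply: val_inj; rewrite /= linvK. Qed.

Lemma seg_inv_neq s : seg_inv s != s.
Proof. by rewrite -val_eqE /= linv_neq. Qed.

Definition surf_skeleton : lineComplex :=
  @LineComplex spoint sseg seg_ini seg_inv seg_invK seg_inv_neq.

Definition wseg (w : word) : seq sseg := pmap insub w.

Lemma val_wseg w : all (mem (sE S)) (map fst w) -> map val (wseg w) = w.
Proof.
move=> wE; rewrite /wseg (pmap_filter (@insubK _ _ _)); apply/all_filterP.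
by move: wE; rewrite all_map; apply: sub_all => l /= lE; rewrite insubT.
Qed.

Definition face i : word * nat := nth ([::], 1) (sF S) i.
(** The second component of a piece chooses one of the two orientations of a face. *)
Definition piece_word f : word :=
  if f.2 then winv (face f.1).1 else (face f.1).1.
Definition piece_bd f : seq sseg := wseg (piece_word f).
Definition piece_inv f : spiece := (f.1, ~~ f.2).

Lemma face_in i : i < size (sF S) -> face i \in sF S.
Proof. exact: mem_nth. Qed.

Lemma face_wordP i : i < size (sF S) -> [/\ (face i).1 != [::],
  all (mem (sE S)) (map fst (face i).1) & cycle (corner_rel (sini S)) (face i).1].
Proof. by move=> /face_in fi; apply: (gl_word (s_gluing S)); apply/map_f. Qed.

Lemma piece_wordP f : [/\ piece_word f != [::],
  all (mem (sE S)) (map fst (piece_word f)) & cycle (corner_rel (sini S)) (piece_word f)].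
Proof.
have [h1 h2 h3] := face_wordP (ltn_ord f.1); rewrite /piece_word.
by case: f.2; rewrite // winv_nil map_fst_winv all_rev cycle_winv.
Qed.

Lemma val_piece_bd f : map val (piece_bd f) = piece_word f.
Proof. by rewrite val_wseg //; case: (piece_wordP f). Qed.

Lemma piece_invK : involutive piece_inv.
Proof. by case=> i b; rewrite /piece_inv /= negbK. Qed.

Lemma piece_inv_neq f : piece_inv f != f.
Proof. by case: f => i []; rewrite xpair_eqE andbF. Qed.

Lemma piece_bd_nonempty f : piece_bd f != [::].
Proof.
rewrite -size_eq0 -(size_map val) val_piece_bd size_eq0; by case: (piece_wordP f).
Qed.

Lemma piece_bd_closed f : cycle (@follows surf_skeleton) (piece_bd f).
Proof.
have [_ _] := piece_wordP f; rewrite -val_piece_bd cycle_map.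
by apply: sub_cycle => s t; rewrite /corner_rel /follows -val_eqE /= eq_sym.
Qed.

Lemma val_path_inv (w : seq (segment surf_skeleton)) :
  map val (path_inv w) = winv (map val w).
Proof. by rewrite /path_inv /winv map_rev -!map_comp. Qed.

Lemma piece_bd_inv f : piece_bd (piece_inv f) = path_inv (piece_bd f : seq (segment surf_skeleton)).
Proof.
apply: (inj_map val_inj); rewrite val_path_inv !val_piece_bd /piece_word /=.
by case: f.2; rewrite //= winvK.
Qed.

Definition cplx : surfaceComplex :=
  @SurfaceComplex surf_skeleton spiece piece_inv piece_bd piece_invK piece_inv_neq
    piece_bd_nonempty piece_bd_closed piece_bd_inv.

Lemma hol_val (w : seq (segment cplx)) x :
  hol (fun s => sact S (val s)) w x = hol (sact S) (map val w) x.
Proof. by elim: w x => //= s w IH x. Qed.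

Lemma sactK s : cancel (sact S (val s)) (sact S (val (seg_inv s))).
Proof. exact: (br_actK (s_branching S)) (valP s). Qed.

Definition face_deg f := (face f.1).2.

Lemma face_deg_gt0 f : 0 < face_deg f.
Proof.
have := face_in (ltn_ord f.1); rewrite /face_deg; case: (face f.1) => w m.
by move=> /(br_deg (s_branching S))[].
Qed.

Lemma face_deg_orbit (f : piece cplx) j x :
  (iter j (hol (fun s : segment cplx => sact S (val s)) (bd f)) x == x) = (face_deg f %| j).
Proof.
have -> : iter j (hol (fun s : segment cplx => sact S (val s)) (bd f)) x =
    iter j (hol (sact S) (piece_word f)) x.
  by apply: eq_iter => y; rewrite hol_val val_piece_bd.
have [_ wE _] := face_wordP (ltn_ord f.1); have fF := face_in (ltn_ord f.1).
have [_ d] : 0 < face_deg f /\ has_deg (sact S) (face f.1).1 (face_deg f).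
  by apply: (br_deg (s_branching S)); rewrite /face_deg -surjective_pairing.
have aK := br_actK (s_branching S).
by rewrite /piece_word; case: f.2; [have dV := has_deg_winv aK wE d; exact: dV|exact: d].
Qed.

Definition surf_monodromy : monodromy cplx X := @Monodromy cplx X
  (fun s => sact S (val s)) face_deg sactK face_deg_gt0 (fun _ => erefl) face_deg_orbit.

End Complex.

(** * Elementary modifications of presented surfaces *)

Lemma winv_rot i w : winv (rot i w) = rot (size w - i) (winv w).
Proof. by rewrite /winv map_rot rev_rot /rotr size_rev size_map. Qed.

Section Reface.
Variables (X Y : countType) (S : surf X) (S' : surf Y).
Variables (pos : nat -> nat) (flip : nat -> bool) (shift : nat -> nat).
Hypothesis V_eq : sV S =i sV S'.
Hypothesis E_eq : sE S =i sE S'.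
Hypothesis ini_eq : forall l : letter, l.1 \in sE S -> sini S' l = sini S l.
Hypothesis pos_lt : forall i, i < size (sF S) -> pos i < size (sF S').
Hypothesis pos_inj : forall i j, i < size (sF S) -> j < size (sF S) ->
  pos i = pos j -> i = j.
Hypothesis pos_surj : forall i, i < size (sF S') ->
  exists2 j, j < size (sF S) & pos j = i.
Hypothesis face_eq : forall i, i < size (sF S) -> (face S' (pos i)).1 =
  rot (shift i) (if flip i then winv (face S i).1 else (face S i).1).
Hypothesis shift_lt : forall i, i < size (sF S) -> shift i < size (face S i).1.

Definition re_pt (p : spoint S) : spoint S' :=
  exist _ (val p) (etrans (esym (V_eq _)) (valP p)).
Definition re_seg (s : sseg S) : sseg S' :=
  exist _ (val s) (etrans (esym (E_eq _)) (valP s)).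
Definition re_piece (f : spiece S) : spiece S' :=
  (Ordinal (pos_lt (ltn_ord f.1)), f.2 (+) flip f.1).
(** The rotation of [re_bd] for the piece [f]; [face_eq] gives it for one of the two
orientations of the face, and inverting a word reverses rotations. *)
Definition re_shift (f : spiece S) : nat :=
  if f.2 (+) flip f.1 then
    if shift f.1 == 0 then 0 else size (face S f.1).1 - shift f.1
  else shift f.1.

Lemma size_piece_bd (f : spiece S) : size (piece_bd f) = size (face S f.1).1.
Proof.
by rewrite -(size_map val) val_piece_bd /piece_word; case: f.2; rewrite ?size_winv.
Qed.

Lemma re_shift_lt f : re_shift f < size (piece_bd f).
Proof.
rewrite size_piece_bd /re_shift; have := shift_lt (ltn_ord f.1).
case: (_ (+) _) => //; case: eqP => //; lia.
Qed.

Lemma re_bd f : piece_bd (re_piece f) = rot (re_shift f) (map re_seg (piece_bd f)).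
Proof.
apply: (inj_map val_inj); rewrite map_rot -map_comp.
rewrite (eq_map (g := val)) // !val_piece_bd /piece_word /re_piece /re_shift /=.
have lt := shift_lt (ltn_ord f.1).
rewrite face_eq //; case: (flip _) f.2 => [] [] //=.
  by rewrite winv_rot size_winv winvK; case: eqP => // ->; rewrite subn0 rot_size rot0.
by rewrite winv_rot; case: eqP => // ->; rewrite subn0 -size_winv rot_size rot0.
Qed.

Lemma re_shift_pinv f :
  (re_shift f = 0 /\ re_shift (piece_inv f) = 0) \/
  re_shift f + re_shift (piece_inv f) = size (piece_bd f).
Proof.
rewrite size_piece_bd /re_shift /=; have := shift_lt (ltn_ord f.1).
case: f.2 (flip f.1) => [] [] /=; case: (shift f.1) => [|i] /=; lia.
Qed.

Lemma re_bij : bijective re_piece.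
Proof.
apply: inj_surj_bij => [[i b] [j c] [/= E]|[i b]].
  have -> : i = j by apply: val_inj; apply: pos_inj E; exact: ltn_ord.
  by move=> /addIb ->.
have [j jl Ej] := pos_surj (ltn_ord i).
exists (Ordinal jl, b (+) flip j); congr pair; first exact: val_inj.
by rewrite /= -addbA addbb addbF.
Qed.

Definition reface_iso : complex_iso (cplx S) (cplx S').
Proof.
apply: (@ComplexIso (cplx S) (cplx S') re_pt re_seg re_piece).
- apply: inj_surj_bij => [p q /(congr1 val) E|p]; first exact: val_inj.
  by exists (exist _ (val p) (etrans (V_eq _) (valP p))); exact: val_inj.
- apply: inj_surj_bij => [p q /(congr1 val) E|p]; first exact: val_inj.
  by exists (exist _ (val p) (etrans (E_eq _) (valP p))); exact: val_inj.
- exact: re_bij.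
- by move=> s; apply: val_inj; rewrite /= ini_eq // (valP s).
- by move=> s; apply: val_inj.
- by move=> [i b]; rewrite /= /re_piece /piece_inv /= addNb.
- by move=> f; apply: is_rot_sym; exists (re_shift f); exact: re_bd.
Defined.

End Reface.

Definition surf_cover (X : countType) (x0 : X) (S : surf X) : covering :=
  monodromy_cover (surf_monodromy S) x0.

Definition related (X : countType) (x0 : X) (S S' : surf X) :=
  elementarily_related (surf_cover x0 S) (surf_cover x0 S').

Section RefaceCover.
Variables (X : countType) (x0 : X) (S S' : surf X).
Variables (pos : nat -> nat) (flip : nat -> bool) (shift : nat -> nat).
Hypothesis V_eq : sV S =i sV S'.
Hypothesis E_eq : sE S =i sE S'.
Hypothesis ini_eq : forall l : letter, l.1 \in sE S -> sini S' l = sini S l.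
Hypothesis pos_lt : forall i, i < size (sF S) -> pos i < size (sF S').
Hypothesis pos_inj : forall i j, i < size (sF S) -> j < size (sF S) ->
  pos i = pos j -> i = j.
Hypothesis pos_surj : forall i, i < size (sF S') ->
  exists2 j, j < size (sF S) & pos j = i.
Hypothesis face_eq : forall i, i < size (sF S) -> (face S' (pos i)).1 =
  rot (shift i) (if flip i then winv (face S i).1 else (face S i).1).
Hypothesis shift_lt : forall i, i < size (sF S) -> shift i < size (face S i).1.
Hypothesis act_eq : forall (l : letter) x, l.1 \in sE S -> sact S' l x = sact S l x.
Hypothesis deg_eq : forall i, i < size (sF S) -> (face S' (pos i)).2 = (face S i).2.

(** Permuting, rotating and inverting the faces only renames the elements of the
covering. *)
Lemma reface_related : related x0 S S'.
Proof.
apply: rst_step; constructor 1.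
apply: (@coordinates_iso (surf_cover x0 S) (cplx S') X (surf_monodromy S') x0
  (reface_iso V_eq E_eq ini_eq pos_lt pos_inj pos_surj face_eq shift_lt)
  (re_shift flip shift) snd).
- by move=> [s x]; rewrite /= act_eq // (valP s).
- by move=> [p x] [q y] /= -> ->.
- by move=> p x; exists (p, x).
- move=> f; rewrite [deg _ _]/= /face_deg /= deg_eq //.
  exact: (@cover_branched _ _ (surf_monodromy S) x0 (cpiece f) f erefl).
- exact: re_shift_lt.
- exact: re_bd.
- exact: re_shift_pinv.
Qed.

End RefaceCover.

Lemma path_joins (K : lineComplex) (s t : segment K) w :
  path (@follows K) s (rcons w t) -> joins (fin s) w (ini t).
Proof.
elim: w s => [|r w IH] s /=; first by rewrite /follows andbT eq_sym.
by move=> /andP[/eqP -> /IH ->]; rewrite eqxx.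
Qed.

Lemma cycle_joins (K : lineComplex) (s : segment K) w :
  cycle (@follows K) (s :: w) -> joins (fin s) w (ini s).
Proof. exact: path_joins. Qed.

Lemma cycle_joins_inv (K : lineComplex) (s : segment K) w :
  cycle (@follows K) (rcons w (sinv s)) -> joins (ini s) w (fin s).
Proof. by rewrite -rot1_cons rot_cycle => /cycle_joins; rewrite fin_sinv. Qed.

Lemma same_pieceE (X : countType) (S : surf X) (f g : piece (cplx S)) :
  same_piece f g = (f.1 == g.1).
Proof.
case: f g => [i b] [j c]; rewrite /same_piece /= !xpair_eqE [j == i]eq_sym.
by case: (i == j) b c => [] [] [].
Qed.

Lemma face_cons (X : countType) (S : surf X) x G i : sF S = x :: G ->
  face S i = if i is j.+1 then nth ([::], 1) G j else x.
Proof. by rewrite /face => ->; case: i. Qed.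

Section SplitSurf.
Variables (X : countType) (x0 : X) (S S' : surf X).
Variables (w1 w2 : word) (m : nat) (l : letter) (G : seq (word * nat)).
Hypothesis FS : sF S = (w1 ++ w2, m) :: G.
Hypothesis FS' : sF S' = (rcons w1 (linv l), 1) :: (l :: w2, m) :: G.
Hypothesis V_eq : sV S =i sV S'.
Hypothesis E_eq : sE S' =i l.1 :: sE S.
Hypothesis l_new : l.1 \notin sE S.
Hypothesis ini_eq : forall k : letter, k.1 \in sE S -> sini S' k = sini S k.
Hypothesis act_eq : forall (k : letter) x, k.1 \in sE S -> sact S' k x = sact S k x.

Lemma size_S : 0 < size (sF S). Proof. by rewrite FS. Qed.
Lemma size_S' : size (sF S') = (size (sF S)).+1. Proof. by rewrite FS FS'. Qed.
Lemma fst_lt : 0 < size (sF S'). Proof. by rewrite FS'. Qed.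
Lemma snd_lt : 1 < size (sF S'). Proof. by rewrite FS'. Qed.
Lemma E_sub n : n \in sE S -> n \in sE S'.
Proof. by rewrite E_eq inE orbC => ->. Qed.
Lemma succ_lt i : i < size (sF S) -> i.+1 < size (sF S').
Proof. by rewrite size_S'. Qed.
Lemma l_in : l.1 \in sE S'. Proof. by rewrite E_eq mem_head. Qed.

Definition ss_old : piece (cplx S) := (Ordinal size_S, false).
Definition ss_pt (p : point (cplx S)) : point (cplx S') :=
  exist _ (val p) (etrans (esym (V_eq _)) (valP p)).
Definition ss_seg (s : segment (cplx S)) : segment (cplx S') :=
  exist _ (val s) (E_sub (valP s)).
Definition ss_piece (f : piece (cplx S)) : piece (cplx S') :=
  (Ordinal (succ_lt (ltn_ord f.1)), f.2).
Definition ss_new : segment (cplx S') := exist _ l l_in.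
Definition ss_fst : piece (cplx S') := (Ordinal fst_lt, false).
Definition ss_snd : piece (cplx S') := (Ordinal snd_lt, false).

Lemma w12_E : all (mem (sE S)) (map fst w1) /\ all (mem (sE S)) (map fst w2).
Proof.
have [_ + _] := face_wordP size_S; rewrite (face_cons 0 FS) /= map_cat all_cat.
by move=> /andP.
Qed.

Lemma val_ss_seg w : all (mem (sE S)) (map fst w) ->
  map val (map ss_seg (wseg S w)) = w.
Proof. by move=> wE; rewrite -map_comp (eq_map (g := val)) // val_wseg. Qed.

Lemma ss_fst_bd : bd ss_fst = rcons (map ss_seg (wseg S w1)) (sinv ss_new).
Proof.
apply: (inj_map val_inj); rewrite [bd _]/= val_piece_bd map_rcons val_ss_seg.
  by rewrite /piece_word /= (face_cons 0 FS').
by case: w12_E.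
Qed.

Lemma ss_snd_bd : bd ss_snd = ss_new :: map ss_seg (wseg S w2).
Proof.
apply: (inj_map val_inj); rewrite [bd _]/= val_piece_bd map_cons val_ss_seg.
  by rewrite /piece_word /= (face_cons 1 FS').
by case: w12_E.
Qed.

Lemma face_old (f : piece (cplx S)) : ~~ same_piece ss_old f ->
  face S' f.1.+1 = face S f.1.
Proof.
rewrite same_pieceE -val_eqE /= (face_cons _ FS') (face_cons _ FS).
by case: (val f.1).
Qed.

Lemma bd_old : bd ss_old = wseg S w1 ++ wseg S w2.
Proof.
by rewrite /= /piece_bd /piece_word /= (face_cons 0 FS) /= /wseg pmap_cat.
Qed.

Definition surf_splitting : splitting (cplx S') ss_old (wseg S w1) (wseg S w2).
Proof.
apply: (@Splitting (cplx S) (cplx S') ss_old (wseg S w1) (wseg S w2)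
  ss_pt ss_seg ss_piece ss_new ss_fst ss_snd).
- by exists 0; rewrite rot0 bd_old.
- apply: inj_surj_bij => [p q /(congr1 val) E|p]; first exact: val_inj.
  by exists (exist _ (val p) (etrans (V_eq _) (valP p))); exact: val_inj.
- by move=> s t /(congr1 val) E; exact: val_inj.
- by move=> s; apply: val_inj; rewrite /= ini_eq // (valP s).
- by move=> s; apply: val_inj.
- move=> s; apply/eqP => /(congr1 val) /= E; move: l_new.
  by rewrite -E (valP s).
- move=> t; have := valP t; rewrite E_eq inE => /orP[/eqP Et|tE].
    right; case: (letter_eq Et) => E; [left|right]; exact: val_inj.
  by left; exists (exist _ (val t) tE); exact: val_inj.
- by apply: cycle_joins_inv; rewrite -ss_fst_bd; exact: bd_closed.
- by apply: cycle_joins; rewrite -ss_snd_bd; exact: bd_closed.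
- move=> [i b] [j c] _ _ [E ->]; congr pair; exact: val_inj.
- by [].
- move=> g gf; apply: (inj_map val_inj); rewrite -map_comp.
  rewrite (eq_map (g := val)) // [bd _]/= [bd _]/= !val_piece_bd.
  by rewrite /piece_word /= face_old.
- exact: ss_fst_bd.
- exact: ss_snd_bd.
- by rewrite same_pieceE.
- by move=> g; rewrite !same_pieceE -!val_eqE /= !eqSS.
- case=> -[i il] b; case: i il => [|[|i]] il.
  + by constructor 2; rewrite same_pieceE.
  + by constructor 3; rewrite same_pieceE.
  have il' : i.+1 < size (sF S) by move: il; rewrite size_S'.
  constructor 1; exists (Ordinal il', b); first by rewrite same_pieceE.
  by congr pair; exact: val_inj.
Defined.

Lemma split_related : related x0 S S'.
Proof.
apply: rst_step; constructor 3.
apply: (@splitting_lifts (cplx S) (cplx S') X x0 (surf_monodromy S) (surf_monodromy S') ss_old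
  (wseg S w1) (wseg S w2) surf_splitting).
- exact: bd_old.
- by move=> s x; rewrite /= act_eq // (valP s).
- by move=> g gf; rewrite /= /face_deg face_old.
- by rewrite /= /face_deg (face_cons _ FS) (face_cons _ FS').
- by rewrite /= /face_deg (face_cons _ FS').
Qed.

End SplitSurf.

Section SubdivSurf.
Variables (X : countType) (x0 : X) (S S' : surf X) (a t e : letter) (mid : nat).

Definition subst1 (k : letter) : word :=
  if k == a then [:: t; e] else if k == linv a then [:: linv e; linv t] else [:: k].
Definition substw (w : word) : word := flatten (map subst1 w).

Hypothesis FS : sF S' = [seq (substw wm.1, wm.2) | wm <- sF S].
Hypothesis a_in : a.1 \in sE S.
Hypothesis te : t.1 != e.1.
Hypothesis E_eq : forall n, (n \in sE S') =
  [|| (n != a.1) && (n \in sE S), n == t.1 | n == e.1].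
Hypothesis V_eq : sV S' =i mid :: sV S.
Hypothesis mid_new : mid \notin sV S.
Hypothesis ini_eq : forall k : letter, k.1 \in sE S -> k.1 != a.1 -> sini S' k = sini S k.
Hypothesis ini_t : sini S' t = sini S a.
Hypothesis fin_t : sini S' (linv t) = mid.
Hypothesis ini_e : sini S' e = mid.
Hypothesis fin_e : sini S' (linv e) = sini S (linv a).
Hypothesis act_eq : forall (k : letter) x, k.1 \in sE S -> k.1 != a.1 ->
  sact S' k x = sact S k x.
Hypothesis act_te : forall x, sact S' e (sact S' t x) = sact S a x.

Lemma t_in : t.1 \in sE S'. Proof. by rewrite E_eq eqxx orbT. Qed.
Lemma e_in : e.1 \in sE S'. Proof. by rewrite E_eq eqxx !orbT. Qed.
Lemma mid_in : mid \in sV S'. Proof. by rewrite V_eq mem_head. Qed.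
Lemma V_sub p : p \in sV S -> p \in sV S'.
Proof. by rewrite V_eq inE orbC => ->. Qed.
Lemma size_SS : size (sF S') = size (sF S). Proof. by rewrite FS size_map. Qed.

Definition ms_pt (p : point (cplx S)) : point (cplx S') :=
  exist _ (val p) (V_sub (valP p)).
Definition ms_mid (_ : segment (cplx S)) : point (cplx S') := exist _ mid mid_in.
Definition ms_fst (_ : segment (cplx S)) : segment (cplx S') := exist _ t t_in.
Definition ms_snd (_ : segment (cplx S)) : segment (cplx S') := exist _ e e_in.
Definition ms_seg (s : segment (cplx S)) : segment (cplx S') :=
  insubd (exist _ t t_in : sseg S') (val s).
Definition ms_piece (f : piece (cplx S)) : piece (cplx S') :=
  (cast_ord (esym size_SS) f.1, f.2).

Definition aseg : segment (cplx S) := exist _ a a_in.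

Lemma kept_val (s : segment (cplx S)) : kept (pred1 aseg) s = ((val s).1 != a.1).
Proof.
rewrite /kept /= -!val_eqE /= -negb_or; congr (~~ _).
apply/orP/eqP=> [[]/eqP // <- //|/letter_eq[]->]; rewrite ?linvK ?eqxx; auto.
Qed.

Lemma val_ms_seg s : kept (pred1 aseg) s -> val (ms_seg s) = val s.
Proof.
rewrite kept_val => sa; rewrite /ms_seg insubdK // unfold_in E_eq sa.
by rewrite (valP s).
Qed.

Lemma subst1_inv k : subst1 (linv k) = winv (subst1 k).
Proof.
rewrite /subst1 -(inj_eq (can_inj linvK)) linvK.
case: (k =P linv a) => [->|_]; first by rewrite linv_neq /winv /= !linvK.
by rewrite (inj_eq (can_inj linvK)); case: (k == a).
Qed.

Lemma substw_inv w : substw (winv w) = winv (substw w).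
Proof.
elim: w => //= k w IH; rewrite /substw /= winv_cat -subst1_inv -IH.
by rewrite /winv /= rev_cons map_rcons -cats1 flatten_cat /= cats0.
Qed.

Lemma val_step (s : segment (cplx S)) :
  map val (subdivided_step (pred1 aseg) ms_seg ms_fst ms_snd s) = subst1 (val s).
Proof.
rewrite /subdivided_step /subst1 /= -!val_eqE /= -{2}(linvK a).
rewrite (inj_eq (can_inj linvK)); case: ifP => // n1; case: ifP => //= n2.
by rewrite val_ms_seg // /kept /= -!val_eqE /= n1 -{1}(linvK a) (inj_eq (can_inj linvK)) n2.
Qed.

Lemma ms_bd f : bd (ms_piece f) =
  flatten (map (subdivided_step (pred1 aseg) ms_seg ms_fst ms_snd) (bd f)).
Proof.
apply: (inj_map val_inj); rewrite map_flatten -map_comp (eq_map val_step).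
rewrite map_comp /= !val_piece_bd /piece_word /=.
have -> : face S' f.1 = (substw (face S f.1).1, (face S f.1).2).
  by rewrite /face FS (nth_map ([::], 1)).
by case: f.2; rewrite //= -substw_inv.
Qed.

Definition surf_subdivision : subdivision (cplx S') (pred1 aseg).
Proof.
apply: (@Subdivision (cplx S) (cplx S') (pred1 aseg)
  ms_pt ms_mid ms_seg ms_fst ms_snd ms_piece).
- by move=> p q /(congr1 val) E; exact: val_inj.
- by move=> s s' /eqP -> /eqP ->.
- move=> p s _; rewrite -val_eqE /=; apply/eqP => E.
  by move: mid_new; rewrite -E (valP p).
- move=> p; have := valP p; rewrite V_eq inE => /orP[/eqP Ep|pV].
    by right; exists aseg; [exact: eqxx|exact: val_inj].
  by left; exists (exist _ (val p) pV); exact: val_inj.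
- move=> s s' ks ks' /(congr1 val); rewrite !val_ms_seg // => E; exact: val_inj.
- move=> s ks; apply: val_inj; rewrite /= val_ms_seg // ini_eq ?(valP s) //.
  by move: ks; rewrite kept_val.
- move=> s ks; apply: val_inj; rewrite /= !val_ms_seg //.
  by move: ks; rewrite !kept_val.
- by move=> s /eqP ->; apply: val_inj; rewrite /= ini_t.
- by move=> s _; apply: val_inj; rewrite /= fin_t.
- by move=> s _; apply: val_inj; rewrite /= ini_e.
- by move=> s /eqP ->; apply: val_inj; rewrite /= fin_e.
- move=> s _; rewrite -val_eqE /=; apply/eqP => E.
  by move: te; rewrite E eqxx.
- move=> s; have := valP s; rewrite E_eq => /or3P[/andP[sa sE]|/eqP Es|/eqP Es].
  + have ks : kept (pred1 aseg) (exist _ (val s) sE) by rewrite kept_val.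
    by left; exists (exist _ (val s) sE) => //; apply: val_inj; rewrite val_ms_seg.
  + right; exists aseg; first exact: eqxx.
    by rewrite !inE -!val_eqE /=; case: (letter_eq Es) => ->; rewrite eqxx ?orbT.
  + right; exists aseg; first exact: eqxx.
    by rewrite !inE -!val_eqE /=; case: (letter_eq Es) => ->; rewrite eqxx ?orbT.
- exists (fun f : piece (cplx S') => ((cast_ord size_SS f.1, f.2) : piece (cplx S))).
    by move=> [i b]; rewrite /ms_piece /= cast_ordKV.
  by move=> [i b]; rewrite /ms_piece /= cast_ordK.
- by [].
- exact: ms_bd.
Defined.

Lemma subdivision_related : related x0 S S'.
Proof.
apply: rst_step; constructor 2.
apply: (@subdivision_lifts (cplx S) (cplx S') X x0 (surf_monodromy S) (surf_monodromy S') aseg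
  surf_subdivision).
- move=> s x ks; have -> : act (surf_monodromy S') (sd_seg surf_subdivision s) x =
    sact S' (val (ms_seg s)) x by [].
  by rewrite val_ms_seg // act_eq ?(valP s) //; move: ks; rewrite kept_val.
- by move=> x; exact: act_te.
- by move=> g; rewrite /= /face_deg /face /= FS (nth_map ([::], 1)).
Qed.

End SubdivSurf.

(** * Cutting, gluing and cancelling *)

Ltac bool_congruence := repeat match goal with
  | H : is_true (_ && _) |- _ => let H1 := fresh in let H2 := fresh in
      move/andP: H => [H1 H2]
  | H : is_true (_ == _) |- _ => move/eqP: H => H
  | |- is_true (_ && _) => apply/andP; split
  | |- is_true (_ == _) => apply/eqP
  end; first [done | congruence].

Section Cycles.
Variable T : eqType.
Implicit Types (P : letter -> T) (w : word).

Lemma cycle_ext (E : seq nat) P P' w : all (mem E) (map fst w) ->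
  (forall k : letter, k.1 \in E -> P k = P' k) ->
  cycle (corner_rel P) w = cycle (corner_rel P') w.
Proof.
rewrite all_map => wE PP'; apply: eq_in_cycle (wE) => a b aE bE.
by rewrite /corner_rel !PP'.
Qed.

(** When a cyclic word is cut along [l], a function constant along the corners of the two
parts is the same as one constant along the corners of the whole that takes at [l] and
[linv l] the values at the neighbouring letters; the defaults of [head] cover the
case that one of the parts is a monogon. Applied to [ini] this governs the points, and
applied to properties it governs [gl_star], for cutting as well as for gluing. *)
Lemma cycle_cut P l w1 w2 : w1 ++ w2 != [::] ->
  cycle (corner_rel P) (rcons w1 (linv l)) && cycle (corner_rel P) (l :: w2) =
  [&& cycle (corner_rel P) (w1 ++ w2), P l == P (head (head l w2) w1) &
      P (linv l) == P (head (head l w1) w2)].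
Proof.
case: w1 w2 => [|x u] [|y v] //= _; rewrite ?cats0 ?rcons_cat ?rcons_path
  ?cat_path /= ?rcons_path ?last_rcons ?last_cat /= /corner_rel ?linvK;
  apply/idP/idP => h; bool_congruence.
Qed.

End Cycles.

(** Equality of boundary paths up to cyclic interchange and orientation. *)
Definition same_cycle (w w' : word) := is_rot w w' \/ is_rot (winv w) w'.

Lemma is_rot_perm (T : eqType) (w w' : seq T) : is_rot w w' -> perm_eq w w'.
Proof. by case=> i ->; rewrite perm_sym perm_rot. Qed.

Lemma is_rot_cycle (T : eqType) (e : rel T) (w w' : seq T) :
  is_rot w w' -> cycle e w = cycle e w'.
Proof. by case=> i ->; rewrite rot_cycle. Qed.

Lemma same_cycle_perm w w' : same_cycle w w' -> perm_eq (map fst w) (map fst w').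
Proof.
case=> [|] /is_rot_perm /(perm_map fst) //; apply: perm_trans.
by rewrite map_fst_winv perm_sym perm_rev.
Qed.

Lemma same_cycle_cycle (T : eqType) (P : letter -> T) w w' : same_cycle w w' ->
  cycle (corner_rel P) w = cycle (corner_rel P) w'.
Proof. by case=> /is_rot_cycle <- //; rewrite cycle_winv. Qed.

Section Gluing.
Variables (V E : seq nat) (ini : letter -> nat).
Implicit Types (ws : seq word) (w : word) (l k : letter).

Lemma gluing_perm ws ws' : perm_eq ws ws' -> gluing V E ini ws -> gluing V E ini ws'.
Proof.
move=> pw [uE iniV wP cP sP nP]; have mE := perm_mem pw; split=> //.
- by move=> w; rewrite -mE; exact: wP.
- move=> n /cP <-; apply/permP; rewrite perm_sym; exact/perm_map/perm_flatten.
- by move=> P h; apply: sP => w; rewrite mE; exact: h.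
Qed.

Lemma gluing_head w w' ws : same_cycle w w' -> gluing V E ini (w :: ws) ->
  gluing V E ini (w' :: ws).
Proof.
move=> e [uE iniV wP cP sP nP]; have pw := same_cycle_perm e; split=> //.
- move=> v; rewrite inE => /orP[/eqP ->|vw]; last by apply: wP; rewrite inE vw orbT.
  have [h1 h2 h3] := wP _ (mem_head _ _); split.
  + by move: h1; rewrite -!size_eq0 -!(size_map fst) (perm_size pw).
  + by rewrite -(perm_all _ pw).
  + by rewrite -(same_cycle_cycle _ e).
- move=> n /cP <-; rewrite /= !map_cat !count_cat; congr (_ + _).
  by apply/permP; rewrite perm_sym.
- move=> P h; apply: sP => v; rewrite inE => /orP[/eqP ->|vw].
    by rewrite (same_cycle_cycle _ e) h ?mem_head.
  by rewrite h // inE vw orbT.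
Qed.

Lemma gluing_cut_fresh ws w1 w2 l : gluing V E ini (rcons w1 (linv l) :: (l :: w2) :: ws) ->
  [/\ l.1 \in E, l.1 \notin map fst w1, l.1 \notin map fst w2 &
   l.1 \notin map fst (flatten ws)].
Proof.
move=> [uE iniV wP cP sP nP].
have lE : l.1 \in E.
  have in2 : l :: w2 \in rcons w1 (linv l) :: (l :: w2) :: ws by rewrite !inE eqxx orbT.
  by have [_ /andP[] //] := wP _ in2.
have := cP _ lE; rewrite /= -cats1 !map_cat !count_cat /= map_cat count_cat /= eqxx.
rewrite addn0 addn1 add1n addSn addnS => /eqP; rewrite !eqSS !addn_eq0.
by move=> /and3P[/eqP h1 /eqP h2 /eqP h3]; split=> //; apply/count_memPn.
Qed.

Lemma gluing_letters ws w : gluing V E ini (w :: ws) ->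
  {in flatten ws, forall k, k.1 \in E} /\ {in w, forall k, k.1 \in E}.
Proof.
move=> [uE iniV wP cP sP nP]; split=> [k /flattenP[v vw kv]|k kw].
  have [_ /allP h _] := wP v (mem_behead (s := w :: ws) vw).
  by apply: h; apply: map_f.
by have [_ /allP h _] := wP w (mem_head _ _); apply/h/map_f.
Qed.

End Gluing.

(** The segments [l] and [linv l] can be replaced by their neighbours on the uncut
face, with the same initial points and the same values of every [P] constant along
the corners. *)
Lemma gluing_split V E ini ini' ws w1 w2 l :
  gluing V E ini ((w1 ++ w2) :: ws) -> l.1 \notin E ->
  (forall k : letter, k.1 \in E -> ini' k = ini k) ->
  ini' l = ini (head (head l w2) w1) ->
  ini' (linv l) = ini (head (head l w1) w2) ->
  gluing V (l.1 :: E) ini' (rcons w1 (linv l) :: (l :: w2) :: ws).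
Proof.
move=> T lE iniE inil iniv; have [fE wE] := gluing_letters T.
case: T => [uE iniV wP cP sP nP].
have [w0 allw cw] := wP _ (mem_head _ _).
have [all1 all2] : all (mem E) (map fst w1) /\ all (mem E) (map fst w2).
  by apply/andP; rewrite -all_cat -map_cat.
have h1E : (head (head l w2) w1).1 \in E.
  by apply: wE; case: (w1) w0 => [|x u] /=; rewrite ?mem_head //; case: (w2) => //= y v _; rewrite mem_head.
have h2E : (head (head l w1) w2).1 \in E.
  apply: wE; rewrite mem_cat; case: (w2) w0 => [|y v] /=; rewrite ?cats0 ?mem_head ?orbT //.
  by case: (w1) => //= x u _; rewrite mem_head.
have cext (T : eqType) (P : letter -> T) w P' : w \in (w1 ++ w2) :: ws ->
    (forall k : letter, k.1 \in E -> P' k = P k) -> cycle (corner_rel P') w = cycle (corner_rel P) w.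
  by move=> ww h; apply: cycle_ext h; case: (wP _ ww).
have sub : all (mem (l.1 :: E)) (map fst w1) /\ all (mem (l.1 :: E)) (map fst w2).
  by split; [move: all1|move: all2]; apply: sub_all => n /= nE; rewrite inE nE orbT.
split.
- by rewrite /= lE.
- move=> k; rewrite inE => /orP[/eqP ek|kE]; last by rewrite iniE // iniV.
  by case: (letter_eq ek) => ->; rewrite ?inil ?iniv iniV.
- have /andP[c1 c2] : cycle (corner_rel ini') (rcons w1 (linv l)) && cycle (corner_rel ini') (l :: w2).
    by rewrite cycle_cut // (cext _ ini) ?mem_head // cw inil iniv !iniE // !eqxx.
  move=> w; rewrite !inE => /or3P[/eqP -> |/eqP -> |ww].
  + split=> //; first by case: (w1).
    by rewrite map_rcons all_rcons /= inE eqxx /=; case: sub.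
  + by split=> //=; rewrite inE eqxx /=; case: sub.
  have ww' : w \in (w1 ++ w2) :: ws by rewrite inE ww orbT.
  have [h1 h2 h3] := wP _ ww'; split=> //; last by rewrite (cext _ ini).
  by move: h2; apply: sub_all => n /= nE; rewrite inE nE orbT.
- move=> n; have cE : count_mem n (map fst (flatten (rcons w1 (linv l) :: (l :: w2) :: ws))) =
      count_mem n (map fst (flatten ((w1 ++ w2) :: ws))) + (l.1 == n).*2.
    rewrite /= !map_cat !count_cat /= map_cat map_rcons count_cat -cats1 count_cat /=.
    by rewrite addn0 -addnn; lia.
  rewrite cE inE => /orP[/eqP ->|nE].
    rewrite eqxx; suff -> : count_mem l.1 (map fst (flatten ((w1 ++ w2) :: ws))) = 0 by [].
    apply/count_memPn; apply: contra lE => /mapP[k /=]; rewrite mem_cat => /orP[/wE|/fE] kE ->; exact: kE.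
  by rewrite cP //; case: eqP lE => // ->; rewrite nE.
- move=> P hP.
  have /andP[_ /andP[/eqP Pl /eqP Pv]] : [&& cycle (corner_rel P) (w1 ++ w2),
      P l == P (head (head l w2) w1) & P (linv l) == P (head (head l w1) w2)].
    by rewrite -cycle_cut // !hP // !inE eqxx ?orbT.
  have hP' w : w \in (w1 ++ w2) :: ws -> cycle (corner_rel P) w.
    rewrite inE => /orP[/eqP -> |ww]; last by rewrite hP // !inE ww !orbT.
    have : cycle (corner_rel P) (rcons w1 (linv l)) && cycle (corner_rel P) (l :: w2).
      by rewrite !hP // !inE eqxx ?orbT.
    by rewrite cycle_cut // => /and3P[].
  (* the neighbour that stands in for a new segment *)
  pose rr k := if k == l then head (head l w2) w1 else
               if k == linv l then head (head l w1) w2 else k.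
  have rP k : k.1 \in l.1 :: E -> [/\ (rr k).1 \in E, P (rr k) = P k & ini (rr k) = ini' k].
    rewrite /rr inE => /orP[/eqP ek|kE].
      by case: (letter_eq ek) => ->; rewrite ?linv_neq eqxx.
    have kl : k.1 == l.1 = false by apply/eqP => ek; move: lE; rewrite -ek kE.
    case: (k =P l) => [ek|_]; first by rewrite ek eqxx in kl.
    case: (k =P linv l) => [ek|_]; first by rewrite ek eqxx in kl.
    by rewrite iniE.
  move=> a b /rP[a1 a2 a3] /rP[b1 b2 b3] eab.
  by rewrite -a2 -b2; apply: sP => //; rewrite a3 b3.
- move=> P hP p q pV qV; apply: nP => // k kE.
  by rewrite -iniE // -[ini (linv k)]iniE // hP // inE kE orbT.
Qed.

Lemma path_const (E : seq nat) (ini : letter -> nat) (P : pred nat) x w :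
  all (mem E) (map fst (x :: w)) ->
  (forall k : letter, k.1 \in E -> P (ini k) = P (ini (linv k))) ->
  path (corner_rel ini) x w -> P (ini x) = P (ini (linv (last x w))).
Proof.
move=> + hP; elim: w x => [|y w IH] x /=; first by rewrite andbT => /hP.
move=> /andP[/hP -> h] /andP[/eqP -> py]; exact: IH.
Qed.

(** A property constant along the corners of the glued surface extends to [l] and [linv l]
by the values at the neighbouring letters. The surface stays connected because [w1]
leads from one end of [l] to the other. *)
Lemma gluing_merge V E ini ws w1 w2 (l : letter) : w1 ++ w2 != [::] ->
  gluing V E ini (rcons w1 (linv l) :: (l :: w2) :: ws) ->
  gluing V (rem l.1 E) ini ((w1 ++ w2) :: ws).
Proof.
move=> w0 T; have [lE l1 l2 l3] := gluing_cut_fresh T; case: T => [uE iniV wP cP sP nP].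
have memE n : (n \in rem l.1 E) = (n != l.1) && (n \in E) by rewrite mem_rem_uniq.
have in1 : rcons w1 (linv l) \in rcons w1 (linv l) :: (l :: w2) :: ws by rewrite mem_head.
have in2 : l :: w2 \in rcons w1 (linv l) :: (l :: w2) :: ws by rewrite !inE eqxx orbT.
have in3 (w : word) : w \in ws -> w \in rcons w1 (linv l) :: (l :: w2) :: ws.
  by move=> ww; rewrite !inE ww !orbT.
have sub (w : word) : all (mem E) (map fst w) -> l.1 \notin map fst w ->
    all (mem (rem l.1 E)) (map fst w).
  move=> /allP wE lw; apply/allP => n nw; rewrite /= memE; apply/andP.
  by split; [apply: contra lw => /eqP <-|exact: wE].
have [_ a1 c1] := wP _ in1; have [_ a2 c2] := wP _ in2.
have {}a1 : all (mem E) (map fst w1) by move: a1; rewrite map_rcons all_rcons => /andP[].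
have {}a2 : all (mem E) (map fst w2) by case/andP: a2.
have sub1 := sub _ a1 l1; have sub2 := sub _ a2 l2.
have : [&& cycle (corner_rel ini) (w1 ++ w2), ini l == ini (head (head l w2) w1) &
    ini (linv l) == ini (head (head l w1) w2)] by rewrite -cycle_cut // c1 c2.
move=> /and3P[c12 /eqP inil /eqP iniv].
split.
- exact: rem_uniq.
- by move=> k; rewrite memE => /andP[_ /iniV].
- move=> w; rewrite inE => /orP[/eqP ->|ww].
    by split=> //; rewrite map_cat all_cat sub1.
  have [h1 h2 h3] := wP _ (in3 _ ww); split=> //; apply: sub => //.
  apply: contra l3 => /mapP[k kw ->]; apply/mapP; exists k => //.
  by apply/flattenP; exists w.
- move=> n; rewrite memE => /andP[nl /cP <-].
  rewrite /= -cats1 !map_cat !count_cat /= map_cat count_cat /= eq_sym (negPf nl).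
  by rewrite !add0n addn0 addnA.
- move=> P hP a b; rewrite !memE => /andP[al aE] /andP[bl bE] eab.
  pose P' (k : letter) := if k == l then P (head (head l w2) w1) else
               if k == linv l then P (head (head l w1) w2) else P k.
  have PP' (k : letter) : k.1 != l.1 -> P' k = P k.
    by move=> kl; rewrite /P'; do 2![case: eqP => [ek|_]; first by rewrite ek eqxx in kl].
  have cext (w : word) : all (mem E) (map fst w) -> l.1 \notin map fst w ->
      cycle (corner_rel P') w = cycle (corner_rel P) w.
    move=> wE lw; apply: (cycle_ext (sub _ wE lw)) => k; rewrite memE => /andP[kl _].
    exact: PP'.
  have /andP[cl1 cl2] : cycle (corner_rel P') (rcons w1 (linv l)) && cycle (corner_rel P') (l :: w2).
    rewrite cycle_cut // cext ?map_cat ?all_cat ?a1 ?a2 // ?mem_cat ?negb_or ?l1 //.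
    have -> : P' l = P (head (head l w2) w1) by rewrite /P' eqxx.
    have -> : P' (linv l) = P (head (head l w1) w2) by rewrite /P' linv_neq eqxx.
    rewrite hP ?mem_head //=.
    have h1 : (head (head l w2) w1).1 != l.1.
      case: (w1) l1 w0 => [|x u] /=; last by rewrite inE negb_or eq_sym => /andP[].
      by case: (w2) l2 => //= y v; rewrite inE negb_or eq_sym => /andP[].
    have h2 : (head (head l w1) w2).1 != l.1.
      case: (w2) l2 w0 => [|x u] /=; last by rewrite inE negb_or eq_sym => /andP[].
      by case: (w1) l1 => //= y v; rewrite inE negb_or eq_sym => /andP[].
    by rewrite !PP' ?eqxx.
  rewrite -!PP' //; apply: sP => // w; rewrite !inE => /or3P[/eqP -> //|/eqP -> //|ww].
  have [h1 h2 h3] := wP _ (in3 _ ww); rewrite cext // ?hP ?inE ?ww ?orbT //.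
  apply: contra l3 => /mapP[k kw ->]; apply/mapP; exists k => //.
  by apply/flattenP; exists w.
- move=> P hP; apply: nP.
  have hPl : P (ini l) = P (ini (linv l)).
    case: (w1) inil c1 sub1 => [|x u] /= inil c1 s1.
      by move: c1; rewrite /corner_rel linvK andbT => /eqP ->.
    move: c1; rewrite !rcons_path => /andP[/andP[pu /eqP e1] _].
    by rewrite inil (path_const s1 hP pu) e1.
  move=> k kE; case: (k.1 =P l.1) => [ek|/eqP kl]; last by apply: hP; rewrite memE kl.
  by case: (letter_eq ek) => ->; rewrite ?linvK hPl.
Qed.

(** A property constant along the corners that remain extends to [linv e] by its value
at the next letter, and [e] is the only segment at its initial point. A property of the
remaining points extends to that point by its value at the other end of [e]. *)
Lemma gluing_spur V E ini ws w2 (e : letter) : w2 != [::] ->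
  gluing V E ini ((linv e :: e :: w2) :: ws) ->
  (forall k : letter, k.1 \in E -> ini k = ini e -> k = e) ->
  gluing (filter (predC1 (ini e)) V) (rem e.1 E) ini (w2 :: ws).
Proof.
move=> w0 T only; have [fE wE] := gluing_letters T; case: T => [uE iniV wP cP sP nP].
have eE : e.1 \in E by have := wE (linv e) (mem_head _ _).
have memE n : (n \in rem e.1 E) = (n != e.1) && (n \in E) by rewrite mem_rem_uniq.
have [c2 c3] : count_mem e.1 (map fst w2) = 0 /\ count_mem e.1 (map fst (flatten ws)) = 0.
  have := cP _ eE; rewrite /= map_cat count_cat eqxx /= !add1n => /eqP.
  by rewrite !eqSS addn_eq0 => /andP[/eqP -> /eqP ->].
have [/count_memPn l2 /count_memPn l3] := (c2, c3).
have sub (w : word) : all (mem E) (map fst w) -> e.1 \notin map fst w ->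
    all (mem (rem e.1 E)) (map fst w).
  move=> /allP wwE lw; apply/allP => n nw; rewrite /= memE; apply/andP.
  by split; [apply: contra lw => /eqP <-|exact: wwE].
have in3 (w : word) : w \in ws -> w \in (linv e :: e :: w2) :: ws.
  by move=> ww; rewrite inE ww orbT.
have nin (w : word) : w \in ws -> e.1 \notin map fst w.
  move=> ww; apply: contra l3 => /mapP[k kw ->]; apply/mapP; exists k => //.
  by apply/flattenP; exists w.
have [_ aw cw] := wP _ (mem_head _ _).
have a2 : all (mem E) (map fst w2) by case/and3P: aw.
have spur (T : eqType) (P : letter -> T) : cycle (corner_rel P) (linv e :: e :: w2) =
    cycle (corner_rel P) w2 && (P (linv e) == P (head e w2)).
  case: (w2) w0 => // y v _; rewrite /= !rcons_path /corner_rel /= linvK eqxx /=.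
  by apply/idP/idP => h; bool_congruence.
split.
- exact: rem_uniq.
- move=> k; rewrite memE mem_filter => /andP[ke kE]; rewrite iniV // andbT /=.
  by apply: contra ke => /eqP /only ->.
- move=> w; rewrite inE => /orP[/eqP ->|ww].
    split=> //; first exact: sub.
    by move: cw; rewrite spur => /andP[].
  by have [h1 h2 h3] := wP _ (in3 _ ww); split=> //; apply: sub => //; exact: nin.
- move=> n; rewrite memE => /andP[nl /cP <-].
  by rewrite /= eq_sym (negPf nl).
- move=> P hP a b; rewrite !memE => /andP[al aE] /andP[bl bE] eab.
  pose P' (k : letter) := if k == linv e then P (head e w2) else P k.
  have PP' (k : letter) : k.1 != e.1 -> P' k = P k.
    by move=> kl; rewrite /P'; case: eqP => [ek|_ //]; rewrite ek eqxx in kl.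
  have cext (w : word) : all (mem E) (map fst w) -> e.1 \notin map fst w ->
      cycle (corner_rel P') w = cycle (corner_rel P) w.
    move=> wwE lw; apply: (cycle_ext (sub _ wwE lw)) => k; rewrite memE => /andP[kl _].
    exact: PP'.
  rewrite -!PP' //; apply: sP => // w; rewrite !inE => /orP[/eqP ->|ww].
    rewrite spur cext // hP ?mem_head //.
    have -> : P' (linv e) = P (head e w2) by rewrite /P' eqxx.
    rewrite PP' ?eqxx //.
    by case: (w2) l2 w0 => //= y v; rewrite inE negb_or eq_sym => /andP[].
  have [h1 h2 h3] := wP _ (in3 _ ww).
  by rewrite cext ?nin // hP // inE ww orbT.
- move=> P hP.
  pose P' q := if q == ini e then P (ini (linv e)) else P q.
  have eloop : ini (linv e) != ini e.
    apply/eqP => /only; rewrite -[(linv e).1]/e.1 => /(_ eE) /eqP.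
    by rewrite linv_neq.
  have hP' (k : letter) : k.1 \in E -> P' (ini k) = P' (ini (linv k)).
    move=> kE; case: (k.1 =P e.1) => [ek|/eqP ke].
      by case: (letter_eq ek) => ->; rewrite ?linvK /P' eqxx (negPf eloop).
    have ne (j : letter) : j.1 = k.1 -> (ini j == ini e) = false.
      by move=> jk; apply/eqP => /only; rewrite jk => /(_ kE) je; rewrite -jk je eqxx in ke.
    by rewrite /P' !ne // hP // memE ke.
  move=> p q; rewrite !mem_filter /= => /andP[pe pV] /andP[qe qV].
  by have := nP _ hP' p q pV qV; rewrite /P' (negPf pe) (negPf qe).
Qed.

Section RotatedWords.
Variables (X : countType) (E : seq nat) (act : letter -> X -> X).
Hypothesis actK : forall l : letter, l.1 \in E -> cancel (act l) (act (linv l)).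
Implicit Types (w : word) (x : X).

Lemma has_deg_rot w m i : all (mem E) (map fst w) -> has_deg act w m -> has_deg act (rot i w) m.
Proof.
move=> wE h j x; wlog ile : i / i <= size w.
  move=> wl; case: (leqP i (size w)) => [|/ltnW ile]; first exact: wl.
  by rewrite rot_oversize // -(h j x).
have tE : all (mem E) (map fst (take i w)).
  by move: wE; rewrite -{1}(cat_take_drop i w) map_cat all_cat => /andP[].
have hx : hol act (take i w) (hol act (winv (take i w)) x) = x.
  by rewrite -{1}(winvK (take i w)) (hol_winv actK) // map_fst_winv all_rev.
rewrite -hx hol_take_laps // -(h j (hol act (winv (take i w)) x)).
by apply/eqP/eqP => [/(hol_word_inj actK tE)|->].
Qed.

Lemma has_deg_same_cycle w w' m : all (mem E) (map fst w) -> same_cycle w w' ->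
  has_deg act w m -> has_deg act w' m.
Proof.
move=> wE [|] [i ->] h; first exact: has_deg_rot.
have hV := has_deg_winv actK wE h.
by apply: has_deg_rot => //; rewrite map_fst_winv all_rev.
Qed.

End RotatedWords.

Definition same_base (X Y : countType) (S : surf X) (S' : surf Y) :=
  [/\ sV S' = sV S, sE S' = sE S & sini S' = sini S].

Section Ops.
Variables (X : countType) (x0 : X).
Implicit Types (S : surf X) (F G : seq (word * nat)) (l : letter).

Lemma related_refl S : related x0 S S.
Proof. exact: rst_refl. Qed.

Lemma related_trans S1 S2 S3 :
  related x0 S1 S2 -> related x0 S2 S3 -> related x0 S1 S3.
Proof. exact: rst_trans. Qed.

Lemma related_sym S1 S2 : related x0 S1 S2 -> related x0 S2 S1.
Proof. exact: rst_sym. Qed.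

Lemma word_E S w m : (w, m) \in sF S ->
  [/\ w != [::], all (mem (sE S)) (map fst w) & cycle (corner_rel (sini S)) w].
Proof. by move=> wF; apply: (gl_word (s_gluing S)); exact: (map_f fst wF). Qed.

Lemma surf_perm S F : perm_eq (sF S) F ->
  exists S', [/\ sF S' = F, same_base S S' & related x0 S S'].
Proof.
move=> pF; have T := gluing_perm (perm_map fst pF) (s_gluing S).
have Br : branching (sE S) (sact S) F.
  case: (s_branching S) => aK dP; split=> // w m; rewrite -(perm_mem pF); exact: dP.
exists (Surf T Br); split=> //.
move: pF; rewrite perm_sym => /(perm_iotaP ([::], 1))[Is pI EF].
have uI : uniq Is by rewrite (perm_uniq pI) iota_uniq.
have mI i : (i \in Is) = (i < size (sF S)) by rewrite (perm_mem pI) mem_iota.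
have sF' : size F = size Is by rewrite EF size_map.
apply: (@reface_related X x0 S (Surf T Br) (index^~ Is) (fun _ => false) (fun _ => 0)) => //=.
- by move=> i il; rewrite sF' index_mem mI.
- move=> i j il jl e; rewrite -(nth_index 0 (s := Is) (x := i)) ?mI // e nth_index //.
  by rewrite mI.
- move=> i; rewrite sF' => il; exists (nth 0 Is i); last exact: index_uniq.
  by rewrite -mI mem_nth.
- move=> i il; rewrite rot0 /face /= EF (nth_map 0) ?index_mem ?mI //.
  by rewrite nth_index // mI.
- by move=> i il; have [] := face_wordP il; rewrite lt0n size_eq0.
- move=> i il; rewrite /face /= EF (nth_map 0) ?index_mem ?mI //.
  by rewrite nth_index // mI.
Qed.

Lemma surf_head S w w' m G : sF S = (w, m) :: G -> same_cycle w w' ->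
  exists S', [/\ sF S' = (w', m) :: G, same_base S S' & related x0 S S'].
Proof.
move=> FS e.
have T : gluing (sV S) (sE S) (sini S) (map fst ((w', m) :: G)).
  by have := s_gluing S; rewrite FS /=; exact: gluing_head.
have [w0 wE _] : [/\ w != [::], all (mem (sE S)) (map fst w) & cycle (corner_rel (sini S)) w].
  by apply: (@word_E S w m); rewrite FS mem_head.
have Br : branching (sE S) (sact S) ((w', m) :: G).
  case: (s_branching S) => aK dP; split=> // v k; rewrite inE => /orP[/eqP[-> ->]|vG].
    have [|? ?] := dP w m; first by rewrite FS mem_head.
    by split=> //; exact: (has_deg_same_cycle aK wE e).
  by apply: dP; rewrite FS inE vG orbT.
exists (Surf T Br); split=> //.
have [b [i il Ew]] : exists b, exists2 i, i < size w & w' = rot i (if b then winv w else w).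
  have w0' : 0 < size w by rewrite lt0n size_eq0.
  case: e => -[i ->]; [exists false|exists true]; case: (ltnP i (size w)) => il;
    by [exists i | exists 0; rewrite ?rot0 // rot_oversize // size_winv].
apply: (@reface_related X x0 S (Surf T Br) id (fun j => (j == 0) && b)
  (fun j => if j == 0 then i else 0)) => //=.
- by rewrite FS.
- by move=> j; rewrite FS /=; exists j.
- by move=> [|j] jl; rewrite (face_cons _ FS) /face /= ?rot0.
- move=> [|j] jl; first by rewrite (face_cons _ FS).
  by have [] := face_wordP jl; rewrite lt0n size_eq0.
- by move=> [|j] jl; rewrite (face_cons _ FS) /face.
Qed.

(** The new segment is made to act as [w1], so that the part cut off has order one. *)
Lemma surf_split S w1 w2 m G : sF S = (w1 ++ w2, m) :: G ->
  exists S' l, [/\ sF S' = (rcons w1 (linv l), 1) :: (l :: w2, m) :: G,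
    [/\ sV S' = sV S, sE S' = l.1 :: sE S & l.1 \notin sE S],
    [/\ forall k : letter, k.1 \in sE S -> sini S' k = sini S k,
        sini S' l = sini S (head (head l w2) w1) &
        sini S' (linv l) = sini S (head (head l w1) w2)],
    (forall k : letter, k.1 \in sE S -> sact S' k = sact S k) /\
      (forall x, sact S' l x = hol (sact S) w1 x) & related x0 S S'].
Proof.
move=> FS; pose l : letter := ((foldr maxn 0 (sE S)).+1, true).
have lE : l.1 \notin sE S.
  apply/negP => /= h; suff : forall n, n \in sE S -> n <= foldr maxn 0 (sE S).
    by move=> /(_ _ h); rewrite ltnn.
  elim: (sE S) => //= a s IH n; rewrite inE leq_max => /orP[/eqP ->|/IH ->].
    by rewrite leqnn.
  by rewrite orbT.
pose ini' k := if k == l then sini S (head (head l w2) w1) else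
               if k == linv l then sini S (head (head l w1) w2) else sini S k.
pose act' k := if k == l then hol (sact S) w1 else
               if k == linv l then hol (sact S) (winv w1) else sact S k.
have kl (k : letter) : k.1 \in sE S -> (k == l) = false /\ (k == linv l) = false.
  by move=> kE; split; apply/eqP => ek; move: lE; rewrite (_ : l.1 = k.1) ?kE // ek.
have iniE (k : letter) : k.1 \in sE S -> ini' k = sini S k.
  by move=> /kl[h1 h2]; rewrite /ini' h1 h2.
have actE (k : letter) : k.1 \in sE S -> act' k = sact S k.
  by move=> /kl[h1 h2]; rewrite /act' h1 h2.
have inil : ini' l = sini S (head (head l w2) w1) by rewrite /ini' eqxx.
have iniv : ini' (linv l) = sini S (head (head l w1) w2).
  by rewrite /ini' linv_neq eqxx.
pose F' := (rcons w1 (linv l), 1) :: (l :: w2, m) :: G.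
have T : gluing (sV S) (l.1 :: sE S) ini' (map fst F').
  apply: (@gluing_split _ _ (sini S) ini' (map fst G)) => //.
  by have := s_gluing S; rewrite FS.
have in0 : (w1 ++ w2, m) \in sF S by rewrite FS mem_head.
have [_ + _] := word_E in0; rewrite map_cat all_cat => /andP[w1E w2E].
have [aK dP] := s_branching S.
have holE (w : word) x : all (mem (sE S)) (map fst w) -> hol act' w x = hol (sact S) w x.
  by elim: w x => //= k w IH x /andP[kE wE]; rewrite actE // IH.
have act'K (k : letter) : k.1 \in l.1 :: sE S -> cancel (act' k) (act' (linv k)).
  rewrite inE => /orP[/eqP ek|kE]; last by rewrite !actE //; exact: aK.
  case: (letter_eq ek) => -> x; rewrite ?linvK /act' ?linv_neq ?eqxx.
    exact: (hol_winv aK).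
  by rewrite -{1}(winvK w1) (hol_winv aK) // map_fst_winv all_rev.
have Br : branching (l.1 :: sE S) act' F'.
  split=> // w k; rewrite !inE => /or3P[/eqP[-> ->]|/eqP[-> ->]|wG].
  - split=> // j x; rewrite dvd1n; apply/eqP.
    have h y : hol act' (rcons w1 (linv l)) y = y.
      rewrite hol_rcons holE // -[hol _ _ y]/((fun=> hol (sact S) w1 y) tt).
      by rewrite /act' linv_neq eqxx (hol_winv aK).
    by elim: j => //= j ->.
  - have [m0 dm] := dP _ _ in0; split=> // j x; rewrite -(dm j x); congr (_ == _).
    apply: eq_iter => y; rewrite /= hol_cat holE // /act' eqxx.
    by [].
  have [|k0 dk] := dP w k; first by rewrite FS inE wG orbT.
  split=> // j x; rewrite -(dk j x); congr (_ == _); apply: eq_iter => y.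
  have wF : (w, k) \in sF S by rewrite FS inE wG orbT.
  by rewrite holE //; have [] := word_E wF.
exists (Surf T Br), l; split=> //; first by split=> // x; rewrite /= /act' eqxx.
apply: (@split_related X x0 S (Surf T Br) w1 w2 m l G) => //.
by move=> k x kE /=; rewrite actE.
Qed.

(** The first face has order one, so [l] acts as [w1]; hence the given
surface is a splitting of the glued one with the same action. *)
Lemma surf_merge S w1 w2 m l G : w1 ++ w2 != [::] ->
  sF S = (rcons w1 (linv l), 1) :: (l :: w2, m) :: G ->
  exists S', [/\ sF S' = (w1 ++ w2, m) :: G,
    [/\ sV S' = sV S, sE S' = rem l.1 (sE S) & sini S' = sini S] & related x0 S S'].
Proof.
move=> w0 FS.
have T0 := s_gluing S; rewrite FS /= in T0.
have [lE l1 l2 l3] := gluing_cut_fresh T0.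
have T : gluing (sV S) (rem l.1 (sE S)) (sini S) (map fst ((w1 ++ w2, m) :: G)).
  exact: gluing_merge T0.
have [aK dP] := s_branching S.
have memE n : (n \in rem l.1 (sE S)) = (n != l.1) && (n \in sE S).
  by rewrite mem_rem_uniq // (gl_uniq T0).
have Br : branching (rem l.1 (sE S)) (sact S) ((w1 ++ w2, m) :: G).
  split=> [k|w k]; first by rewrite memE => /andP[_ /aK].
  rewrite inE => /orP[/eqP[-> ->]|wG]; last by apply: dP; rewrite FS !inE wG !orbT.
  have [_ d1] : 0 < 1 /\ has_deg (sact S) (rcons w1 (linv l)) 1 by apply: dP; rewrite FS mem_head.
  have [m0 d2] : 0 < m /\ has_deg (sact S) (l :: w2) m by apply: dP; rewrite FS !inE eqxx orbT.
  split=> // j x; rewrite -(d2 j x); congr (_ == _); apply: eq_iter => y.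
  have e : sact S (linv l) (hol (sact S) w1 y) = y.
    by have /eqP := d1 1 y; rewrite /= hol_rcons.
  rewrite hol_cat; have -> : hol (sact S) (l :: w2) y = hol (sact S) w2 (sact S l y) by [].
  congr hol; rewrite -{2}e; have := aK (linv l) lE (hol (sact S) w1 y).
  by rewrite linvK.
exists (Surf T Br); split=> //; apply: related_sym.
apply: (@split_related X x0 (Surf T Br) S w1 w2 m l G) => //=.
- by move=> n; rewrite inE memE; case: eqP => // ->.
- by rewrite memE eqxx.
Qed.

(** Doubling the spur by a cut gives the faces [linv e, linv t] and [t, e, w2], and the tip
of the spur is then the middle of the path [t, e]. So the surface is the subdivision of
one with the faces [linv a] and [a, w2], which glued along [a] leave [w2]. *)
Lemma surf_spur S e w2 m G : w2 != [::] ->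
  sF S = (linv e :: e :: w2, m) :: G ->
  (forall k : letter, k.1 \in sE S -> sini S k = sini S e -> k = e) ->
  exists S', [/\ sF S' = (w2, m) :: G,
    sV S' = filter (predC1 (sini S e)) (sV S), sE S' = rem e.1 (sE S) &
    related x0 S S'].
Proof.
move=> w0 FS only.
have T0 := s_gluing S; rewrite FS /= in T0.
have eE : e.1 \in sE S.
  by have [_ wE] := gluing_letters T0; have := wE (linv e) (mem_head _ _).
have T : gluing (filter (predC1 (sini S e)) (sV S)) (rem e.1 (sE S)) (sini S)
    (map fst ((w2, m) :: G)) by exact: gluing_spur T0 only.
have [aK dP] := s_branching S.
have memE n : (n \in rem e.1 (sE S)) = (n != e.1) && (n \in sE S).
  by rewrite mem_rem_uniq // (gl_uniq T0).
have Br : branching (rem e.1 (sE S)) (sact S) ((w2, m) :: G).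
  split=> [k|w k]; first by rewrite memE => /andP[_ /aK].
  rewrite inE => /orP[/eqP[-> ->]|wG]; last by apply: dP; rewrite FS !inE wG !orbT.
  have [m0 d2] : 0 < m /\ has_deg (sact S) (linv e :: e :: w2) m.
    by apply: dP; rewrite FS mem_head.
  split=> // j x; rewrite -(d2 j x); congr (_ == _); apply: eq_iter => y.
  have -> : hol (sact S) (linv e :: e :: w2) y =
    hol (sact S) w2 (sact S e (sact S (linv e) y)) by [].
  by congr hol; have := aK (linv e) eE y; rewrite linvK.
pose S' := Surf T Br; exists S'; split=> //.
have [S1 [t [FS1 [V1 E1 tE] [ini1 int fit] [act1 actt] rel1]]] :=
  @surf_split S [:: linv e] (e :: w2) m G FS.
have [S2 [a [FS2 [V2 E2 aE] [ini2 ina fia] [act2 acta] rel2]]] :=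
  @surf_split S' [::] w2 m G erefl.
apply: related_trans rel1 _; apply: related_sym.
apply: related_trans rel2 _.
rewrite /= in V2 E2 aE ini2 act2 int fit ina fia.
have [_ _ cw] : [/\ linv e :: e :: w2 != [::],
    all (mem (sE S)) (map fst (linv e :: e :: w2)) &
    cycle (corner_rel (sini S)) (linv e :: e :: w2)] by apply: (@word_E S _ m); rewrite FS mem_head.
have inw2 x : sini S (head x w2) = sini S (linv e).
  by case: (w2) w0 cw => //= y v _ /and3P[_ /eqP -> _].
have nsub (w : word) : all (mem (rem e.1 (sE S))) (map fst w) -> substw a t e w = w.
  rewrite /substw; elim: w => //= k w IH /andP[kE wE]; rewrite IH // /subst1.
  have ka : k.1 != a.1 by apply: contra aE => /eqP <-.
  by do 2![case: eqP => [ek|_]; first by rewrite ek eqxx in ka].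
have [w2E GE] : all (mem (rem e.1 (sE S))) (map fst w2) /\
    forall wm, wm \in G -> all (mem (rem e.1 (sE S))) (map fst wm.1).
  split; first by have [|_ ? _] := @word_E S' w2 m; first exact: mem_head.
  by move=> [w k] wG; have [|_ ? _] := @word_E S' w k; first by rewrite inE wG orbT.
apply: (@subdivision_related X x0 S2 S1 a t e (sini S e)).
- rewrite FS1 FS2 /=; congr [:: _, _ & _].
  + by rewrite /substw /= /subst1 linv_neq eqxx.
  + by rewrite /substw /= {1}/subst1 eqxx -/(substw a t e w2) nsub.
  rewrite -[LHS]map_id; apply/eq_in_map => -[w k] /GE wE.
  by rewrite nsub.
- by rewrite E2 mem_head.
- by apply: contra tE => /eqP ->.
- move=> n; rewrite E1 E2 !inE memE.
  have -> : (n != a.1) && ((n == a.1) || (n != e.1) && (n \in sE S)) =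
      (n != e.1) && (n \in sE S).
    by case: (n =P a.1) => [->|] //=; rewrite memE in aE; rewrite (negPf aE).
  by case: (n =P e.1) => [->|_]; rewrite ?eE ?orbT ?orbF // orbC.
- by move=> p; rewrite V1 V2 !inE mem_filter /=; case: eqP => // ->; rewrite (gl_ini T0).
- by rewrite V2 mem_filter /= eqxx.
- move=> k; rewrite E2 inE => /orP[-> //|kE] _; rewrite ini2 // ini1 //.
  by move: kE; rewrite memE => /andP[].
- by rewrite int ina /= inw2.
- by rewrite fit.
- by rewrite ini1.
- by rewrite fia ini1 //= inw2.
- move=> k x; rewrite E2 inE => /orP[-> //|kE] _; rewrite act2 // act1 //.
  by move: kE; rewrite memE => /andP[].
- by move=> x; rewrite acta actt act1 //=; have := aK (linv e) eE x; rewrite linvK.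
Qed.

End Ops.

(** * Reduction to one point *)

(** The orders of the branched faces. *)
Definition branch_orders (F : seq (word * nat)) : seq nat := [seq m <- map snd F | 1 < m].

Lemma branch_orders_perm F F' : perm_eq F F' -> perm_eq (branch_orders F) (branch_orders F').
Proof. by move=> h; apply: perm_filter; apply: perm_map. Qed.

Lemma not_cycle (T : Type) (r : rel T) w : ~~ cycle r w ->
  (exists a b u, is_rot w [:: a, b & u] /\ ~~ r a b) \/
  (exists a, w = [:: a] /\ ~~ r a a).
Proof.
case: w => // x w.
have np (y : T) s : ~~ path r y s -> exists s1 a b s2, y :: s = s1 ++ [:: a, b & s2] /\ ~~ r a b.
  elim: s y => //= z s IH y; rewrite negb_and; case: (boolP (r y z)) => /= [_|ryz _].
    by move=> /IH[s1 [a [b [s2 [-> h]]]]]; exists (y :: s1), a, b, s2.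
  by exists [::], y, z, s.
rewrite [cycle _ _]/= => /np[s1 [a [b [s2]]]].
case: (lastP s2) => [|s2' z] [E h].
  have : rcons (x :: w) x = rcons (rcons s1 a) b.
    by rewrite rcons_cons E -!cats1 -catA.
  move=> /rcons_inj[E1 E2]; case: s1 {E} E1 => [|y s1] /= [Ex Ew].
    by right; exists a; rewrite Ex Ew; split=> //; rewrite -E2 Ex in h.
  left; exists a, b, s1; split=> //; rewrite Ew -E2 Ex.
  by apply/is_rotP; exists (y :: s1), [:: a]; rewrite cats1.
have : rcons (x :: w) x = rcons (s1 ++ [:: a, b & s2']) z.
  by rewrite rcons_cons E rcons_cat.
move=> /rcons_inj[-> _]; left; exists a, b, (s2' ++ s1); split=> //.
by apply/is_rotP; exists s1, [:: a, b & s2'].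
Qed.

Lemma is_rot_mem (T : eqType) (k : T) w : k \in w -> exists u, is_rot w (k :: u).
Proof. by move=> /rot_to[i u E]; exists u, i. Qed.

Lemma same_cycle_mem (k : letter) w : k.1 \in map fst w -> exists u, same_cycle w (k :: u).
Proof.
move=> /mapP[j jw ek]; case: (letter_eq ek) => Ek.
  by have [|u hu] := @is_rot_mem _ k w; [rewrite Ek|exists u; left].
have [|u hu] := @is_rot_mem _ k (winv w); last by exists u; right.
by rewrite mem_winv Ek linvK.
Qed.

Lemma same_cycle_refl w : same_cycle w w.
Proof. by left; exact: is_rot_refl. Qed.

Lemma is_rot_winv w v : is_rot w v -> is_rot (winv w) (winv v).
Proof. by move=> [i ->]; rewrite winv_rot; eexists. Qed.

Lemma cycle_const (P : pred letter) c (w : word) :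
  (forall k, k \in w -> P k = c /\ P (linv k) = c) -> cycle (corner_rel P) w.
Proof.
move=> h; have -> : cycle (corner_rel P) w = cycle (fun _ _ => true) w.
  apply: (@eq_in_cycle _ (mem w)) => [a b aw bw|]; last exact/allP.
  by rewrite /corner_rel; have [_ ->] := h a aw; have [-> _] := h b bw; rewrite eqxx.
by case: w {h} => //= x w; move: (rcons w x) => s; elim: s x => //=.
Qed.

Definition letters (E : seq nat) : seq letter :=
  map (pair^~ true) E ++ map (pair^~ false) E.

Lemma mem_letters E (k : letter) : (k \in letters E) = (k.1 \in E).
Proof.
rewrite mem_cat; case: k => n b; apply/orP/idP => /=.
  by case=> /mapP[m mE [-> _]].
by move=> nE; case: b; [left|right]; apply/mapP; exists n.
Qed.

Lemma count_letters_cons (P : pred letter) n E :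
  count P (letters (n :: E)) = P (n, true) + P (n, false) + count P (letters E).
Proof. by rewrite /letters /= !count_cat /=; lia. Qed.

Lemma count_letters_perm (P : pred letter) E E' : perm_eq E E' ->
  count P (letters E) = count P (letters E').
Proof.
move=> pE; apply/permP: P; rewrite /letters; apply: perm_cat; exact: perm_map.
Qed.

Lemma perm_swap (T : eqType) (a b : T) s : perm_eq (a :: b :: s) (b :: a :: s).
Proof. exact: permEl (perm_catCA [:: a] [:: b] s). Qed.

Section OneVertex.
Variables (X : countType) (x0 : X).
Implicit Types (S : surf X).

Lemma surf_front S w m w' : (w, m) \in sF S -> same_cycle w w' ->
  exists S', [/\ sF S' = (w', m) :: rem (w, m) (sF S), same_base S S' & related x0 S S'].
Proof.
move=> wF e; have [S1 [FS1 [V1 E1 i1] r1]] := surf_perm x0 (perm_to_rem wF).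
have [S2 [FS2 [V2 E2 i2] r2]] := surf_head x0 FS1 e.
exists S2; split=> //; first by rewrite /same_base V2 E2 i2.
exact: related_trans r1 r2.
Qed.

Definition degree S p := count (fun l => sini S l == p) (letters (sE S)).

(** No other segment starts at either end of [e], so by connectedness there is no other
face. *)
Lemma spur_sphere S (e : letter) m G : sF S = ([:: linv e; e], m) :: G ->
  (forall k : letter, k.1 \in sE S -> sini S k = sini S e -> k = e) -> G = [::].
Proof.
move=> FS only; case: (s_gluing S); rewrite FS /= => uE iniV wP cP sP nP.
have inE0 : [:: linv e; e] \in [:: linv e; e] :: map fst G by rewrite mem_head.
have [_ /and3P[eE _ _] _] := wP _ inE0.
have ne (v : word) k : v \in map fst G -> k \in v -> k.1 != e.1.
  move=> vG kv; apply/negP => /eqP ke; have := cP _ eE.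
  rewrite /= !eqxx !add1n => /eqP; rewrite !eqSS => /eqP/count_memPn/negP; apply.
  by rewrite -ke; apply: map_f; apply/flattenP; exists v.
case: G FS ne wP cP sP inE0 => // -[v m'] G FS ne wP cP sP _.
have vin : v \in map fst ((v, m') :: G) by rewrite /= mem_head.
have [v0 vE _] := wP v (mem_behead (s := [:: linv e; e] :: _) vin).
have [k kv] : exists k, k \in v by case: (v) v0 => // k v' _; exists k; rewrite mem_head.
have kE : k.1 \in sE S by apply: (allP vE); exact: map_f.
have star j : j.1 \in sE S -> sini S j = sini S (linv e) -> j = linv e.
  move=> jE ej; apply/eqP; suff -> : (j == linv e) = (linv e == linv e) by [].
  apply: (sP (pred1 (linv e))) => // w; rewrite inE => /orP[/eqP ->|wG].
    by rewrite /= /corner_rel /= linvK !eqxx.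
  apply: (cycle_const (c := false)) => j' j'w /=; have := ne _ _ wG j'w.
  by move=> nj; split; apply/eqP => ej'; move: nj; rewrite -?[j'.1]/((linv j').1) ej' eqxx.
have ek (j : letter) : j.1 = k.1 -> ((sini S j == sini S e) || (sini S j == sini S (linv e))) = false.
  move=> jk; have nk := ne _ _ vin kv; apply/negP => /orP[] /eqP.
    by move/only; rewrite jk => /(_ kE) je; rewrite -jk je eqxx in nk.
  by move/star; rewrite jk => /(_ kE) je; rewrite -jk je eqxx in nk.
pose P q := (q == sini S e) || (q == sini S (linv e)).
suff hP (j : letter) : j.1 \in sE S -> P (sini S j) = P (sini S (linv j)).
  by have := nP P hP _ _ (iniV e eE) (iniV k kE); rewrite /P eqxx ek.
move=> jE; case: (j.1 =P e.1) => [ej|/eqP nj].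
  by case: (letter_eq ej) => ->; rewrite ?linvK /P !eqxx ?orbT.
have h (i : letter) : i.1 = j.1 -> P (sini S i) = false.
  move=> ij; apply/negP => /orP[] /eqP.
    by move/only; rewrite ij => /(_ jE) ie; rewrite -ij ie eqxx in nj.
  by move/star; rewrite ij => /(_ jE) ie; rewrite -ij ie eqxx in nj.
by rewrite !h.
Qed.

(** Otherwise the property of being [e] would be constant along all corners, and by
[gl_star] no other segment would start at the initial point of [e]. *)
Lemma find_corner S (e k : letter) : e.1 \in sE S -> sini S e != sini S (linv e) ->
  k.1 \in sE S -> sini S k = sini S e -> k != e ->
  exists w m b u, [/\ (w, m) \in sF S, same_cycle w [:: linv e, b & u] & b != e].
Proof.
move=> eE eloop kE ek ke.
case: (boolP (all (fun wm => cycle (corner_rel (pred1 e)) wm.1) (sF S))) => [/allP h|].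
  have h' w : w \in map fst (sF S) -> cycle (corner_rel (pred1 e)) w.
    by move=> /mapP[wm wF ->]; exact: h.
  by have := gl_star (s_gluing S) h' kE eE ek; rewrite /= eqxx (negPf ke).
move=> /allPn[[w m] wF /= /not_cycle[[a [b [u [rw]]]]|[a [Ew]]]].
  have [_ _ cw] := word_E wF.
  move: cw; rewrite (is_rot_cycle _ rw) => /andP[/eqP eab _].
  rewrite /corner_rel /= => h; exists w, m.
  case: (linv a =P e) h => [Ea|/eqP ane].
    by rewrite eq_sym eqb_id => be; exists b, u; split=> //; rewrite -Ea linvK; left.
  rewrite eq_sym eqbF_neg negbK => /eqP be.
  have [u' hu'] : exists u', is_rot (winv [:: a, b & u]) [:: linv b, linv a & u'].
    exists (winv u); apply/is_rotP; exists (winv u), [:: linv b; linv a].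
    by split=> //; rewrite /winv /= !rev_cons -!cats1 -catA.
  exists (linv a), u'; split=> //; rewrite -be.
  by right; apply: is_rot_trans hu'; exact: is_rot_winv.
have [_ _] := word_E wF; rewrite Ew /= /corner_rel andbT => /eqP el h.
exfalso; move: h eloop; rewrite /=; case: (a =P e) => [<-|_]; first by rewrite el eqxx.
case: (linv a =P e) => [<-|_]; last by rewrite eqxx.
by rewrite linvK el eqxx.
Qed.

(** The triangle of [linv e], [b] and a new segment is cut off and glued to the face on
the other side of [b]. The effect is to replace [b], which starts at the point [p] where
[e] starts, by a segment with the same final point that starts at the final point of
[e]; so one segment less starts at [p]. *)
Lemma reduce_step S (e b : letter) w m u : e.1 \in sE S ->
  sini S e != sini S (linv e) -> (w, m) \in sF S -> same_cycle w [:: linv e, b & u] ->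
  b != e -> exists S', [/\ related x0 S S', sV S' = sV S, e.1 \in sE S' &
    [/\ sini S' e = sini S e, sini S' (linv e) = sini S (linv e),
     degree S' (sini S e) < degree S (sini S e) &
     perm_eq (branch_orders (sF S')) (branch_orders (sF S))]].
Proof.
move=> eE eloop wF we be.
have [S1 [FS1 [V1 E1 i1] r1]] := surf_front wF we; set G := rem _ _ in FS1.
have in1 : ([:: linv e, b & u], m) \in sF S1 by rewrite FS1 mem_head.
have [_ wE cw] := word_E in1.
have bE : b.1 \in sE S by move: wE; rewrite E1 => /and3P[].
have ib : sini S b = sini S e by case/andP: cw; rewrite /corner_rel linvK i1 => /eqP ->.
have beV : b != linv e by apply: contra eloop => /eqP <-; rewrite ib.
have be1 : b.1 != e.1.
  by apply/negP => /eqP /letter_eq[] /eqP; [rewrite (negPf be)|rewrite (negPf beV)].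
have [S2 [t [FS2 [V2 E2 tE] [i2 it itv] _ r2]]] :=
  @surf_split X x0 S1 [:: linv e; b] u m G FS1.
rewrite /= i1 in it; rewrite /= i1 in itv; rewrite E1 in E2 tE i2; rewrite i1 in i2.
have bt : b.1 != t.1 by apply: contra tE => /eqP <-.
have fb : sini S2 (linv t) = sini S (linv b).
  rewrite itv; move: cw; rewrite i1 /=; case: (u) => [|y v] /= /and3P[_ /eqP -> _] //.
(* [b] occurs once in the triangle, hence once in the other faces *)
have [v [m' [vL bv]]] : exists v m', (v, m') \in (t :: u, m) :: G /\ b.1 \in map fst v.
  have bE2 : b.1 \in sE S2 by rewrite E2 inE bE orbT.
  have := gl_count (s_gluing S2) bE2; rewrite FS2.
  have -> : count_mem b.1 (map fst (flatten (map fst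
      ((rcons [:: linv e; b] (linv t), 1) :: (t :: u, m) :: G)))) =
    (e.1 == b.1) + ((b.1 == b.1) + ((t.1 == b.1) +
      count_mem b.1 (map fst (flatten (map fst ((t :: u, m) :: G)))))) by [].
  rewrite eqxx [e.1 == _]eq_sym (negPf be1) [t.1 == _]eq_sym (negPf bt).
  case: (boolP (b.1 \in map fst (flatten (map fst ((t :: u, m) :: G))))) => [h _|].
    have /mapP[j /flattenP[v /mapP[[v' m'] vL ->] jv] ej] := h.
    by exists v', m'; split=> //; rewrite ej; exact: map_f.
  by move=> /count_memPn ->.
have [v' vv'] := @same_cycle_mem (linv b) v bv.
set tri := (rcons [:: linv e; b] (linv t), 1) in FS2.
set L := (t :: u, m) :: G in vL FS2.
have vF : (v, m') \in sF S2 by rewrite FS2 inE vL orbT.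
have p3 : perm_eq (sF S2) ((v, m') :: tri :: rem (v, m') L).
  rewrite FS2 (perm_trans _ (_ : perm_eq (tri :: (v, m') :: rem (v, m') L) _)) //.
    by rewrite perm_cons perm_to_rem.
  exact: perm_swap.
have [S3 [FS3 [V3 E3 i3] r3]] := surf_perm x0 p3.
have [S4 [FS4 [V4 E4 i4] r4]] := surf_head x0 FS3 vv'.
have p5 : perm_eq (sF S4) (tri :: (linv b :: v', m') :: rem (v, m') L).
  by rewrite FS4 perm_swap.
have [S5 [FS5 [V5 E5 i5] r5]] := surf_perm x0 p5.
have h6 : same_cycle (rcons [:: linv e; b] (linv t)) (rcons [:: linv t; linv e] (linv (linv b))).
  by left; apply/is_rotP; exists [:: linv e; b], [:: linv t]; rewrite linvK.
have [S6 [FS6 [V6 E6 i6] r6]] := surf_head x0 FS5 h6.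
have [//|S7 [FS7 [V7 E7 i7] r7]] := @surf_merge X x0 S6 [:: linv t; linv e] v' m' (linv b)
  (rem (v, m') L) _ FS6.
have iE : sini S7 = sini S2 by rewrite i7 i6 i5 i4 i3.
have EE : sE S7 = rem b.1 (t.1 :: sE S) by rewrite E7 E6 E5 E4 E3 E2.
have uE : uniq (t.1 :: sE S) by have := gl_uniq (s_gluing S2); rewrite E2.
exists S7; split.
- apply: related_trans r1 _; apply: related_trans r2 _; apply: related_trans r3 _.
  apply: related_trans r4 _; apply: related_trans r5 _; apply: related_trans r6 _.
  exact: r7.
- by rewrite V7 V6 V5 V4 V3 V2 V1.
- by rewrite EE mem_rem_uniq // inE eq_sym be1 inE eE orbT.
split.
- by rewrite iE i2.
- by rewrite iE i2.
- set P := fun l => sini S2 l == sini S e.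
  have Eold : degree S (sini S e) = count P (letters (sE S)).
    by apply: eq_in_count => l; rewrite mem_letters /P => lE; rewrite i2.
  have Enew : degree S7 (sini S e) = count P (letters (rem b.1 (t.1 :: sE S))).
    by rewrite /degree EE iE.
  have pE : perm_eq (t.1 :: sE S) (b.1 :: rem b.1 (t.1 :: sE S)).
    by apply: perm_to_rem; rewrite inE bE orbT.
  have both (l : letter) : P (l.1, true) + P (l.1, false) = P l + P (linv l).
    by case: l => n [] //=; rewrite addnC.
  have Pb : P b = true by rewrite /P i2 // ib eqxx.
  have Pt : P t = false by rewrite /P it eq_sym (negPf eloop).
  have Ptv : P (linv t) = P (linv b) by rewrite /P fb i2.
  rewrite Eold Enew; have := count_letters_perm P pE.
  rewrite !count_letters_cons (both t) (both b) Pb Pt Ptv.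
  by rewrite !add0n addnC addnAC => /addIn ->; rewrite add1n.
- rewrite /branch_orders FS7; apply: perm_filter.
  apply: (@perm_trans _ (map snd L)).
    by rewrite perm_sym; apply: (perm_map snd (perm_to_rem vL)).
  by rewrite perm_sym; apply: (perm_map snd (perm_to_rem wF)).
Qed.

Lemma letter_word S n : n \in sE S ->
  exists w m, (w, m) \in sF S /\ n \in map fst w.
Proof.
move=> nE; have := gl_count (s_gluing S) nE.
case: (boolP (n \in map fst (flatten (map fst (sF S))))) => [h _|/count_memPn ->] //.
have /mapP[j /flattenP[v /mapP[[v' m'] vL ->] jv] ej] := h.
by exists v', m'; split=> //; rewrite ej; exact: map_f.
Qed.

(** When [e] is alone at its initial point, [linv e] is followed by [e] in the face that
contains it. This spur is not a whole face: one turn around it is the identity, so it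
would be unbranched and by [spur_sphere] the only face. *)
Lemma reduce_points d S (e : letter) : degree S (sini S e) <= d -> e.1 \in sE S ->
  sini S e != sini S (linv e) -> branch_orders (sF S) != [::] ->
  exists S', [/\ related x0 S S', size (sV S') < size (sV S) &
    perm_eq (branch_orders (sF S')) (branch_orders (sF S))].
Proof.
elim: d S => [|d IH] S dS eE eloop b0.
  move: dS; rewrite leqn0 eqn0Ngt -has_count => /hasPn /(_ e).
  by rewrite mem_letters eqxx => /(_ eE).
case: (boolP (has (fun k => (sini S k == sini S e) && (k != e)) (letters (sE S)))).
  case/hasP => k; rewrite mem_letters => kE /andP[/eqP ek ke].
  have [w [m [b [u [wF we be]]]]] := find_corner eE eloop kE ek ke.
  have [S1 [r1 V1 eE1 [i1 i1' d1 p1]]] := reduce_step eE eloop wF we be.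
  have [|//|||S2 [r2 V2 p2]] := IH S1.
  - by rewrite i1; move: (leq_trans d1 dS).
  - by rewrite i1 i1'.
  - by move: b0; rewrite -!size_eq0 (perm_size p1).
  exists S2; split; first exact: related_trans r1 r2.
    by rewrite -V1.
  exact: perm_trans p2 p1.
move=> /hasPn nh.
have only (k : letter) : k.1 \in sE S -> sini S k = sini S e -> k = e.
  by move=> kE ek; have := nh k; rewrite mem_letters ek eqxx negbK => /(_ kE) /eqP.
have [w [m [wF ew]]] := letter_word eE.
have [u wu] := @same_cycle_mem (linv e) w ew.
have [S1 [FS1 [V1 E1 i1] r1]] := surf_front wF wu; set G := rem _ _ in FS1.
have in1 : (linv e :: u, m) \in sF S1 by rewrite FS1 mem_head.
have [_ wE cw] := word_E in1.
have p1 : perm_eq (branch_orders (sF S1)) (branch_orders (sF S)).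
  rewrite /branch_orders FS1; apply: perm_filter; rewrite perm_sym.
  exact: (perm_map snd (perm_to_rem wF)).
case: u {wu} FS1 in1 wE cw => [|b w2] FS1 in1 wE cw.
  by move: cw eloop; rewrite /= /corner_rel linvK i1 andbT => ->.
have Eb : b = e.
  apply: only; first by move: wE; rewrite E1 => /and3P[].
  by case/andP: cw; rewrite /corner_rel linvK i1 => /eqP ->.
rewrite {b}Eb in FS1 in1 wE cw.
have only1 (k : letter) : k.1 \in sE S1 -> sini S1 k = sini S1 e -> k = e.
  by rewrite E1 i1; exact: only.
case: w2 FS1 in1 {wE cw} => [|y v] FS1 in1.
  have G0 := spur_sphere FS1 only1.
  have [_ /(_ 1 x0)] := br_deg (s_branching S1) in1; rewrite /=.
  have -> : sact S1 e (sact S1 (linv e) x0) = x0.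
    have := br_actK (s_branching S1) (l := linv e) _ x0; rewrite linvK; apply.
    by rewrite /= E1.
  rewrite eqxx => /esym; rewrite dvdn1 => /eqP m1.
  by move: b0; rewrite -size_eq0 -(perm_size p1) FS1 G0 m1.
have [//|S2 [FS2 V2 E2 r2]] := @surf_spur X x0 S1 e (y :: v) m G _ FS1 only1.
exists S2; split; first exact: related_trans r1 r2.
  rewrite V2 i1 V1 size_filter -(count_predC (pred1 (sini S e)) (sV S)).
  rewrite -[X in X < _]add0n ltn_add2r -has_count has_pred1.
  exact: (gl_ini (s_gluing S)).
by apply: perm_trans p1; rewrite /branch_orders FS1 FS2.
Qed.

Lemma one_vertex N S : size (sV S) <= N -> branch_orders (sF S) != [::] ->
  exists S', [/\ related x0 S S', {in sV S' &, forall p q, p = q} &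
    perm_eq (branch_orders (sF S')) (branch_orders (sF S))].
Proof.
elim: N S => [|N IH] S sS b0.
  exists S; split=> //; first exact: related_refl.
  by move: sS; rewrite leqn0 size_eq0 => /eqP -> p.
case: (boolP (has (fun e => sini S e != sini S (linv e)) (letters (sE S)))).
  case/hasP => e; rewrite mem_letters => eE eloop.
  have [S1 [r1 V1 p1]] := reduce_points (leqnn _) eE eloop b0.
  have [||S2 [r2 V2 p2]] := IH S1.
  - by move: (leq_trans V1 sS).
  - by move: b0; rewrite -!size_eq0 (perm_size p1).
  exists S2; split=> //; first exact: related_trans r1 r2.
  exact: perm_trans p2 p1.
move=> /hasPn loops; exists S; split=> //; first exact: related_refl.
have hP p (k : letter) : k.1 \in sE S -> (pred1 p) (sini S k) = (pred1 p) (sini S (linv k)).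
  by move=> kE; have := loops k; rewrite mem_letters negbK => /(_ kE) /eqP ->.
move=> p q pV qV; have := gl_conn (s_gluing S) (hP p) pV qV.
by rewrite /= eqxx => /esym/eqP.
Qed.

End OneVertex.

(** * The hub and its monogons *)

Definition monogons (M : seq (letter * nat)) : seq (word * nat) :=
  [seq ([:: linv s.1], s.2) | s <- M].

Lemma insert_sorted (M : seq (letter * nat)) m : sorted leq (map snd M) ->
  exists M1 M2, M = M1 ++ M2 /\ forall s, sorted leq (map snd (M1 ++ (s, m) :: M2)).
Proof.
elim: M => [|x M IH] /=; first by exists [::], [::].
case: (leqP m x.2) => [mx px|xm px].
  by exists [::], (x :: M); split=> // s; rewrite /= mx.
have [M1 [M2 [EM h]]] := IH (path_sorted px).
exists (x :: M1), M2; rewrite EM; split=> // s; rewrite /= path_sortedE ?h ?andbT; last exact: leq_trans.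
move: px; rewrite path_sortedE; last exact: leq_trans.
by move=> /andP[+ _]; rewrite EM !map_cat !all_cat /= (ltnW xm) => /andP[-> ->].
Qed.

Section Hub.
Variables (X : countType) (x0 : X).
Implicit Types (S : surf X) (M : seq (letter * nat)) (B : seq (word * nat)).

Definition one_vertex_surf S := {in sV S &, forall p q, p = q}.

Lemma one_vertex_base S S' : sV S' = sV S -> one_vertex_surf S -> one_vertex_surf S'.
Proof. by move=> e; rewrite /one_vertex_surf e. Qed.

Lemma word_mem S w m k : (w, m) \in sF S -> k \in w -> k.1 \in sE S.
Proof. by move=> /word_E[_ /allP wE _] kw; apply: wE; exact: map_f. Qed.

(** The property of an edge to occur in the hub is constant along the corners of the hub
and of the monogons. If no face of [B] had an edge in common with the hub, it would be
constant along all corners, hence the same for all segments, as they start at one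
point. *)
Lemma find_neighbour S hub M B : one_vertex_surf S -> hub != [::] -> B != [::] ->
  perm_eq (sF S) ((hub, 1) :: monogons M ++ B) ->
  exists w m n, [/\ (w, m) \in B, n \in map fst w & n \in map fst hub].
Proof.
move=> V1 hub0 B0 pF; have mF := perm_mem pF.
case: (boolP (has (fun wm => has (mem (map fst hub)) (map fst wm.1)) B)).
  by case/hasP => -[w m] wB /hasP[n nw nh]; exists w, m, n.
move=> /hasPn nB; pose P (k : letter) := k.1 \in map fst hub.
have hP w : w \in map fst (sF S) -> cycle (corner_rel P) w.
  move=> /mapP[[w' m] + ->]; rewrite mF inE mem_cat => /or3P[/eqP[-> _]|/mapP[s _ [-> _]]|wB] /=.
  - apply: (cycle_const (c := true)) => k kh; rewrite /P -[(linv k).1]/(k.1).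
    by rewrite map_f.
  - by rewrite /corner_rel /P eqxx.
  apply: (cycle_const (c := false)) => k kw; rewrite /P -[(linv k).1]/(k.1).
  have /hasPn := nB _ wB; move=> /(_ k.1); rewrite map_f // => /(_ isT) /= h.
  by rewrite (negPf h).
have [k kh] : exists k, k \in hub by case: (hub) hub0 => // k h _; exists k; exact: mem_head.
have [[w m] wB] : exists wm, wm \in B by case: (B) B0 => // x B' _; exists x; exact: mem_head.
have wF : (w, m) \in sF S by rewrite mF inE mem_cat wB !orbT.
have [w0 _ _] := word_E wF.
have [j jw] : exists j, j \in w by case: (w) w0 => // j w' _; exists j; exact: mem_head.
have jE := word_mem wF jw.
have kE : k.1 \in sE S by apply: (@word_mem S hub 1); rewrite ?mF ?mem_head.
have e : sini S k = sini S j by apply: V1; apply: (gl_ini (s_gluing S)).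
have := gl_star (s_gluing S) hP kE jE e.
have /hasPn /(_ j.1) := nB _ wB; rewrite /= map_f // => /(_ isT) /negPf h.
by rewrite /P h map_f.
Qed.

Lemma perm_count_word S F n : perm_eq (sF S) F -> n \in sE S ->
  count_mem n (map fst (flatten (map fst F))) = 2.
Proof.
move=> pF nE; rewrite -(gl_count (s_gluing S) nE); apply/permP.
by rewrite perm_sym; apply/perm_map/perm_flatten/perm_map.
Qed.

(** The common edge of the hub and a face of [B] belongs to [r], because the edges of the
monogons already occur twice. The face is glued to the hub along it. If it was branched,
a monogon of the same order is cut off at the corner of the hub that keeps the orders
of the monogons sorted. *)
Lemma hub_reduction N S M r B : size B <= N -> one_vertex_surf S -> M != [::] ->
  perm_eq (sF S) ((map fst M ++ r, 1) :: monogons M ++ B) ->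
  sorted leq (map snd M) ->
  exists S' M' r', [/\ related x0 S S', one_vertex_surf S', M' != [::],
    perm_eq (sF S') ((map fst M' ++ r', 1) :: monogons M') &
    sorted leq (map snd M') /\ perm_eq (map snd M') (map snd M ++ branch_orders B)].
Proof.
elim: N S M r B => [|N IH] S M r B sB V1 M0 pF sM.
  move: sB pF; rewrite leqn0 size_eq0 => /eqP ->; rewrite !cats0 => pF.
  by exists S, M, r; split=> //; exact: related_refl.
case: (altP (B =P [::])) => [EB|B0].
  by apply: (IH S M r B) => //; rewrite EB.
have A0 : map fst M ++ r != [::] by case: (M) M0.
have [w [m [n [wB nw nh]]]] := find_neighbour V1 A0 B0 pF.
have wF : (w, m) \in sF S by rewrite (perm_mem pF) inE mem_cat wB !orbT.
have nE : n \in sE S by move: nw => /mapP[k kw ->]; exact: word_mem wF kw.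
have nr : n \in map fst r.
  move: nh; rewrite map_cat mem_cat => /orP[nM|//].
  have := perm_count_word pF nE.
  rewrite /= map_cat count_cat map_cat count_cat map_cat flatten_cat map_cat count_cat.
  have pos (s : seq nat) : n \in s -> 0 < count_mem n s by rewrite -has_pred1 has_count.
  have c1 := pos _ nM.
  have c2 : 0 < count_mem n (map fst (flatten (map fst (monogons M)))).
    apply: pos; move: nM => /mapP[k /mapP[s sM' ->] ->]; apply/mapP; exists (linv s.1) => //.
    apply/flattenP; exists [:: linv s.1]; last exact: mem_head.
    by apply/mapP; exists ([:: linv s.1], s.2) => //; apply/mapP; exists s.
  have c3 : 0 < count_mem n (map fst (flatten (map fst B))).
    apply: pos; move: nw => /mapP[k kw ->]; apply/mapP; exists k => //.
    by apply/flattenP; exists w => //; apply/mapP; exists (w, m).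
  move: c1 c2 c3.
  case: (count_mem n [seq i.1 | i <- [seq i.1 | i <- M]]) => // c1 _.
  case: (count_mem n (map fst (flatten (map fst (monogons M))))) => // c2 _.
  case: (count_mem n (map fst (flatten (map fst B)))) => // c3 _.
  by rewrite !addSn !addnS.
have [t tr nt] := mapP nr.
have [r1 [r2 Er]] : exists r1 r2, r = r1 ++ t :: r2.
  by case/splitPr: tr => r1 r2; exists r1, r2.
have [w' ww'] : exists w', same_cycle w (linv t :: w').
  by apply: same_cycle_mem; rewrite -[(linv t).1]/(t.1) -nt.
set A := map fst M in pF A0.
set R := monogons M ++ rem (w, m) B.
have p1 : perm_eq (sF S) ((w, m) :: (A ++ r, 1) :: R).
  apply: perm_trans pF _; apply: perm_trans (perm_swap _ _ _); rewrite perm_cons.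
  apply: perm_trans (permEl (perm_catCA (monogons M) [:: (w, m)] _)).
  by rewrite perm_cat2l; exact: perm_to_rem.
have [S1 [FS1 [V_1 E_1 i_1] rel1]] := surf_perm x0 p1.
have [S2 [FS2 [V_2 E_2 i_2] rel2]] := surf_head x0 FS1 ww'.
have p3 : perm_eq (sF S2) ((A ++ r, 1) :: (linv t :: w', m) :: R).
  by rewrite FS2 perm_swap.
have [S3 [FS3 [V_3 E_3 i_3] rel3]] := surf_perm x0 p3.
have h4 : same_cycle (A ++ r) (rcons (r2 ++ A ++ r1) (linv (linv t))).
  left; apply/is_rotP; exists (A ++ r1 ++ [:: t]), r2; rewrite Er linvK -cats1 -!catA.
  by [].
have [S4 [FS4 [V_4 E_4 i_4] rel4]] := surf_head x0 FS3 h4.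
have u0 : (r2 ++ A ++ r1) ++ w' != [::].
  by rewrite /A; case: (M) M0 => // s M' _; case: (r2).
have [S5 [FS5 [V_5 E_5 i_5] rel5]] := surf_merge x0 u0 FS4.
have rel : related x0 S S5.
  apply: related_trans rel1 _; apply: related_trans rel2 _; apply: related_trans rel3 _.
  apply: related_trans rel4 _; exact: rel5.
have V5 : one_vertex_surf S5 by apply: one_vertex_base V1; rewrite V_5 V_4 V_3 V_2 V_1.
have sB' : size (rem (w, m) B) <= N by rewrite size_rem //; move: sB; case: (size B).
have bB : perm_eq (branch_orders B) ((if 1 < m then [:: m] else [::]) ++ branch_orders (rem (w, m) B)).
  have := branch_orders_perm (perm_to_rem wB); rewrite {2}/branch_orders /=; by case: ifP.
case: (leqP m 1) => [m1|m1].
  have {}m1 : m = 1.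
    by apply/eqP; rewrite eqn_leq m1; have [-> _] := br_deg (s_branching S) wF.
  have h6 : same_cycle ((r2 ++ A ++ r1) ++ w') (A ++ (r1 ++ w' ++ r2)).
    by left; apply/is_rotP; exists r2, (A ++ r1 ++ w'); rewrite -!catA.
  have [S6 [FS6 [V_6 E_6 i_6] rel6]] := surf_head x0 FS5 h6.
  have V6 : one_vertex_surf S6 by apply: one_vertex_base V5.
  have pF6 : perm_eq (sF S6) ((map fst M ++ (r1 ++ w' ++ r2), 1) :: monogons M ++ rem (w, m) B).
    by rewrite FS6 {1}m1.
  have [S' [M' [r' [rel' V' M'0 pF' [sM' pM']]]]] := IH S6 M _ _ sB' V6 M0 pF6 sM.
  exists S', M', r'; split=> //.
    by apply: related_trans rel _; apply: related_trans rel6 _.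
  split=> //; apply: perm_trans pM' _; rewrite perm_cat2l perm_sym.
  by move: bB; rewrite {1}m1.
have [M1 [M2 [EM sortM]]] := insert_sorted m sM.
have EA : A = map fst M1 ++ map fst M2 by rewrite /A EM map_cat.
set A1 := map fst M1 in EA; set A2 := map fst M2 in EA.
have h6 : same_cycle ((r2 ++ A ++ r1) ++ w') ((A2 ++ r1 ++ w' ++ r2 ++ A1) ++ [::]).
  left; apply/is_rotP; exists (r2 ++ A1), (A2 ++ r1 ++ w').
  by rewrite EA -!catA cats0.
have [S6 [FS6 [V_6 E_6 i_6] rel6]] := surf_head x0 FS5 h6.
have [S7 [l [FS7 [V_7 E_7 _] _ _ rel7]]] := surf_split x0 FS6.
set M' := M1 ++ (linv l, m) :: M2.
have h8 : same_cycle (rcons (A2 ++ r1 ++ w' ++ r2 ++ A1) (linv l))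
    (map fst M' ++ (r1 ++ w' ++ r2)).
  left; apply/is_rotP; exists (A2 ++ r1 ++ w' ++ r2), (A1 ++ [:: linv l]).
  by rewrite /M' map_cat -/A1 -/A2 /= -cats1 -!catA.
have [S8 [FS8 [V_8 E_8 i_8] rel8]] := surf_head x0 FS7 h8.
have V8 : one_vertex_surf S8 by apply: one_vertex_base V5; rewrite V_8 V_7 V_6.
have pF8 : perm_eq (sF S8) ((map fst M' ++ (r1 ++ w' ++ r2), 1) :: monogons M' ++ rem (w, m) B).
  rewrite FS8 perm_cons /R EM /M' /monogons !map_cat /= -!catA /= linvK.
  exact: permEl (perm_catCA [:: ([:: l], m)] _ _).
have M'0 : M' != [::] by rewrite /M'; case: (M1).
have [S' [M'' [r' [rel' V' M''0 pF' [sM' pM']]]]] := IH S8 M' _ _ sB' V8 M'0 pF8 (sortM _).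
exists S', M'', r'; split=> //.
  apply: related_trans rel _; apply: related_trans rel6 _; apply: related_trans rel7 _.
  by apply: related_trans rel8 _.
split=> //; apply: perm_trans pM' _.
rewrite perm_sym (perm_trans (perm_cat (perm_refl _) bB)) // m1 /M' EM !map_cat /= -!catA.
by rewrite perm_cat2l /= perm_catC /= perm_cons perm_catC.
Qed.

(** The first monogon is cut off from an arbitrary branched face. At the end, the last
monogon can be glued to the hub because they are not two monogons with a common
boundary: the hub is unbranched and the monogon is branched. *)
Lemma normal_form S : one_vertex_surf S -> branch_orders (sF S) != [::] ->
  exists S' M r k, [/\ related x0 S S', one_vertex_surf S',
    sF S' = (map fst M ++ r, k) :: monogons M,
    sorted leq (rcons (map snd M) k) &
    perm_eq (rcons (map snd M) k) (branch_orders (sF S))].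
Proof.
move=> V1 b0.
have [w [m [wF m1]]] : exists w m, (w, m) \in sF S /\ 1 < m.
  have : has (fun m => 1 < m) (map snd (sF S)) by rewrite has_filter.
  by case/hasP => _ /mapP[[w m] wF ->] m1; exists w, m.
have := @same_cycle_refl w; rewrite -{2}(cats0 w) => h1.
have [S1 [FS1 [V_1 E_1 i_1] rel1]] := surf_front x0 wF h1.
have [S2 [l [FS2 [V_2 E_2 _] _ _ rel2]]] := surf_split x0 FS1.
set G := rem _ _ in FS1 FS2.
have h3 : same_cycle (rcons w (linv l)) (map fst [:: (linv l, m)] ++ w).
  by left; apply/is_rotP; exists w, [:: linv l]; rewrite cats1.
have [S3 [FS3 [V_3 E_3 i_3] rel3]] := surf_head x0 FS2 h3.
have V3 : one_vertex_surf S3 by apply: one_vertex_base V1; rewrite V_3 V_2 V_1.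
have pF3 : perm_eq (sF S3) ((map fst [:: (linv l, m)] ++ w, 1) :: monogons [:: (linv l, m)] ++ G).
  by rewrite FS3 /= linvK.
have [//|//|S4 [M [r [rel4 V4 M0 pF4 [sM pM]]]]] :=
  hub_reduction (leqnn _) V3 _ pF3.
have {}pM : perm_eq (map snd M) (branch_orders (sF S)).
  apply: perm_trans pM _; rewrite perm_sym; have := branch_orders_perm (perm_to_rem wF).
  by rewrite {2}/branch_orders /= m1.
case: (lastP M) M0 pF4 sM pM => // M' [s k] _ pF4 sM pM.
have k1 : 1 < k.
  have : k \in branch_orders (sF S) by rewrite -(perm_mem pM) map_rcons mem_rcons mem_head.
  by rewrite mem_filter => /andP[].
have pF5 : perm_eq (sF S4) ((map fst M' ++ s :: r, 1) :: ([:: linv s], k) :: monogons M').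
  apply: perm_trans pF4 _; rewrite map_rcons cat_rcons perm_cons.
  by rewrite /monogons map_rcons perm_rcons.
have [S5 [FS5 [V_5 E_5 i_5] rel5]] := surf_perm x0 pF5.
have h6 : same_cycle (map fst M' ++ s :: r) (rcons (r ++ map fst M') (linv (linv s))).
  left; apply/is_rotP; exists (map fst M' ++ [:: s]), r.
  by rewrite linvK -cats1 -!catA.
have [S6 [FS6 [V_6 E_6 i_6] rel6]] := surf_head x0 FS5 h6.
have rel46 : related x0 S S6.
  apply: related_trans rel1 _; apply: related_trans rel2 _; apply: related_trans rel3 _.
  by apply: related_trans rel4 _; apply: related_trans rel5 _.
have u0 : (r ++ map fst M') ++ [::] != [::].
  rewrite cats0; apply/eqP => u0; move: FS6; rewrite u0 /= linvK => FS6.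
  have in1 : ([:: s], 1) \in sF S6 by rewrite FS6 mem_head.
  have in2 : ([:: linv s], k) \in sF S6 by rewrite FS6 !inE eqxx orbT.
  have sE6 : s.1 \in sE S6 by apply: word_mem in1 (mem_head _ _).
  have [_ /(_ 1 x0)] := br_deg (s_branching S6) in1; rewrite /= dvdn1 eqxx => /eqP e1.
  have [_ /(_ 1 x0)] := br_deg (s_branching S6) in2; rewrite /= dvdn1 -{1}e1.
  rewrite (br_actK (s_branching S6)) // eqxx => /esym/eqP k1'.
  by rewrite k1' in k1.
have [S7 [FS7 [V_7 E_7 i_7] rel7]] := surf_merge x0 u0 FS6.
have h8 : same_cycle ((r ++ map fst M') ++ [::]) (map fst M' ++ r).
  by left; apply/is_rotP; exists r, (map fst M'); rewrite cats0.
have [S8 [FS8 [V_8 E_8 i_8] rel8]] := surf_head x0 FS7 h8.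
exists S8, M', r, k; split=> //.
- by apply: related_trans rel46 _; apply: related_trans rel7 _.
- by apply: one_vertex_base V4; rewrite V_8 V_7 V_6 V_5.
- by move: sM; rewrite map_rcons.
- by move: pM; rewrite map_rcons.
Qed.

End Hub.

(** * Links of points and cohomology modulo two *)

Definition as_bool (Q : Prop) : bool :=
  if excluded_middle_informative Q then true else false.

Lemma as_boolP Q : reflect Q (as_bool Q).
Proof. by rewrite /as_bool; case: excluded_middle_informative => h; constructor. Qed.

Lemma cycle_nth (T : Type) (x0 : T) (r : rel T) w :
  (forall j, j < size w -> r (nth x0 w j) (nth x0 w (j.+1 %% size w))) -> cycle r w.
Proof.
case: w => // x w h; apply/(pathP x0) => i; rewrite size_rcons => iw.
have := h i iw; rewrite -rcons_cons nth_rcons /= iw nth_rcons.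
move: iw; rewrite ltnS; case: ltngtP => // [iw _|-> _]; last by rewrite modnn.
by rewrite modn_small.
Qed.

Section Fans.
Variable K : surfaceComplex.
Implicit Types (f : piece K) (s t u : segment K) (c : passage K).

Lemma onthP (T : Type) (w : seq T) j x : onth w j = Some x <->
  j < size w /\ nth x w j = x.
Proof.
elim: w j => [|y w IH] [|j] /=; [by split=> // -[]|by split=> // -[]|by split=> [[->]|[_ ->]]|].
exact: IH.
Qed.

(** Reading a boundary path backwards exchanges the place [j] with [n.-1 - j]. *)
Lemma mirror n j : j < n -> (n.-1 - j.+1 %% n).+1 %% n = n.-1 - j.
Proof.
case: n => // n; rewrite ltnS; case: ltngtP => // [jn _|-> _] /=.
  by rewrite [j.+1 %% _]modn_small // subnSK // modn_small // ltnS leq_subr.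
by rewrite modnn subn0 modnn subnn.
Qed.

Lemma onth_path_inv (w : seq (segment K)) j s : onth w j = Some s ->
  onth (path_inv w) ((size w).-1 - j) = Some (sinv s).
Proof.
move=> /onthP[jw Es]; apply/onthP; rewrite size_path_inv; split.
  by case: (size w) jw => // n _ /=; rewrite ltnS leq_subr.
rewrite /path_inv nth_rev size_map; last by case: (size w) jw => // n _ /=; rewrite ltnS leq_subr.
rewrite (nth_map s); last by case: (size w) jw => // n jn /=; rewrite subSS ltnS leq_subr.
congr sinv; rewrite -[RHS]Es; case: (size w) jw => // n jn /=.
by rewrite subSS subKn.
Qed.

Lemma onth_lt (T : Type) (w : seq T) j x : onth w j = Some x -> j < size w.
Proof. by case/onthP. Qed.

Lemma corner_opp c s t : corner c s t -> exists c', corner c' t s.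
Proof.
case: c => f j [hs ht].
exists (pinv f, (size (bd f)).-1 - j.+1 %% size (bd f)).
rewrite /corner /runs_through /passage_next /= bd_pinv size_path_inv.
split; first exact: onth_path_inv ht.
rewrite mirror; last exact: onth_lt hs.
by rewrite -[s in RHS]sinvK; apply: onth_path_inv hs.
Qed.

(** A chain of corners that leaves a segment through the passage by which it arrived
goes back to the segment from which it came. *)
Lemma corner_back c c' a t u : corner c a t -> corner c' t u ->
  passage_next c = passage_opp c' -> u = a.
Proof.
case: c c' => f j [g i] [ha ht] [ht' hu] [Ef Ei].
have {}Ef : g = pinv f by rewrite Ef pinvK.
move: ht' hu; rewrite {g}Ef /runs_through /= bd_pinv in Ei *.
rewrite size_path_inv in Ei * => ht' hu.
have il := onth_lt ht'; rewrite size_path_inv in il.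
have jl := onth_lt ha; rewrite /= in jl.
have Ei' : i = (size (bd f)).-1 - j.+1 %% size (bd f).
  by rewrite Ei subKn //; case: (size (bd f)) il.
move: hu; rewrite Ei' mirror // (onth_path_inv ha) sinvK.
by move=> [].
Qed.

Definition reach s t := s = t \/ exists c, fan s c t.

(** By [corner_back] a chain of corners may be shortened until it satisfies the condition
on passages in [fan]. *)
Lemma reach_corner s t c u : reach s t -> corner c t u -> reach s u.
Proof.
case=> [<-|[c0 f0]] cu; first by right; exists c; constructor.
case: (excluded_middle_informative (passage_next c0 = passage_opp c)) => e; last first.
  by right; exists c; apply: fan_step f0 cu e.
case: f0 cu e => [s' c' t' co|s' c1 t1 c' t' f1 co _] cu e.
  by left; rewrite (corner_back co cu e).
by rewrite (corner_back co cu e); right; exists c1.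
Qed.

Lemma reach_cycle s (P : pred (segment K)) f : (forall t, reflect (reach s t) (P t)) ->
  cycle (fun a b => P (sinv a) == P b) (bd f).
Proof.
move=> PP; have [x0 _] : exists x0, x0 \in bd f.
  by have := bd_nonempty f; case: (bd f) => // x w _; exists x; rewrite mem_head.
apply: (cycle_nth (x0 := x0)) => j jl.
have n0 : 0 < size (bd f) by apply: leq_ltn_trans jl.
have co : corner (f, j) (sinv (nth x0 (bd f) j)) (nth x0 (bd f) (j.+1 %% size (bd f))).
  split; rewrite /runs_through /=; first by rewrite sinvK; apply/onthP; split=> //; exact: set_nth_default.
  by apply/onthP; split; rewrite ?ltn_mod //; apply: set_nth_default; rewrite ltn_mod.
have [c' co'] := corner_opp co.
apply/eqP; apply/idP/idP => /PP h; apply/PP; first exact: reach_corner h co.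
exact: reach_corner h co'.
Qed.

Lemma fan_const (T : eqType) (P : segment K -> T) s c t :
  (forall f, cycle (fun a b => P (sinv a) == P b) (bd f)) -> fan s c t -> P s = P t.
Proof.
move=> hP; have hc c' a b : corner c' a b -> P a = P b.
  case: c' => f j [] /onthP /= [jl E1] /onthP /= [jl' E2].
  rewrite -[a]sinvK; have := hP f; case E: (bd f) jl jl' E1 E2 => [//|x w] jl jl' E1 E2.
  rewrite /= => /(pathP x) /(_ j); rewrite size_rcons => /(_ jl) /eqP.
  rewrite -rcons_cons nth_rcons jl nth_rcons (set_nth_default (sinv a)) // E1 => ->.
  rewrite -E2 (set_nth_default x) //; move: jl => /=; rewrite ltnS; case: ltngtP => // [jw _|-> _].
    by rewrite modn_small.
  by rewrite modnn.
elim=> [s' c' t' /hc //|s' c1 t1 c' t' _ -> /hc //].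
Qed.

End Fans.

Section Cohomology.

Definition sum2 (T : Type) (sig : T -> bool) (w : seq T) : bool :=
  foldr (fun s b => sig s (+) b) false w.

Lemma sum2_cat (T : Type) (sig : T -> bool) u v :
  sum2 sig (u ++ v) = sum2 sig u (+) sum2 sig v.
Proof. by elim: u => //= s u ->; rewrite addbA. Qed.

Lemma sum2_rot (T : Type) (sig : T -> bool) u v : is_rot u v -> sum2 sig u = sum2 sig v.
Proof. by move=> /is_rotP[a [b [-> ->]]]; rewrite !sum2_cat addbC. Qed.

Lemma sum2_map (S T : Type) (h : S -> T) (sig : T -> bool) u :
  sum2 sig (map h u) = sum2 (fun s => sig (h s)) u.
Proof. by elim: u => //= s u ->. Qed.

Lemma eq_sum2 (T : Type) (sig sig' : T -> bool) u : sig =1 sig' ->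
  sum2 sig u = sum2 sig' u.
Proof. by move=> e; elim: u => //= s u ->; rewrite e. Qed.

Lemma sum2_path_inv (K : lineComplex) (sig : segment K -> bool) u :
  (forall s, sig (sinv s) = sig s) -> sum2 sig (path_inv u) = sum2 sig u.
Proof.
move=> h; elim: u => //= s u IH; rewrite path_inv_cons -cats1 sum2_cat /= IH h addbF.
exact: addbC.
Qed.

(** The first cohomology group with coefficients Z/2 vanishes. *)
Definition acyclic2 (K : surfaceComplex) : Prop :=
  forall sig : segment K -> bool, (forall s, sig (sinv s) = sig s) ->
    (forall f, sum2 sig (bd f) = false) ->
    exists h : point K -> bool, forall s, sig s = h (ini s) (+) h (fin s).

Lemma acyclic2_iso (K L : surfaceComplex) : complex_iso K L -> acyclic2 K <-> acyclic2 L.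
Proof.
move=> u; case: (iso_pt_bij u) => g gK Kg.
case: (iso_seg_bij u) => gs gsK Ksg; case: (iso_piece_bij u) => gp gpK Kgp.
have gs_inv t : gs (sinv t) = sinv (gs t).
  by apply: (can_inj gsK); rewrite iso_sinv !Ksg.
split=> H sig si sb.
  have [|f|h hE] := H (fun s => sig (iso_seg u s)).
  - by move=> s; rewrite iso_sinv si.
  - by rewrite -sum2_map; have := iso_bd u f => /(sum2_rot sig) <-; exact: sb.
  exists (h \o g) => t /=; rewrite -(Ksg t); move: (gs t) => s.
  by rewrite hE /fin -iso_sinv !iso_ini !gK.
have [|f|h hE] := H (fun t => sig (gs t)).
- by move=> t; rewrite gs_inv si.
- rewrite -(Kgp f); have /(sum2_rot (fun t => sig (gs t))) -> := iso_bd u (gp f).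
  by rewrite sum2_map (eq_sum2 (sig' := sig)) // => s; rewrite gsK.
exists (h \o iso_pt u) => s /=; have := hE (iso_seg u s); rewrite gsK => ->.
by rewrite /fin iso_ini -iso_sinv iso_ini.
Qed.

(** A cocycle of [K] is extended to the new segment by its sum over [w1]. *)
Lemma acyclic2_splitting (K L : surfaceComplex) f w1 w2 :
  @splitting K L f w1 w2 -> acyclic2 K <-> acyclic2 L.
Proof.
move=> u; case: (sp_pt_bij u) => g gK Kg.
have fbd (sig : segment K -> bool) : sum2 sig (bd f) = sum2 sig w1 (+) sum2 sig w2.
  by rewrite -sum2_cat; apply: sum2_rot; exact: sp_bd u.
split=> H sig si sb.
  pose sig' s := sig (sp_seg u s).
  have si' s : sig' (sinv s) = sig' s by rewrite /sig' sp_seg_sinv si.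
  have e1 : sum2 sig' w1 = sig (sp_new u).
    have := sb (sp_fst u); rewrite sp_fst_bd -cats1 sum2_cat sum2_map /= addbF si.
    by move/(canRL (addbK _)).
  have e2 : sum2 sig' w2 = sig (sp_new u).
    have := sb (sp_snd u); rewrite sp_snd_bd /= sum2_map addbC.
    by move/(canRL (addbK _)).
  have bdf : sum2 sig' (bd f) = false by rewrite fbd e1 e2 addbb.
  have [//|k|h hE] := H sig'.
    case: (boolP (same_piece f k)) => [/orP[]/eqP ->|nk] //.
      by rewrite bd_pinv sum2_path_inv.
    by have := sb (sp_piece u k); rewrite sp_piece_bd // sum2_map.
  exists (h \o g).
  have old s : sig (sp_seg u s) = (h \o g) (ini (sp_seg u s)) (+) (h \o g) (fin (sp_seg u s)).
    rewrite -[LHS]/(sig' s) hE /= /fin -sp_seg_sinv !sp_seg_ini !gK.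
    by [].
  have new : sig (sp_new u) = (h \o g) (ini (sp_new u)) (+) (h \o g) (fin (sp_new u)).
    have claim w p q : joins p (map (sp_seg u) w) q -> sum2 sig' w = (h \o g) p (+) (h \o g) q.
      elim: w p => [|s w IH] p; first by move=> /eqP ->; rewrite addbb.
      by case/andP=> /eqP <- /IH Ew; rewrite [sum2 _ _]/= Ew /sig' old addbA addbK.
    by rewrite -e1; apply: claim (sp_new_w1 u).
  move=> t; case: (sp_seg_onto u t) => [[s ->] //|[->|->] //].
  by rewrite si new /fin sinvK addbC.
pose sig' t := if excluded_middle_informative (exists s, t = sp_seg u s) is left e
  then sig (proj1_sig (constructive_indefinite_description _ e)) else sum2 sig w1.
have sE s : sig' (sp_seg u s) = sig s.
  rewrite /sig'; case: excluded_middle_informative => [e|[]]; last by exists s.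
  by case: constructive_indefinite_description => s' /= /(@sp_seg_inj _ _ _ _ _ u) ->.
have nE : sig' (sp_new u) = sum2 sig w1.
  rewrite /sig'; case: excluded_middle_informative => // e; exfalso.
  by case: e => s e; have := sp_new_fresh u s; rewrite -e eqxx.
have nvE : sig' (sinv (sp_new u)) = sum2 sig w1.
  rewrite /sig'; case: excluded_middle_informative => // e; exfalso.
  case: e => s e; have := sp_new_fresh u (sinv s).
  by rewrite sp_seg_sinv -e sinvK eqxx.
have mapE w : sum2 sig' (map (sp_seg u) w) = sum2 sig w.
  by rewrite sum2_map; apply: eq_sum2.
have si' t : sig' (sinv t) = sig' t.
  case: (sp_seg_onto u t) => [[s ->]|[->|->]]; first by rewrite -sp_seg_sinv !sE.
    by rewrite nE nvE.
  by rewrite sinvK nE nvE.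
have b1 : sum2 sig' (bd (sp_fst u)) = false.
  by rewrite sp_fst_bd -cats1 sum2_cat /= mapE nvE addbF addbb.
have b2 : sum2 sig' (bd (sp_snd u)) = false.
  by rewrite sp_snd_bd /= mapE nE -fbd.
have bsame k k' : same_piece k k' -> sum2 sig' (bd k) = false -> sum2 sig' (bd k') = false.
  by move=> /orP[] /eqP -> //; rewrite bd_pinv sum2_path_inv.
have [//|k|h hE] := H sig'.
  case: (sp_piece_onto u k) => [[k' nk ->]|/bsame|/bsame]; [|exact|exact].
  by rewrite sp_piece_bd // mapE.
exists (h \o sp_pt u) => s /=; have := hE (sp_seg u s); rewrite sE => ->.
by rewrite /fin sp_seg_ini -sp_seg_sinv sp_seg_ini.
Qed.

(** A cocycle of [K] is extended to the halves of [s0] by its value at [s0] on the first half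
and by 0 on the second. *)
Lemma acyclic2_subdivision (K L : surfaceComplex) s0 :
  subdivision L (pred1 (s0 : segment K)) -> acyclic2 K <-> acyclic2 L.
Proof.
move=> u; case: (sd_piece_bij u) => gp gpK Kgp.
have s0n : (s0 == sinv s0) = false by rewrite eq_sym; apply/negbTE/sinv_neq.
have keptE s : kept (pred1 s0) s = (s != s0) && (sinv s != s0) by [].
have kinv s : kept (pred1 s0) s -> kept (pred1 s0) (sinv s).
  by rewrite !keptE sinvK andbC.
have cases s : [\/ kept (pred1 s0) s, s = s0 | s = sinv s0].
  rewrite keptE; case: eqP => [->|_]; first by constructor 2.
  case: eqP => [<-|_]; last by constructor 1.
  by constructor 3; rewrite sinvK.
have pathE (sig : segment K -> bool) (sig' : segment L -> bool) w :
    (forall t, sig' (sinv t) = sig' t) -> (forall s, sig (sinv s) = sig s) ->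
    (forall s, kept (pred1 s0) s -> sig' (sd_seg u s) = sig s) ->
    sig' (sd_fst u s0) (+) sig' (sd_snd u s0) = sig s0 ->
    sum2 sig' (sd_path u w) = sum2 sig w.
  move=> si' si ks hs; rewrite /sd_path; elim: w => //= s w IH.
  rewrite sum2_cat IH; congr addb; rewrite /subdivided_step /=.
  case: (cases s) => [k|->|->]; last first.
  - by rewrite eq_sym s0n sinvK eqxx /= !si' addbF si -hs addbC.
  - by rewrite eqxx /= addbF.
  by move: (k); rewrite keptE => /andP[/negPf -> /negPf ->] /=; rewrite ks // addbF.
split=> H sig si sb.
  pose sig' s := if (s == s0) || (sinv s == s0) then sig (sd_fst u s0) (+) sig (sd_snd u s0)
    else sig (sd_seg u s).
  have kE s : kept (pred1 s0) s -> sig' s = sig (sd_seg u s).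
    by rewrite keptE /sig' => /andP[/negPf -> /negPf ->].
  have dE : sig' s0 = sig (sd_fst u s0) (+) sig (sd_snd u s0) by rewrite /sig' eqxx.
  have dE' : sig' (sinv s0) = sig' s0 by rewrite /sig' sinvK eqxx orbT.
  have si' s : sig' (sinv s) = sig' s.
    case: (cases s) => [k|->|->]; rewrite ?sinvK //.
    by rewrite !kE ?kinv // sd_seg_sinv // si.
  have [//|f|h hE] := H sig'.
    rewrite -(@pathE sig' sig) // -?sd_bd //; last by move=> s /kE ->.
  pose h' x := if excluded_middle_informative (exists p, x = sd_pt u p) is left e
    then h (proj1_sig (constructive_indefinite_description _ e))
    else h (ini s0) (+) sig (sd_fst u s0).
  have hp p : h' (sd_pt u p) = h p.
    rewrite /h'; case: excluded_middle_informative => [e|[]]; last by exists p.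
    by case: constructive_indefinite_description => q /= /(@sd_pt_inj _ _ _ u) ->.
  have hm : h' (sd_mid u s0) = h (ini s0) (+) sig (sd_fst u s0).
    rewrite /h'; case: excluded_middle_informative => // e; exfalso.
    case: e => p e; have := @sd_mid_new _ _ _ u p s0 (eqxx s0).
    by rewrite e eqxx.
  have hfst : sig (sd_fst u s0) = h' (ini (sd_fst u s0)) (+) h' (fin (sd_fst u s0)).
    by rewrite (@sd_fst_ini _ _ _ u) ?(@sd_fst_fin _ _ _ u) //= hp hm addKb.
  have hsnd : sig (sd_snd u s0) = h' (ini (sd_snd u s0)) (+) h' (fin (sd_snd u s0)).
    rewrite (@sd_snd_ini _ _ _ u) ?(@sd_snd_fin _ _ _ u) //= hp hm.
    have := hE s0; rewrite dE => /(canRL (addKb _)) ->.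
    by case: (h _) (sig _) (h _) => [] [] [].
  exists h' => t; case: (sd_seg_onto u t) => [[s ks ->]|[s /eqP -> ]].
    rewrite -kE // hE /fin -sd_seg_sinv // (@sd_seg_ini _ _ _ u) //.
    by rewrite (@sd_seg_ini _ _ _ u) ?kinv // !hp.
  rewrite !inE => /or4P[] /eqP -> //.
    by rewrite si hfst /fin sinvK addbC.
  by rewrite si hsnd /fin sinvK addbC.
pose old t := exists s, kept (pred1 s0) s /\ t = sd_seg u s.
pose sig' t := if excluded_middle_informative (old t) is left e
  then sig (proj1_sig (constructive_indefinite_description _ e))
  else ((t == sd_fst u s0) || (sinv t == sd_fst u s0)) && sig s0.
have s0s0 : pred1 s0 s0 by exact: eqxx.
have new t : ini t = sd_mid u s0 \/ fin t = sd_mid u s0 -> ~ old t.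
  move=> hm [s [ks Et]].
  have [p Ep] : exists p, sd_pt u p = sd_mid u s0.
    case: hm => <-; rewrite Et; first by exists (ini s); rewrite (@sd_seg_ini _ _ _ u).
    by exists (ini (sinv s)); rewrite /fin -(@sd_seg_sinv _ _ _ u) // (@sd_seg_ini _ _ _ u) ?kinv.
  by have := @sd_mid_new _ _ _ u p s0 s0s0; rewrite Ep eqxx.
have newE t : ini t = sd_mid u s0 \/ fin t = sd_mid u s0 ->
    sig' t = ((t == sd_fst u s0) || (sinv t == sd_fst u s0)) && sig s0.
  by move=> /new nt; rewrite /sig'; case: excluded_middle_informative.
have kE s : kept (pred1 s0) s -> sig' (sd_seg u s) = sig s.
  move=> ks; rewrite /sig'; case: excluded_middle_informative => [e|[]]; last by exists s.
  by case: constructive_indefinite_description => s' /= [ks' /(@sd_seg_inj _ _ _ u) ->].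
have mfst := @sd_fst_fin _ _ _ u s0 s0s0; have msnd := @sd_snd_ini _ _ _ u s0 s0s0.
have fE : sig' (sd_fst u s0) = sig s0 by rewrite newE ?eqxx //; right.
have fvE : sig' (sinv (sd_fst u s0)) = sig s0.
  by rewrite newE ?sinvK ?eqxx ?orbT //; left.
have nfst : (sd_snd u s0 == sd_fst u s0) = false.
  apply/eqP => E; have := @sd_mid_new _ _ _ u (ini s0) s0 s0s0.
  by rewrite -(@sd_fst_ini _ _ _ u) // -E msnd eqxx.
have nfst' : (sinv (sd_snd u s0) == sd_fst u s0) = false.
  apply/eqP => E; have := @sd_fst_snd _ _ _ u s0 s0s0.
  by rewrite -E sinvK eqxx.
have sE : sig' (sd_snd u s0) = false by rewrite newE ?nfst ?nfst' //; left.
have svE : sig' (sinv (sd_snd u s0)) = false.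
  by rewrite newE ?sinvK ?nfst ?nfst' // /fin sinvK; right.
have si' t : sig' (sinv t) = sig' t.
  case: (sd_seg_onto u t) => [[s ks ->]|[s /eqP ->]].
    by rewrite -sd_seg_sinv // !kE ?kinv.
  by rewrite !inE => /or4P[] /eqP ->; rewrite ?sinvK ?fE ?fvE ?sE ?svE.
have hs : sig' (sd_fst u s0) (+) sig' (sd_snd u s0) = sig s0 by rewrite fE sE addbF.
have [//|f|h hE] := H sig'.
  rewrite -(Kgp f) sd_bd (@pathE sig sig') //.
have hk s : kept (pred1 s0) s -> sig s = h (sd_pt u (ini s)) (+) h (sd_pt u (fin s)).
  move=> ks; rewrite -kE // hE /fin -sd_seg_sinv // !(@sd_seg_ini _ _ _ u) //.
  exact: kinv.
have h0 : sig s0 = h (sd_pt u (ini s0)) (+) h (sd_pt u (fin s0)).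
  rewrite -hs !hE mfst msnd (@sd_fst_ini _ _ _ u) // (@sd_snd_fin _ _ _ u) //.
  by rewrite addbA addbK.
exists (h \o sd_pt u) => s /=; case: (cases s) => [/hk //|-> //|->].
by rewrite si h0 /fin sinvK addbC.
Qed.

Lemma acyclic2_step (K L : surfaceComplex) : complex_step K L -> acyclic2 K <-> acyclic2 L.
Proof.
case=> [[u]|[s [u]]|[f [w1 [w2 [u]]]]].
- exact: acyclic2_iso u.
- exact: acyclic2_subdivision u.
- exact: acyclic2_splitting u.
Qed.

Lemma acyclic2_related (K L : surfaceComplex) :
  related_complexes K L -> acyclic2 K <-> acyclic2 L.
Proof.
elim=> [? ? /acyclic2_step //|//|? ? _ IH|? ? ? _ IH1 _ IH2]; first by split; apply IH.
by split=> [/IH1/IH2|/IH2/IH1].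
Qed.

End Cohomology.

(** * Polygons and spheres *)

Lemma second_one (I : finType) (c : I -> nat) i : \sum_j c j = 2 -> c i = 1 ->
  exists j, [/\ j != i, c j = 1 & forall h, h != i -> 0 < c h -> h = j].
Proof.
rewrite (bigD1 i) //= => + ci; rewrite ci => -[E].
have [j jP] : exists j, (j != i) && (0 < c j).
  case: (pickP (fun j => (j != i) && (0 < c j))) => [j h|none]; first by exists j.
  move: E; rewrite big1 // => j ji; have := none j; rewrite ji /= lt0n.
  by move=> /negbFE/eqP.
case/andP: jP => ji cj.
move: E; rewrite (bigD1 j) //=; case Ej: (c j) cj => [|k] // _; rewrite addSn => -[] /eqP.
rewrite addn_eq0 sum_nat_eq0 => /andP[/eqP k0 /forallP h].
exists j; split=> // [|h']; first by rewrite Ej k0.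
move=> hi ch; apply/eqP/negP => /negP hj.
by have := h h'; rewrite hi hj /= => /eqP c0; rewrite c0 in ch.
Qed.

Section Manifold.
Variables (X : countType) (S : surf X).
Local Notation K := (cplx S).

Definition runs (n : nat) (i : 'I_(size (sF S))) : nat :=
  count_mem n (map fst (face S i).1).

Lemma passesE (f : piece K) (s : segment K) : passes f s = runs (val s).1 f.1.
Proof.
have -> : passes f s = count_mem (val s).1 (map fst (map val (bd f))).
  rewrite /passes; elim: (bd f) => //= t w <-.
  have -> : ((val t).1 == (val s).1) = (t == s) + (t == sinv s) :> nat.
    rewrite -!val_eqE /=; case: eqP => [e|ne].
      case: (letter_eq e) => ->; rewrite ?eqxx ?linv_neq //.
      by rewrite eq_sym linv_neq.
    by case: eqP => [e|_]; [case: ne; rewrite e|case: eqP => // e; case: ne; rewrite e].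
  exact: addnACA.
rewrite val_piece_bd /runs /piece_word; case: f.2 => //.
by rewrite map_fst_winv; apply/permP; rewrite perm_rev.
Qed.

Lemma sum_runs n : n \in sE S -> \sum_i runs n i = 2.
Proof.
move=> nE; rewrite -(gl_count (s_gluing S) nE) map_flatten count_flatten -!map_comp.
rewrite sumnE big_map (big_nth ([::], 1)) big_mkord.
by apply: eq_bigr => i _.
Qed.

Lemma surf_cycle (T : eqType) (P : letter -> T) (f : piece K) :
  cycle (fun a b : segment K => P (val (sinv a)) == P (val b)) (bd f) =
  cycle (corner_rel P) (face S f.1).1.
Proof.
have -> : cycle (corner_rel P) (face S f.1).1 = cycle (corner_rel P) (piece_word f).
  by rewrite /piece_word; case: f.2; rewrite // cycle_winv.
by rewrite -val_piece_bd cycle_map.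
Qed.

(** That every edge occurs twice gives the conditions on passages; [gl_star], applied to
the property of being reached from [s] by a fan, gives the fans. *)
Lemma surf_manifold : sF S != [::] -> manifold K.
Proof.
move=> F0.
have [s0 _] : exists s : segment K, True.
  have [wm wF] : exists wm, wm \in sF S by case: (sF S) F0 => // x F _; exists x; rewrite mem_head.
  case: wm wF => w m wF; have [w0 /allP wE _] := word_E wF.
  case: w w0 wE {wF} => // k w _ wE; have kE : k.1 \in sE S by apply: wE; rewrite /= mem_head.
  by exists (exist _ k kE).
split.
- by exists s0.
- move=> p q; pose P v := as_bool (exists q : point K, val q = v /\ exists w, joins p w q).
  have hP (l : letter) : l.1 \in sE S -> P (sini S l) = P (sini S (linv l)).
    move=> lE; have half (k : letter) : k.1 \in sE S -> P (sini S k) -> P (sini S (linv k)).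
      move=> kE /as_boolP[q' [Eq [w jw]]]; apply/as_boolP.
      pose s : segment K := exist _ k kE; exists (fin s); split=> //.
      exists (w ++ [:: s]); apply/joins_cat; exists q' => //=.
      by rewrite eqxx andbT; apply/eqP/val_inj.
    apply/idP/idP; first exact: half.
    by rewrite -{2}(linvK l); apply: half.
  have := gl_conn (s_gluing S) hP (valP p) (valP q).
  have -> : P (val p) = true by apply/as_boolP; exists p; split=> //; exists [::] => /=.
  by move=> /esym/as_boolP[q' [/val_inj <-]].
- move=> s; have [w [m [wF sw]]] := letter_word (valP s).
  have iF : index (w, m) (sF S) < size (sF S) by rewrite index_mem.
  exists (Ordinal iF, false); rewrite passesE /runs /= /face nth_index //.
  by rewrite -has_count has_pred1.
- move=> f s; rewrite passesE -(sum_runs (valP s)) (bigD1 f.1) //=; exact: leq_addr.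
- move=> f s; rewrite passesE => /(second_one (sum_runs (valP s)))[j [jf cj h]].
  exists (j, false); split; first by rewrite same_pieceE eq_sym.
    by rewrite passesE.
  by move=> g; rewrite same_pieceE eq_sym passesE same_pieceE => gf /(h _ gf) ->.
- move=> f s; rewrite passesE => c2 g; rewrite passesE same_pieceE.
  apply: contraTT => gf; rewrite -leqNgt leqn0; apply/eqP.
  have := sum_runs (valP s); rewrite (bigD1 f.1) //= c2 -[X in _ = X]addn0 => /addnI/eqP.
  by rewrite sum_nat_eq0 => /forallP /(_ g.1); rewrite eq_sym gf /= => /eqP.
- move=> s t Est.
  pose P (k : letter) := as_bool (exists t : segment K, val t = k /\ reach s t).
  have PP (t' : segment K) : reflect (reach s t') (P (val t')).
    apply: (iffP (as_boolP _)) => [[t'' [/val_inj <-]] //|h]; first by exists t'.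
  have hP w : w \in map fst (sF S) -> cycle (corner_rel P) w.
    move=> /mapP[wm wF ->].
    have iF : index wm (sF S) < size (sF S) by rewrite index_mem.
    have := surf_cycle P (Ordinal iF, false); rewrite /face nth_index // => <-.
    by apply: (reach_cycle (s := s) (P := fun t => P (val t))).
  have := gl_star (s_gluing S) hP (valP s) (valP t) (congr1 val Est).
  have -> : P (val s) = true by apply/PP; left.
  by move=> /esym/PP.
Qed.

End Manifold.

Lemma related_targets (C C' : covering) :
  elementarily_related C C' -> related_complexes (target C) (target C').
Proof.
elim=> [A' B'|A'|A' B' _ h|A' B' C'' _ h1 _ h2].
- case=> [[u _]|[s0 [u _]]|[fs [w1 [w2 [u _]]]]]; apply: rst_step.
  + by constructor 1; split.
  + by constructor 2; exists s0; split.
  + by constructor 3; exists fs, w1, w2; split.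
- exact: rst_refl.
- exact: rst_sym.
- exact: rst_trans h1 h2.
Qed.

Lemma related_cplx (X : countType) (x0 : X) (S S' : surf X) :
  related x0 S S' -> related_complexes (cplx S) (cplx S').
Proof. exact: related_targets. Qed.

(** Over the fibre with one element every face has order one and can be glued. *)
Lemma trivialize (X : countType) (S : surf X) : exists T : surf unit,
  [/\ sF T = [seq (wm.1, 1) | wm <- sF S], same_base S T &
      related_complexes (cplx S) (cplx T)].
Proof.
pose F := [seq (wm.1, 1) | wm <- sF S].
have T : gluing (sV S) (sE S) (sini S) (map fst F).
  by rewrite /F -map_comp; exact: s_gluing.
have Br : branching (sE S) (fun _ x => x : unit) F.
  split=> // w m /mapP[[w' m'] _ [_ ->]]; split=> // j x.
  by rewrite dvd1n; apply/eqP; case: x; case: (iter _ _ _).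
exists (Surf T Br); split=> //.
have sz : size (sF (Surf T Br)) = size (sF S) by rewrite /= size_map.
apply: rst_step; constructor 1; split.
apply: (@reface_iso X unit S (Surf T Br) id (fun=> false) (fun=> 0)) => //.
- by move=> i; rewrite sz.
- by move=> i; rewrite sz => il; exists i.
- by move=> i il; rewrite rot0 /face /= (nth_map ([::], 1)).
- by move=> i il; have [] := face_wordP il; rewrite lt0n size_eq0.
Qed.

Lemma collapse (X : countType) (x0 : X) (T : surf X) (A : word) r G : r != [::] ->
  sF T = (A ++ r, 1) :: [seq ([:: linv s], 1) | s <- A] ++ G ->
  exists T', [/\ sF T' = (r, 1) :: G, sV T' = sV T, {subset sE T' <= sE T} &
    related x0 T T'].
Proof.
move=> r0; elim: A T => [|s A IH] T FT.
  by exists T; split=> //; exact: related_refl.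
have h1 : same_cycle (s :: A ++ r) (rcons (A ++ r) (linv (linv s))).
  by left; apply/is_rotP; exists [:: s], (A ++ r); rewrite linvK cats1.
have [T1 [FT1 [V1 E1 i1] rel1]] := surf_head x0 FT h1.
have u0 : (A ++ r) ++ [::] != [::] by rewrite cats0; case: (A).
have [T2 [FT2 [V2 E2 i2] rel2]] := surf_merge x0 u0 FT1.
have [|T3 [FT3 V3 E3 rel3]] := IH T2; first by rewrite FT2 cats0.
exists T3; split=> //.
- by rewrite V3 V2 V1.
- by move=> n /E3; rewrite E2 E1; exact: mem_rem.
- by apply: related_trans rel1 _; apply: related_trans rel2 _.
Qed.

(** No corner of the digon leads from [s] to its inverse, so the end points of [s] are
different, and a function on the points may take the value of the cocycle at one of
them and 0 at the other. *)
Lemma acyclic2_digon (K : surfaceComplex) : digon K -> acyclic2 K.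
Proof.
case=> mK [f [s [oneP bdf]]] sig si sb.
have bdg g : is_rot [:: s; sinv s] (bd g).
  case/orP: (oneP g) => /eqP ->; first exact: is_rot_sym.
  rewrite bd_pinv; case: bdf => i Ei; have : is_rot (bd f) [:: s; sinv s] by exists i.
  move=> /is_rot_sym /is_rotP[a [b [E1 ->]]]; rewrite path_inv_cat; apply/is_rotP.
  exists (path_inv b), (path_inv a); rewrite -path_inv_cat -E1; split=> //.
  by rewrite /path_inv /= sinvK.
have ends : ini s != fin s.
  apply/eqP => e; case: (mf_star mK (s := s) (t := sinv s)) => // [es|[c fc]].
    by have := sinv_neq s; rewrite -es eqxx.
  have := fan_const (P := pred1 s) _ fc; rewrite /= eqxx (negPf (sinv_neq s)) => h.
  suff : true = false by []; apply: h => g; rewrite -(is_rot_cycle _ (bdg g)) /=.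
  by rewrite sinvK !eqxx.
exists (fun p => (p == fin s) && sig s) => t.
have ht : sig s = ((ini s == fin s) && sig s) (+) ((fin s == fin s) && sig s).
  by rewrite (negPf ends) eqxx.
have [g] := mf_bounds mK t; rewrite /passes addn_gt0 -!has_count !has_pred1.
rewrite -!(perm_mem (is_rot_perm (bdg g))) !inE.
move=> ht'; have [->|->] : t = s \/ t = sinv s.
    case/orP: ht' => /orP[] /eqP e; [by left|by right|by right; rewrite -e sinvK|].
    by left; apply: (can_inj (@sinvK K)).
  exact: ht.
by rewrite si fin_sinv -/(fin s) addbC.
Qed.

(** Every edge occurs twice in [r], so the indicator of an edge is a cocycle; but with a single point
every coboundary is 0. *)
Lemma polygon_not_acyclic2 (X : countType) (T : surf X) r :
  one_vertex_surf T -> sF T = [:: (r, 1)] -> ~ acyclic2 (cplx T).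
Proof.
move=> V1 FT; have inr : (r, 1) \in sF T by rewrite FT mem_head.
have [r0 rE _] := word_E inr.
have [a ar] : exists a, a \in r by case: (r) r0 => // k r' _; exists k; rewrite mem_head.
have aE := word_mem inr ar.
pose sig (s : segment (cplx T)) := (val s).1 == a.1.
have odd_sum w : sum2 sig w = odd (count_mem a.1 (map fst (map val w))).
  by elim: w => //= s w ->; rewrite oddD oddb.
move=> /(_ sig) [//|f|h hE].
  have : 0 < size (sF T) by rewrite FT.
  rewrite odd_sum val_piece_bd /piece_word.
  have f0 : nat_of_ord f.1 = 0.
    by apply/eqP; rewrite -leqn0 -ltnS; apply: leq_trans (ltn_ord f.1) _; rewrite FT.
  have -> : face T f.1 = (r, 1) by rewrite f0 (face_cons 0 FT).
  have c2 : count_mem a.1 (map fst r) = 2.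
    by have := gl_count (s_gluing T) aE; rewrite FT /= cats0.
  have -> : count_mem a.1 (map fst (if f.2 then winv r else r)) = 2; last by [].
  by case: f.2; rewrite // map_fst_winv -c2; apply/permP; rewrite perm_rev.
pose s : segment (cplx T) := exist _ a aE.
have := hE s; rewrite /sig eqxx.
have -> : ini s = fin s by apply/val_inj/V1; exact: valP.
by rewrite addbb.
Qed.

Lemma polygon_boundary (X Y : countType) (S : surf X) (T : surf Y) (r : seq (segment (cplx S))) :
  one_vertex_surf T -> sF T = [:: (map val r, 1)] -> {subset sE T <= sE S} ->
  normal_polygon_boundary r.
Proof.
move=> V1 FT EE.
have F0 : 0 < size (sF T) by rewrite FT.
have mT : manifold (cplx T) by apply: surf_manifold; rewrite FT.
pose f : piece (cplx T) := (Ordinal F0, false).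
pose h (s : segment (cplx T)) : segment (cplx S) := exist _ (val s) (EE _ (valP s)).
exists (cplx T), f, h; split.
- split=> //.
    have [s _] := mf_segment mT; exists (ini s) => y; apply/val_inj/V1; exact: valP.
  move=> g; rewrite same_pieceE -val_eqE /= eq_sym.
  by rewrite -leqn0 -ltnS; apply: leq_trans (ltn_ord g.1) _; rewrite FT.
- by move=> s t /(congr1 val) E; exact: val_inj.
- by move=> s; exact: val_inj.
exists (bd f); first by exists 0; rewrite rot0.
apply: (inj_map val_inj); rewrite -map_comp (eq_map (g := val)) // val_piece_bd.
by rewrite /piece_word /= (face_cons 0 FT).
Qed.

Lemma digon_surf (q p n : nat) : q != p -> exists S : surf unit, let e := (n, true) in
  [/\ sF S = [:: ([:: linv e; e], 1)], sV S = [:: q; p], sE S = [:: n] &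
      sini S e = p /\ sini S (linv e) = q].
Proof.
move=> qp; pose e : letter := (n, true).
pose ini k := if k == e then p else q.
have inie : ini e = p by rewrite /ini eqxx.
have iniv : ini (linv e) = q by rewrite /ini linv_neq.
have two (k : letter) : k.1 \in [:: n] -> k = e \/ k = linv e.
  by rewrite inE => /eqP ek; apply: (@letter_eq k e).
have T : gluing [:: q; p] [:: n] ini (map fst [:: ([:: linv e; e], 1)]).
  split=> //.
  - by move=> l /two[] ->; rewrite ?inie ?iniv !inE eqxx ?orbT.
  - move=> w; rewrite inE => /eqP ->; split=> //=; first by rewrite !inE eqxx.
    by rewrite /corner_rel linvK !eqxx.
  - by move=> m; rewrite inE => /eqP -> /=; rewrite eqxx.
  - move=> P _ a b /two[] -> /two[] -> //; rewrite inie iniv => e'; last first.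
      by rewrite e' eqxx in qp.
    by rewrite -e' eqxx in qp.
  - move=> P hP x y.
    have e1 : P p = P q by have := hP e; rewrite inie iniv; apply; rewrite inE.
    by rewrite !inE => /orP[] /eqP -> /orP[] /eqP ->; rewrite ?e1.
have Br : branching [:: n] (fun _ x => x : unit) [:: ([:: linv e; e], 1)].
  split=> // w m; rewrite inE => /eqP[_ ->]; split=> // j x.
  by rewrite dvd1n; apply/eqP; case: x; case: (iter _ _ _).
by exists (Surf T Br).
Qed.

Lemma digon_cplx (S : surf unit) (e : letter) :
  sF S = [:: ([:: linv e; e], 1)] -> digon (cplx S).
Proof.
move=> FS; split; first by apply: surf_manifold; rewrite FS.
have F0 : 0 < size (sF S) by rewrite FS.
have in0 : ([:: linv e; e], 1) \in sF S by rewrite FS mem_head.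
have eE : (linv e).1 \in sE S by apply: word_mem in0 (mem_head _ _).
exists (Ordinal F0, false), (exist _ (linv e) eE); split.
  move=> g; rewrite same_pieceE -val_eqE /= eq_sym.
  by rewrite -leqn0 -ltnS; apply: leq_trans (ltn_ord g.1) _; rewrite FS.
exists 0; rewrite rot0; apply: (inj_map val_inj).
by rewrite val_piece_bd /piece_word /= (face_cons 0 FS) /= linvK.
Qed.

(** The digon [linv e, e] is cut into [linv e, linv t] and [t, e]; this is the subdivision of
the two monogons in which [s] becomes the path [t, e]. *)
Lemma two_monogons_sphere (T : surf unit) s : one_vertex_surf T ->
  sF T = [:: ([:: s], 1); ([:: linv s], 1)] -> sphere (cplx T).
Proof.
move=> V1 FT.
have in0 : ([:: s], 1) \in sF T by rewrite FT mem_head.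
have sE' : s.1 \in sE T by apply: word_mem in0 (mem_head _ _).
set q := sini T s; have qV : q \in sV T by apply: (gl_ini (s_gluing T)).
have VT x : x \in sV T -> x = q by move=> xV; apply: V1.
have ET n : n \in sE T -> n = s.1.
  move=> /letter_word[w [m [+ nw]]]; rewrite FT !inE => /orP[] /eqP[Ew _];
  by move: nw; rewrite Ew inE => /eqP.
have qp : q != q.+1 by rewrite neq_ltn ltnSn.
have [Dg [FD VD ED [ie iv]]] := digon_surf s.1 qp; set e := (s.1, true) in FD ie iv.
have [S1 [t [FS1 [V_1 E_1 tE] [ini1 int itv] _ rel1]]] :=
  @surf_split unit tt Dg [:: linv e] [:: e] 1 [::] FD.
have p2 : perm_eq (sF T) [:: ([:: linv s], 1); ([:: s], 1)].
  by rewrite FT; exact: perm_swap.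
have [T2 [FT2 [V_2 E_2 i_2] rel2]] := surf_perm tt p2.
exists (cplx Dg); last exact: digon_cplx FD.
apply: rst_trans (related_cplx rel2) _.
apply: rst_trans (rst_sym _ _ _ _ (related_cplx rel1)).
apply: (@related_cplx _ tt).
have te : t.1 != s.1 by rewrite ED inE in tE.
have nE (k : letter) : k.1 \in sE T2 -> k.1 != s.1 -> False.
  by rewrite E_2 => /ET ->; rewrite eqxx.
have fs : sini T2 (linv s) = q by rewrite i_2; apply/VT/(gl_ini (s_gluing T)).
rewrite /= in int itv.
apply: (@subdivision_related unit tt T2 S1 s t e q.+1) => //.
- have e1 : subst1 s t e (linv s) = [:: linv e; linv t].
    by rewrite /subst1 linv_neq eqxx.
  have e2 : subst1 s t e s = [:: t; e] by rewrite /subst1 eqxx.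
  by rewrite FS1 FT2 /= /substw /= e1 e2.
- by rewrite E_2.
- move=> n; rewrite E_1 ED E_2 !inE.
  by case: (boolP (n \in sE T)) => [/ET ->|_]; rewrite ?eqxx ?andbF //= orbC.
- move=> x; rewrite V_1 VD V_2 !inE orbC; congr orb.
  by apply/eqP/idP => [->|/VT].
- by rewrite V_2; apply/negP => /VT /eqP; rewrite eq_sym (negPf qp).
- by move=> k kE ks; case: (nE k).
- by rewrite int iv i_2.
- by rewrite itv ie.
- by rewrite ini1 ?ie // ED inE.
- by rewrite ini1 ?iv ?fs // ED inE.
- by move=> k x kE ks; case: (nE k).
- by move=> x; case: (sact _ _ _) => //; case: (sact _ _ _).
Qed.

(** * Presenting a given covering *)

Section Fibre.
Variables (C : covering).
Local Notation K := (target C).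
Hypothesis connK : connected K.
Variable p0 : point K.
Variable ord : piece K -> nat.
Hypothesis ord_gt0 : forall f, 0 < ord f.
Hypothesis ord_branch : forall f : piece (source C),
  branching_number f (ord (cpiece f)).-1.

Lemma lift_seg_ex (s : segment K) (q : point (source C)) (t0 : segment (source C)) :
  exists t : segment (source C), ini s = cpt q -> ini t = q /\ cseg t = s.
Proof.
case: (ini s =P cpt q) => [e|n]; last by exists t0.
by have [t <- <-] := cov_star_surj e; exists t.
Qed.

Variable t0 : segment (source C).

Definition lift_seg s q : segment (source C) :=
  proj1_sig (constructive_indefinite_description _ (lift_seg_ex s q t0)).

Lemma lift_segP (s : segment K) (q : point (source C)) : ini s = cpt q ->
  ini (lift_seg s q) = q /\ cseg (lift_seg s q) = s.
Proof.
by rewrite /lift_seg; case: constructive_indefinite_description => t /= h /h.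
Qed.

Definition carry s q : point (source C) := fin (lift_seg s q).

Lemma lift_segE t : lift_seg (cseg t) (ini t) = t.
Proof. by have [h1 h2] := lift_segP (cov_ini t); exact: cov_star_inj. Qed.

Lemma cpt_fin (t : segment (source C)) : cpt (fin t) = fin (cseg t).
Proof. by rewrite /fin -cov_sinv cov_ini. Qed.

Lemma carryE t : carry (cseg t) (ini t) = fin t.
Proof. by rewrite /carry lift_segE. Qed.

Lemma cpt_carry (s : segment K) q : ini s = cpt q -> cpt (carry s q) = fin s.
Proof. by move=> e; have [_ h] := lift_segP e; rewrite cpt_fin h. Qed.

Lemma carry_inv (s : segment K) q : ini s = cpt q -> carry (sinv s) (carry s q) = q.
Proof.
move=> e; have [h1 h2] := lift_segP e.
by rewrite -{1}h2 -cov_sinv /carry -[fin (lift_seg s q)]/(ini (sinv (lift_seg s q))) lift_segE fin_sinv.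
Qed.

Lemma cpt_hol w q p : joins (cpt q) w p -> cpt (hol carry w q) = p.
Proof.
elim: w q => [|s w IH] q /=; first by move/eqP.
by move=> /andP[/eqP e j]; apply: IH; rewrite cpt_carry.
Qed.

Lemma hol_carry_inv w q p : joins (cpt q) w p ->
  hol carry (path_inv w) (hol carry w q) = q.
Proof.
elim: w q => //= s w IH q /andP[/eqP e j]; rewrite path_inv_cons hol_rcons.
by rewrite IH ?cpt_carry // carry_inv.
Qed.

Lemma hol_carry_path t r : path (@follows _) t r ->
  r = [seq lift_seg sq.1 sq.2 | sq <- plift carry (map (@cseg C) r) (fin t)] /\
  hol carry (map (@cseg C) r) (fin t) = fin (last t r).
Proof.
elim: r t => //= s r IH t /andP[/eqP e /IH[Er Eh]].
by rewrite -e lift_segE carryE -Er.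
Qed.

Definition tree_ex p : exists w : seq (segment K), joins p0 w p := connK p0 p.
(** Paths from a base point to all points, which identify all fibres with the one over
the base point. *)
Definition tree p : seq (segment K) := xchoose (tree_ex p).

Lemma treeP p : joins p0 (tree p) p.
Proof. exact: xchooseP (tree_ex p). Qed.

Definition fibre : countType := {q : point (source C) | cpt q == p0}.

Definition base_of q := hol carry (path_inv (tree (cpt q))) q.

Lemma base_ofP q : cpt (base_of q) == p0.
Proof. by apply/eqP/cpt_hol/joins_inv/treeP. Qed.

Definition coord q : fibre := exist _ (base_of q) (base_ofP q).

Definition loop s := tree (ini s) ++ s :: path_inv (tree (fin s)).

Lemma loopP (s : segment K) : joins p0 (loop s) p0.
Proof.
apply/joins_cat; exists (ini s); first exact: treeP.
by rewrite /= eqxx; apply: joins_inv; exact: treeP.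
Qed.

Lemma loop_inv (s : segment K) : loop (sinv s) = path_inv (loop s).
Proof.
by rewrite /loop path_inv_cat path_inv_cons path_invK cat_rcons fin_sinv.
Qed.

Lemma loop_fibre (s : segment K) (x : fibre) : cpt (hol carry (loop s) (val x)) == p0.
Proof. by apply/eqP/cpt_hol; rewrite (eqP (valP x)); exact: loopP. Qed.

Definition fibre_act s (x : fibre) : fibre := exist _ (hol carry (loop s) (val x)) (loop_fibre s x).

Lemma fibre_actK s : cancel (fibre_act s) (fibre_act (sinv s)).
Proof.
move=> x; apply: val_inj; rewrite /= loop_inv.
by apply: (@hol_carry_inv _ _ p0); rewrite (eqP (valP x)); exact: loopP.
Qed.

Lemma base_ofK q : hol carry (tree (cpt q)) (base_of q) = q.
Proof.
rewrite -{1}(path_invK (tree (cpt q))); apply: (@hol_carry_inv _ _ p0).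
exact/joins_inv/treeP.
Qed.

Lemma coord_act (t : segment (source C)) : coord (fin t) = fibre_act (cseg t) (coord (ini t)).
Proof.
apply: val_inj; rewrite /= /loop hol_cat cov_ini base_ofK /= carryE /base_of.
by rewrite cpt_fin.
Qed.

Lemma coord_inj p q : cpt p = cpt q -> coord p = coord q -> p = q.
Proof. by move=> e /(congr1 val) /= h; rewrite -(base_ofK p) h e base_ofK. Qed.

Lemma coord_surj (p : point K) (x : fibre) : exists q, cpt q = p /\ coord q = x.
Proof.
have jp : joins (cpt (val x)) (tree p) p by rewrite (eqP (valP x)); exact: treeP.
exists (hol carry (tree p) (val x)); split; first exact: cpt_hol.
by apply: val_inj; rewrite /= /base_of (cpt_hol jp) (hol_carry_inv jp).
Qed.

Lemma coord_hol w q p : joins (cpt q) w p -> coord (hol carry w q) = hol fibre_act w (coord q).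
Proof.
elim: w q => //= s w IH q /andP[/eqP e j]; rewrite IH ?cpt_carry //; congr hol.
by have [h1 h2] := lift_segP e; rewrite coord_act h1 h2.
Qed.

Lemma iter_orbit (T : eqType) (h : T -> T) q0 m j0 j : 0 < m ->
  uniq (traject h q0 m) -> iter m h q0 = q0 ->
  (iter j h (iter j0 h q0) == iter j0 h q0) = (m %| j).
Proof.
move=> m0 u hm.
have mult k : iter (k * m) h q0 = q0 by elim: k => // k IH; rewrite mulSn iterD IH.
have -> : (iter j h (iter j0 h q0) == iter j0 h q0) = (iter j h q0 == q0).
  apply/eqP/eqP => e; last by rewrite -iterD addnC iterD e.
  have [k Ek] : exists k, iter k h (iter j0 h q0) = q0.
    by exists (j0 * m.-1); rewrite -iterD -mulnSr prednK.
  by rewrite -{1}Ek -iterD addnC iterD e Ek.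
have -> : iter j h q0 = iter (j %% m) h q0.
  by rewrite {1}(divn_eq j m) addnC iterD mult.
have lt : j %% m < m by rewrite ltn_mod.
have := nth_uniq q0 (i := j %% m) (j := 0) _ _ u.
by rewrite !size_traject !nth_traject // => ->.
Qed.

(** A lap of a boundary path is the lift of [bd fs] from its starting point. So the starting
points of the laps of a piece are the successive images of the first one under a turn, and
they are distinct because the laps are; their number is [ord fs]. *)
Lemma fibre_act_orbit (fs : piece K) j (x : fibre) :
  (iter j (hol fibre_act (bd fs)) x == x) = (ord fs %| j).
Proof.
set B := bd fs; set n := size B; have B0 : B != [::] := bd_nonempty fs.
have n0 : 0 < n by rewrite lt0n size_eq0.
have [b [B' EB]] : exists b B', B = b :: B' by case: (B) B0 => // b B' _; exists b, B'.
have jB : joins (ini b) B (ini b).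
  have := bd_closed fs; rewrite -/B EB => /path_joins h /=; rewrite eqxx; exact: h.
have [q [Eq Ec]] := coord_surj (ini b) x.
have cptB q' : cpt q' = ini b -> cpt (hol carry B q') = ini b.
  by move=> e; apply: cpt_hol; rewrite e.
have cptI i q' : cpt q' = ini b -> cpt (iter i (hol carry B) q') = ini b.
  by move=> e; elim: i => //= i /cptB.
have coordI i : coord (iter i (hol carry B) q) = iter i (hol fibre_act B) x.
  elim: i => //= i IH; rewrite -IH; apply: (coord_hol (p := ini b)).
  by rewrite (cptI i _ Eq).
have -> : (iter j (hol fibre_act B) x == x) = (iter j (hol carry B) q == q).
  rewrite -coordI -{1}Ec; apply/eqP/eqP => [|-> //]; apply: coord_inj.
  by rewrite cptI.
(* the lap of [bd fs] starting at [q] *)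
have [s sq sb] : exists2 s : segment (source C), ini s = q & cseg s = b.
  by apply: cov_star_surj; rewrite Eq.
have [r pr Er] : exists2 r, path (@follows _) s r & map (@cseg C) r = B'.
  apply: lift_path; rewrite sb; have := bd_closed fs; rewrite -/B EB /= rcons_path.
  by case/andP.
have Ew : map (@cseg C) (s :: r) = rot 0 B by rewrite rot0 /= sb Er EB.
have [f [[Ef [j0 pf]] _]] := cov_lift (w := s :: r) n0 pr Ew.
have [ws [EL lapsE uws sws]] := ord_branch f.
rewrite Ef prednK // in sws.
have cL : map (@cseg C) (lift_bd f) = wpow B (ord fs).
  rewrite EL -sws map_flatten; elim: (ws) lapsE => //= w ws' IH h.
  rewrite wpowS IH => [|v vw]; last by apply: h; rewrite inE vw orbT.
  by rewrite h ?mem_head // Ef.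
have szL : size (lift_bd f) = ord fs * n by rewrite -(size_map (@cseg C)) cL size_wpow.
have [l [L EL']] : exists l L, lift_bd f = l :: L.
  case E: (lift_bd f) => [|l L]; last by exists l, L.
  by move/eqP: szL; rewrite E eq_sym muln_eq0 -leqn0 leqNgt ord_gt0 -leqn0 leqNgt n0.
have cyL : cycle (@follows _) (lift_bd f).
  by have [i ->] := lift_bd_simple f; rewrite rot_cycle bd_closed.
have := cyL; rewrite EL' /= rcons_path => /andP[pL /eqP lastL].
have [h1 h2] := hol_carry_path pL.
set q0 := ini l.
have ELl : lift_bd f = [seq lift_seg sq.1 sq.2 | sq <- plift carry (wpow B (ord fs)) q0].
  by rewrite -cL EL' /= lift_segE carryE -h1.
have closed : hol carry (wpow B (ord fs)) q0 = q0.
  by rewrite -cL EL' /= carryE h2 -lastL.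
have cq0 : cpt q0 = ini b.
  rewrite /q0 -cov_ini; move: cL; rewrite EL' EB.
  by have := ord_gt0 fs; case: (ord fs) => // d _; rewrite wpowS /= => -[->].
have uT : uniq (traject (hol carry B) q0 (ord fs)).
  pose lap q' := [seq lift_seg sq.1 sq.2 | sq <- plift carry B q'].
  have Ews : ws = map lap (traject (hol carry B) q0 (ord fs)).
    apply: eq_from_flatten_shape.
      rewrite -EL ELl plift_wpow map_flatten -map_comp.
      by congr flatten; apply: eq_map => q'.
    rewrite /shape -map_comp (@eq_map _ _ (size \o lap) (fun=> n)); last first.
      by move=> q' /=; rewrite size_map size_plift.
    have -> : map size ws = map (fun=> n) ws.
      apply/eq_in_map => w /lapsE Ew'; rewrite -(size_map (@cseg C)) Ew' Ef; by [].
    have cst (T : Type) (v : seq T) : map (fun=> n) v = nseq (size v) n.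
      by elim: v => //= y v ->.
    by rewrite !cst size_traject sws.
  by apply: (map_uniq (f := lap)); rewrite -Ews.
have Eq0 : q = iter (minn j0 (ord fs)) (hol carry B) q0.
  move: pf; rewrite rot0 (rot_laps_min _ szL) ELl -map_rot -(rot0 (plift _ _ _)).
  rewrite -/n rot_lift_laps ?geq_minr // rot0 take0 /=.
  have := ord_gt0 fs; case: (ord fs) => // d _; rewrite wpowS EB /= => /andP[/eqP Es _].
  rewrite -sq Es; set y := iter _ _ _.
  have [//|-> //] := @lift_segP b y.
  by rewrite /y -EB cptI.
rewrite Eq0; apply: iter_orbit => //; rewrite -?hol_wpow //; exact: ord_gt0.
Qed.

End Fibre.

Section Presentation.
Variable K : surfaceComplex.
Hypothesis mK : manifold K.
Variables (eP : seq (point K)) (eS : seq (segment K)) (eF : seq (piece K)).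
Hypothesis allP_ : forall p, p \in eP.
Hypothesis allS : forall s, s \in eS.
Hypothesis allF : forall f, f \in eF.
Variable s0 : segment K.
Variables (X : countType) (x0 : X).
Variables (fibre_act : segment K -> X -> X) (ord : piece K -> nat).
Hypothesis fibre_actK : forall s, cancel (fibre_act s) (fibre_act (sinv s)).
Hypothesis ord_gt0 : forall f, 0 < ord f.
Hypothesis ord_pinv : forall f, ord (pinv f) = ord f.
Hypothesis fibre_act_orbit : forall fs j x, (iter j (hol fibre_act (bd fs)) x == x) = (ord fs %| j).

(** Chooses one of the two directions of a segment or of the two orientations of a piece. *)
Definition positive (T : countType) (inv : T -> T) (x : T) := pickle x < pickle (inv x).

Lemma pickle_inj (T : countType) : injective (@pickle T).
Proof. exact: pcan_inj pickleK. Qed.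

Lemma positive_inv (T : countType) (inv : T -> T) x : involutive inv -> inv x != x ->
  positive inv (inv x) = ~~ positive inv x.
Proof.
move=> iK ix; rewrite /positive iK; case: ltngtP => // /pickle_inj e.
by rewrite e eqxx in ix.
Qed.

Definition name (s : segment K) : letter :=
  if positive (@sinv K) s then (pickle s, true) else (pickle (sinv s), false).

Lemma name_sinv s : name (sinv s) = linv (name s).
Proof.
rewrite /name positive_inv ?sinv_neq //; last exact: sinvK.
by rewrite sinvK; case: positive.
Qed.

Lemma name_inj : injective name.
Proof.
move=> s t; rewrite /name; case: positive; case: positive => // -[] /pickle_inj //.
exact: (can_inj (@sinvK K)).
Qed.

(** A left inverse of [name]. *)
Definition dec (l : letter) : segment K := nth s0 eS (index l (map name eS)).

Lemma nameK s : dec (name s) = s.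
Proof. by rewrite /dec index_map ?nth_index //; exact: name_inj. Qed.

Definition pV := map pickle eP.
Definition pE := undup (map (fun s => (name s).1) eS).
Definition pini (l : letter) : nat := pickle (ini (dec l)).
Definition pact (l : letter) : X -> X := fibre_act (dec l).
(** One piece of each pair of opposite pieces. *)
Definition reps := [seq f <- undup eF | positive (@pinv K) f].
Definition pF : seq (word * nat) := [seq (map name (bd f), ord f) | f <- reps].

Lemma mem_pE s : (name s).1 \in pE.
Proof. by rewrite mem_undup; apply/mapP; exists s. Qed.

Lemma name_onto (l : letter) : l.1 \in pE -> exists s, l = name s.
Proof.
rewrite mem_undup => /mapP[s _ /letter_eq[->|->]]; first by exists s.
by exists (sinv s); rewrite name_sinv.
Qed.

Lemma name_path_inv w : map name (path_inv w) = winv (map name w).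
Proof.
rewrite /path_inv /winv map_rev -!map_comp; congr rev.
by apply: eq_map => s; rewrite /= name_sinv.
Qed.

Lemma mem_reps f : (f \in reps) = positive (@pinv K) f.
Proof. by rewrite mem_filter mem_undup allF andbT. Qed.

Definition oriented f := if positive (@pinv K) f then f else pinv f.

Lemma oriented_reps f : oriented f \in reps.
Proof.
rewrite mem_reps /oriented; case: ifP => // h.
by rewrite positive_inv ?h // ?pinv_neq //; exact: pinvK.
Qed.

Lemma cycle_name (T : eqType) (P : letter -> T) (w : seq (segment K)) :
  cycle (corner_rel P) (map name w) = cycle (fun a b => P (name (sinv a)) == P (name b)) w.
Proof. by rewrite cycle_map; apply: eq_cycle => a b; rewrite /corner_rel /= name_sinv. Qed.

Lemma count_name s w : count_mem (name s).1 (map fst (map name w)) =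
  count_mem s w + count_mem (sinv s) w.
Proof.
elim: w => //= t w ->.
have -> : ((name t).1 == (name s).1) = (t == s) + (t == sinv s) :> nat; last exact: addnACA.
case: (t =P s) => [->|n1]; first by rewrite eqxx eq_sym (negPf (sinv_neq s)).
case: (t =P sinv s) => [->|n2]; first by rewrite name_sinv eqxx.
case: eqP => // /letter_eq[/name_inj //|]; by rewrite -name_sinv => /name_inj.
Qed.

Lemma passes_pinv (f : piece K) (s : segment K) : passes (pinv f) s = passes f s.
Proof.
rewrite /passes -!count_name bd_pinv name_path_inv map_fst_winv.
by apply/permP; rewrite perm_rev.
Qed.

Lemma passes_oriented (f : piece K) (s : segment K) : passes (oriented f) s = passes f s.
Proof. by rewrite /oriented; case: ifP => // _; exact: passes_pinv. Qed.

Lemma oriented_same (f : piece K) : same_piece f (oriented f).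
Proof. by rewrite /same_piece /oriented; case: ifP; rewrite eqxx ?orbT. Qed.

Lemma positive_pinv (h : piece K) : positive (@pinv K) (pinv h) = ~~ positive (@pinv K) h.
Proof. by apply: positive_inv; [exact: pinvK|exact: pinv_neq]. Qed.

Lemma same_oriented (f g : piece K) : same_piece f g = (oriented f == oriented g).
Proof.
apply/orP/eqP => [[]/eqP ->|]; rewrite /oriented ?positive_pinv ?pinvK //; first by case: ifP.
case: ifP => h1; case: ifP => h2 e; rewrite -?e ?pinvK ?eqxx ?orbT; auto.
- by rewrite e pinvK eqxx; right.
- by rewrite -(can_inj (@pinvK K) e) eqxx; left.
Qed.

Lemma uniq_reps : uniq reps.
Proof. by rewrite filter_uniq ?undup_uniq. Qed.

Lemma oriented_id g : g \in reps -> oriented g = g.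
Proof. by rewrite mem_reps /oriented => ->. Qed.

Lemma sum_passes (s : segment K) : \sum_(f <- reps) passes f s = 2.
Proof.
have [f0 c0] := mf_bounds mK s; set f := oriented f0.
have fr : f \in reps by exact: oriented_reps.
have {}c0 : 0 < passes f s by rewrite passes_oriented.
have same g : g \in reps -> (g == f) = same_piece f g.
  by move=> gr; rewrite same_oriented !oriented_id // eq_sym.
rewrite (bigD1_seq f) ?uniq_reps //=.
have := mf_le2 mK f s; rewrite leq_eqVlt => /orP[/eqP c2|].
  rewrite c2 big_seq_cond big1 // => g /andP[gr gf]; apply/eqP; rewrite -leqn0 leqNgt.
  by apply: contra gf => /(mf_twice mK c2); rewrite same.
rewrite ltnS => c1; have {c0}c1 : passes f s = 1 by apply/eqP; rewrite eqn_leq c1.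
have [f' [ff' cf' uniq']] := mf_once mK c1.
have fr' := oriented_reps f'.
have nf : oriented f' != f by rewrite same // same_oriented [oriented (oriented _)]oriented_id // -same_oriented.
rewrite c1 -big_filter (bigD1_seq (oriented f')) /=; first last.
- by rewrite filter_uniq ?uniq_reps.
- by rewrite mem_filter nf.
rewrite passes_oriented cf' big_seq_cond big1 // => g /andP[].
rewrite mem_filter => /andP[gf gr] gf'; apply/eqP; rewrite -leqn0 leqNgt.
apply: contra gf' => cg; have nsg : ~~ same_piece f g by rewrite -same.
by have := uniq' g nsg cg; rewrite same_oriented (oriented_id gr) eq_sym.
Qed.

Lemma cycle_pinv (T : eqType) (P : letter -> T) f :
  cycle (corner_rel P) (map name (bd (pinv f))) = cycle (corner_rel P) (map name (bd f)).
Proof. by rewrite bd_pinv name_path_inv cycle_winv. Qed.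

Lemma pres_gluing : gluing pV pE pini (map fst pF).
Proof.
have wsE : map fst pF = map (fun f => map name (bd f)) reps by rewrite -map_comp.
split.
- exact: undup_uniq.
- by move=> l _; exact: map_f.
- move=> w; rewrite wsE => /mapP[f _ ->]; split.
  + by rewrite -size_eq0 size_map size_eq0 bd_nonempty.
  + by apply/allP => n /mapP[k /mapP[s _ ->] ->]; exact: mem_pE.
  + rewrite cycle_name -(eq_cycle (e := @follows K)) ?bd_closed // => a b.
    by rewrite /pini !nameK (inj_eq (@pickle_inj _)) eq_sym.
- move=> n; rewrite mem_undup => /mapP[s _ ->]; rewrite -(sum_passes s).
  rewrite wsE map_flatten count_flatten -!map_comp sumnE big_map.
  by apply: eq_bigr => f _; rewrite /= count_name.
- move=> P hP a b /name_onto[s ->] /name_onto[t ->].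
  rewrite /pini !nameK => /pickle_inj /(mf_star mK)[-> //|[c fc]].
  apply: (fan_const (P := P \o name) _ fc) => f; rewrite -(cycle_name P).
  have hr : cycle (corner_rel P) (map name (bd (oriented f))).
    by apply: hP; rewrite wsE; apply: map_f; exact: oriented_reps.
  by move: hr; rewrite /oriented; case: ifP; rewrite ?cycle_pinv.
- move=> P hP x y /mapP[p _ ->] /mapP[q _ ->].
  have [w jw] := mf_connected mK p q; elim: w p jw => [|s w IH] p /=; first by move/eqP ->.
  move=> /andP[/eqP <- /IH <-]; have := hP (name s) (mem_pE s).
  by rewrite -name_sinv /pini !nameK.
Qed.

Lemma hol_name w x : hol pact (map name w) x = hol fibre_act w x.
Proof. by elim: w x => //= s w IH x; rewrite /pact nameK IH. Qed.

Lemma pres_branching : branching pE pact pF.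
Proof.
split=> [l /name_onto[s ->] x|w m /mapP[f _ [-> ->]]].
  by rewrite /pact -name_sinv !nameK fibre_actK.
split=> // j x; rewrite -(fibre_act_orbit f j x); congr (_ == _); apply: eq_iter => y.
exact: hol_name.
Qed.

Definition pres : surf X := Surf pres_gluing pres_branching.

Lemma index_oriented f : index (oriented f) reps < size (sF pres).
Proof. by rewrite size_map index_mem oriented_reps. Qed.

Definition pres_pt (p : point K) : point (cplx pres) := exist _ (pickle p) (map_f _ (allP_ p)).
Definition pres_seg (s : segment K) : segment (cplx pres) := exist _ (name s) (mem_pE s).
Definition pres_piece (f : piece K) : piece (cplx pres) :=
  (Ordinal (index_oriented f), ~~ positive (@pinv K) f).

Lemma face_oriented f : face pres (index (oriented f) reps) = (map name (bd (oriented f)), ord f).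
Proof.
rewrite /face (nth_map f) ?index_mem ?oriented_reps // nth_index ?oriented_reps //.
by rewrite /oriented; case: ifP; rewrite // ord_pinv.
Qed.

Lemma pres_bd f : bd (pres_piece f) = map pres_seg (bd f).
Proof.
apply: (inj_map val_inj); rewrite val_piece_bd -map_comp /piece_word /= face_oriented /=.
rewrite /oriented; case: positive => //=.
by rewrite -name_path_inv -bd_pinv pinvK.
Qed.

Definition pres_iso : complex_iso K (cplx pres).
Proof.
apply: (@ComplexIso K (cplx pres) pres_pt pres_seg pres_piece).
- apply: inj_surj_bij => [p q /(congr1 val) /pickle_inj //|[n nV]].
  by have /mapP[p _ E] := nV; exists p; exact: val_inj.
- apply: inj_surj_bij => [p q /(congr1 val) /name_inj //|[l lE]].
  by have [s E] := name_onto lE; exists s; exact: val_inj.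
- apply: inj_surj_bij => [f g [e1 e2]|[[i il] b]].
    have {}e1 : oriented f = oriented g by rewrite -(nth_index f (oriented_reps f)) e1 nth_index ?oriented_reps.
    have {}e2 : positive (@pinv K) f = positive (@pinv K) g by exact: negb_inj.
    by move: e1; rewrite /oriented e2; case: ifP => // _ /(can_inj (@pinvK K)).
  have [f0 _] := mf_bounds mK s0.
  have il' : i < size reps by move: il; rewrite size_map.
  pose g := nth f0 reps i; have gr : g \in reps by exact: mem_nth.
  have gp : positive (@pinv K) g by rewrite -mem_reps.
  exists (if b then pinv g else g).
  have rg : oriented (if b then pinv g else g) = g.
    by rewrite /oriented; case: b; rewrite ?positive_pinv gp //= pinvK.
  congr pair; last by case: b {rg}; rewrite ?positive_pinv gp.
  by apply: val_inj; rewrite /= rg index_uniq ?uniq_reps.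
- by move=> s; apply: val_inj; rewrite /= /pini nameK.
- by move=> s; apply: val_inj; rewrite /= name_sinv.
- move=> f; congr pair; last by rewrite /= positive_pinv.
  apply: val_inj => /=; congr index; apply/eqP; rewrite -same_oriented /same_piece.
  by rewrite pinvK eqxx orbT.
- by move=> f; exists 0; rewrite rot0 pres_bd.
Defined.

Lemma pres_deg f : deg (surf_monodromy pres) (iso_piece pres_iso f) = ord f.
Proof.
have E2 : deg (surf_monodromy pres) (pres_piece f) = (face pres (index (oriented f) reps)).2 by [].
have E : iso_piece pres_iso f = pres_piece f by [].
by rewrite E E2 face_oriented.
Qed.

End Presentation.

(** * The normal form of a branched covering *)

Lemma presentation (C : covering) (ord : piece (target C) -> nat) :
  manifold (target C) -> finite_complex (target C) ->
  (forall f, 0 < ord f) -> (forall f, ord (pinv f) = ord f) ->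
  (forall f : piece (source C), branching_number f (ord (cpiece f)).-1) ->
  exists (X : countType) (x0 : X) (S : surf X) (eF : seq (piece (target C))),
    [/\ covering_iso C (surf_cover x0 S), forall f, f \in eF &
        map snd (sF S) = map ord (reps eF)].
Proof.
move=> mK [[eP allP_] [eS allS] [eF allF]] d0 dV dB.
have [s0 _] := mf_segment mK.
have [q0 Eq0] := cov_surj (ini s0).
have [t0 _ _] := cov_star_surj (esym Eq0).
pose x0 : fibre (ini s0) := exist _ q0 (introT eqP Eq0).
have cK := mf_connected mK.
pose aK := fibre_actK (p0 := ini s0) cK t0.
pose dK := fibre_act_orbit (p0 := ini s0) cK d0 dB t0.
pose S := pres mK allP_ allS allF s0 aK d0 dK.
pose u := pres_iso mK allP_ allS allF s0 aK d0 dV dK.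
exists (fibre (ini s0)), x0, S, eF; split=> //.
  apply: (@coordinates_iso C (cplx S) _ (surf_monodromy S) x0 u (fun=> 0) (coord cK (ini s0) t0)).
  - move=> t; rewrite coord_act.
    have -> : act (surf_monodromy S) (iso_seg u (cseg t)) = pact eS s0 (fibre_act cK t0) (name (cseg t)) by [].
    by rewrite /pact nameK.
  - by move=> p q; exact: coord_inj.
  - exact: coord_surj.
  - by move=> f; rewrite pres_deg.
  - by move=> f; rewrite lt0n size_eq0 bd_nonempty.
  - by move=> f; rewrite rot0; exact: pres_bd.
  - by move=> f; left.
by rewrite /= /pF -map_comp.
Qed.

Lemma codom_sorted n (k : 'I_n -> nat) : (forall i j : 'I_n, i <= j -> k i <= k j) ->
  sorted leq (codom k).
Proof.
move=> km; rewrite codomE sorted_map.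
have := iota_sorted 0 n; rewrite -val_enum_ord sorted_map.
by apply: sub_sorted => i j; exact: km.
Qed.

Lemma nth_codom_ord n (k : 'I_n -> nat) (i : 'I_n) : nth 0 (codom k) i = k i.
Proof. by rewrite codomE (nth_map i) ?size_enum_ord // nth_ord_enum. Qed.

Section BranchData.
Variables (C : covering) (n : nat).
Variables (f : 'I_n -> piece (target C)) (k : 'I_n -> nat).
Hypothesis f_inj : forall i j, same_piece (f i) (f j) -> i = j.
Hypothesis k_gt1 : forall i, 1 < k i.
Hypothesis f_branch : forall i, branched_along (f i) (k i).-1.
Hypothesis f_only : forall g, (forall i, ~~ same_piece (f i) g) -> branched_along g 0.

Definition order_along (g : piece (target C)) : nat :=
  if [pick i | same_piece (f i) g] is Some i then k i else 1.

Lemma order_along_gt0 g : 0 < order_along g.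
Proof. by rewrite /order_along; case: pickP => // i _; exact: ltnW. Qed.

Lemma order_along_pinv g : order_along (pinv g) = order_along g.
Proof.
rewrite /order_along (@eq_pick _ _ (fun i => same_piece (f i) g)) // => i.
by rewrite /same_piece (inj_eq (can_inj (@pinvK _))) (can2_eq (@pinvK _) (@pinvK _)) orbC.
Qed.

Lemma branching_pinv (g : piece (source C)) b :
  branching_number (pinv g) b -> branching_number g b.
Proof.
case=> ws [E lapsE u sz].
exists (rev (map (@path_inv _) ws)); split.
- rewrite -[LHS]path_invK -lift_bd_pinv E; elim: (ws) => //= w ws' IH.
  by rewrite path_inv_cat IH rev_cons -cats1 flatten_cat /= cats0.
- move=> w; rewrite mem_rev => /mapP[v vw ->].
  rewrite -[cpiece g]pinvK -cov_pinv bd_pinv -(lapsE v vw) /path_inv map_rev -!map_comp.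
  by congr rev; apply: eq_map => s; rewrite /= cov_sinv.
- by rewrite rev_uniq map_inj_uniq //; exact: can_inj (@path_invK _).
- by rewrite size_rev size_map.
Qed.

Lemma order_along_branch (g : piece (source C)) :
  branching_number g (order_along (cpiece g)).-1.
Proof.
rewrite /order_along; case: pickP => [i /orP[/eqP e|/eqP e]|none].
- exact: f_branch e.
- apply: branching_pinv; apply: f_branch; by rewrite cov_pinv e pinvK.
- by apply: f_only (erefl) => i; rewrite none.
Qed.

(** The branched pieces among [reps] are the [f i] up to orientation. *)
Lemma order_along_perm eF : (forall f, f \in eF) ->
  perm_eq [seq m <- map order_along (reps eF) | 1 < m] (codom k).
Proof.
move=> allF; rewrite filter_map.
have oE i : order_along (oriented (f i)) = k i.
  rewrite /order_along; case: pickP => [j|/(_ i)]; last by rewrite oriented_same.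
  by rewrite same_oriented [oriented (oriented _)](oriented_id allF) ?oriented_reps // -same_oriented => /f_inj ->.
have -> : codom k = map order_along (map (fun i => oriented (f i)) (enum 'I_n)).
  by rewrite -map_comp codomE; apply: eq_map => i; rewrite /= oE.
apply: perm_map; apply: uniq_perm.
- by rewrite filter_uniq // uniq_reps.
- rewrite map_inj_uniq ?enum_uniq // => i j e; apply: f_inj.
  by rewrite same_oriented e.
move=> g; rewrite mem_filter (mem_reps allF); apply/andP/mapP => [[]|[i _ ->]].
  rewrite /order_along /=; case: pickP => // i ig _ gp; exists i; first by rewrite mem_enum.
  by move: ig; rewrite same_oriented => /eqP ->; rewrite /oriented gp.
by rewrite /= oE k_gt1 -(mem_reps allF) oriented_reps.
Qed.

End BranchData.

Section NormalForm.
Variables (X : countType) (x0 : X) (S : surf X) (n : nat).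
Variables (M : seq (letter * nat)) (r : word) (k : 'I_n.+1 -> nat).
Variable m : nat.
Hypothesis V1 : one_vertex_surf S.
Hypothesis FS : sF S = (map fst M ++ r, m) :: monogons M.
Hypothesis kE : rcons (map snd M) m = codom k.

Lemma size_M : size M = n.
Proof.
by have := congr1 size kE; rewrite size_rcons size_map size_codom card_ord => -[].
Qed.

Lemma nf_size : size (sF S) = n.+1.
Proof. by rewrite FS /= size_map size_M. Qed.

Definition nf_index (i : 'I_n.+1) : nat := if i < n then i.+1 else 0.

Lemma nf_index_lt i : nf_index i < size (sF S).
Proof. by rewrite nf_size /nf_index; case: ifP. Qed.

(** The hub is the face with index 0 and comes last. The monogons bound the inverses of the
loops in the boundary of the hub, so they are taken with the opposite orientation. *)
Definition nf_piece (i : 'I_n.+1) : piece (cplx S) := (Ordinal (nf_index_lt i), i < n).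

Lemma M_in (j : 'I_n) : (nth ((0, true), 0) M j).1.1 \in sE S.
Proof.
set s := nth _ _ _; have sM : s \in M by rewrite mem_nth // size_M.
have wF : ([:: linv s.1], s.2) \in sF S by rewrite FS inE map_f ?orbT.
exact: word_mem wF (mem_head _ _).
Qed.

Definition nf_seg (j : 'I_n) : segment (cplx S) := exist _ (nth ((0, true), 0) M j).1 (M_in j).

Lemma nf_piece_inj i j : same_piece (nf_piece i) (nf_piece j) -> i = j.
Proof.
rewrite same_pieceE -val_eqE /= /nf_index => /eqP.
case: (ltnP i n) => hi; case: (ltnP j n) => hj //; first by move=> [] /val_inj.
move=> _; apply: val_inj; apply/eqP; rewrite eqn_leq.
by rewrite (leq_trans (leq_ord i) hj) (leq_trans (leq_ord j) hi).
Qed.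

Lemma nf_piece_onto h : exists i, same_piece (nf_piece i) h.
Proof.
have : nat_of_ord h.1 < n.+1 by rewrite -nf_size.
case E: (nat_of_ord h.1) => [|i] iN.
  by exists ord_max; rewrite same_pieceE -val_eqE /= E /nf_index ltnn.
exists (Ordinal (ltnW iN)); rewrite same_pieceE -val_eqE /= E /nf_index /=.
by rewrite -ltnS iN.
Qed.

Lemma nf_deg i : deg (surf_monodromy S) (nf_piece i) = k i.
Proof.
rewrite /= /face_deg /= (face_cons _ FS) -[RHS]nth_codom_ord -kE nth_rcons size_map size_M.
rewrite /nf_index; case: (ltnP i n) => hi.
  by rewrite /monogons (nth_map ((0, true), 0)) ?size_M // (nth_map ((0, true), 0)) ?size_M.
by rewrite eqn_leq hi -ltnS ltn_ord.
Qed.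

Lemma nf_monogon (j : 'I_n) :
  simple_boundary (nf_piece (widen_ord (leqnSn n) j)) [:: nf_seg j].
Proof.
exists 0; rewrite rot0; apply: (inj_map val_inj); rewrite val_piece_bd /piece_word /=.
rewrite ltn_ord (face_cons _ FS) /nf_index /= ltn_ord.
by rewrite /monogons (nth_map ((0, true), 0)) ?size_M //= /winv /= linvK.
Qed.

Lemma nf_letters : map val (codom nf_seg) = map fst M.
Proof.
rewrite codomE -map_comp.
rewrite (@eq_map _ _ _ (fun j : 'I_n => (nth ((0, true), 0) M (val j)).1)) //.
rewrite (map_comp (fun j => (nth ((0, true), 0) M j).1) val) val_enum_ord.
by rewrite -[in RHS](mkseq_nth ((0, true), 0) M) /mkseq -map_comp size_M.
Qed.

Lemma nf_word_E : all (mem (sE S)) (map fst r).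
Proof.
have in0 : (map fst M ++ r, m) \in sF S by rewrite FS mem_head.
by have [_ + _] := word_E in0; rewrite map_cat all_cat => /andP[].
Qed.

Lemma nf_hub : simple_boundary (nf_piece ord_max) (codom nf_seg ++ wseg S r).
Proof.
exists 0; rewrite rot0; apply: (inj_map val_inj).
rewrite map_cat nf_letters val_wseg ?nf_word_E // val_piece_bd /piece_word /= ltnn.
by rewrite (face_cons _ FS) /nf_index /= ltnn.
Qed.

Lemma nf_one_point : one_point (cplx S).
Proof.
have in0 : (map fst M ++ r, m) \in sF S by rewrite FS mem_head.
have [w0 _ _] := word_E in0; case E: (map fst M ++ r) w0 => [//|a w] _.
have aE : a.1 \in sE S by apply: word_mem in0 _; rewrite E mem_head.
exists (ini (exist _ a aE : segment (cplx S))) => y.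
by apply/val_inj/V1; exact: valP.
Qed.

Definition nf_rest : seq (segment (cplx S)) := wseg S r.

(** Over the one-element fibre the monogons can be glued to the hub, all of them if [r]
is not empty, and all but one if it is. *)
Lemma nf_sphere (K : surfaceComplex) : related_complexes K (cplx S) ->
  (sphere K /\ nf_rest = [::]) \/ (~ sphere K /\ normal_polygon_boundary nf_rest).
Proof.
move=> relK; have [T [FT [VT ET iT] relT]] := trivialize S.
rewrite FS /= /monogons -map_comp in FT.
have VT1 : one_vertex_surf T by move=> p q; rewrite VT; exact: V1.
have FT' : sF T = (map fst M ++ r, 1) :: [seq ([:: linv s], 1) | s <- map fst M] ++ [::].
  by rewrite FT cats0 -map_comp.
case: (altP (r =P [::])) => [r0|r0].
  left; split; last by rewrite /nf_rest r0.
  have in0 : (map fst M ++ r, m) \in sF S by rewrite FS mem_head.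
  have [w0 _ _] := word_E in0; rewrite r0 cats0 in w0 FT'.
  case EA: (map fst M) w0 FT' => [//|s A] _ FT1; rewrite cats0 in FT1.
  have h1 : same_cycle (s :: A) (A ++ [:: s]) by left; apply/is_rotP; exists [:: s], A.
  have [T1 [FT1' [V_1 E_1 i_1] rel1]] := surf_head tt FT1 h1.
  have p2 : perm_eq (sF T1) ((A ++ [:: s], 1) :: [seq ([:: linv s], 1) | s <- A] ++ [:: ([:: linv s], 1)]).
    by rewrite FT1' perm_cons cats1 perm_sym perm_rcons.
  have [T2 [FT2 [V_2 E_2 i_2] rel2]] := surf_perm tt p2.
  have [//|T3 [FT3 V_3 E_3 rel3]] := collapse tt _ FT2.
  have VT3 : one_vertex_surf T3 by move=> p q; rewrite V_3 V_2 V_1; exact: VT1.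
  have [D relD dD] := two_monogons_sphere VT3 FT3.
  exists D => //; apply: rst_trans relK _; apply: rst_trans relT _.
  apply: rst_trans (related_cplx rel1) _; apply: rst_trans (related_cplx rel2) _.
  by apply: rst_trans (related_cplx rel3) _.
right; have [T' [FT1 V_1 E_1 rel1]] := collapse tt r0 FT'.
have VT' : one_vertex_surf T' by move=> p q; rewrite V_1; exact: VT1.
split.
  case=> D relD dD; apply: (polygon_not_acyclic2 VT' FT1).
  have relKT : related_complexes K (cplx T').
    by apply: rst_trans relK _; apply: rst_trans relT _; exact: related_cplx rel1.
  by apply/(acyclic2_related relKT)/(acyclic2_related relD)/acyclic2_digon.
apply: (polygon_boundary VT'); first by rewrite val_wseg ?nf_word_E.
by move=> a /E_1; rewrite ET.
Qed.

End NormalForm.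

(* There are n.+1 branched pieces; [f ord_max] is the last one. *)
Theorem mainTheorem1 (C : covering) (n : nat)
    (f : 'I_n.+1 -> piece (target C)) (k : 'I_n.+1 -> nat) :
  manifold (target C) ->
  finite_complex (target C) ->
  connected (source C) ->
  (forall i j, same_piece (f i) (f j) -> i = j) ->
  (forall i, 1 < k i) ->
  (forall i j : 'I_n.+1, i <= j -> k i <= k j) ->
  (forall i, branched_along (f i) (k i).-1) ->
  (forall g, (forall i, ~~ same_piece (f i) g) -> branched_along g 0) ->
  exists (D : covering) (g : 'I_n.+1 -> piece (target D))
         (s : 'I_n -> segment (target D)) (r : seq (segment (target D))),
    [/\ elementarily_related C D,
        one_point (target D),
        (forall i j, same_piece (g i) (g j) -> i = j) /\
        (forall h, exists i, same_piece (g i) h),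
        forall i, branched_along (g i) (k i).-1 &
        [/\ forall i : 'I_n, simple_boundary (g (widen_ord (leqnSn n) i)) [:: s i],
            simple_boundary (g ord_max) (codom s ++ r) &
            (sphere (target C) /\ r = [::]) \/
            (~ sphere (target C) /\ normal_polygon_boundary r)]].
Proof.
move=> mC finC _ f_inj k1 km fB fO.
have [X [x0 [S0 [eF [iso0 allF degs]]]]] := presentation mC finC
  (order_along_gt0 f k1) (order_along_pinv f k) (order_along_branch fB fO).
have rel0 : elementarily_related C (surf_cover x0 S0) by apply: rst_step; constructor 1.
have pk : perm_eq (branch_orders (sF S0)) (codom k).
  by rewrite /branch_orders degs; exact: order_along_perm.
have b0 : branch_orders (sF S0) != [::].
  by rewrite -size_eq0 (perm_size pk) size_codom card_ord.
have [S1 [rel1 V1 p1]] := one_vertex x0 (leqnn _) b0.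
have b1 : branch_orders (sF S1) != [::] by rewrite -size_eq0 (perm_size p1) size_eq0.
have [S [M [r [m [rel2 V FS sM pM]]]]] := normal_form x0 V1 b1.
have kE : rcons (map snd M) m = codom k.
  apply: (sorted_eq leq_trans anti_leq sM (codom_sorted km)).
  exact: perm_trans pM (perm_trans p1 pk).
have rel : elementarily_related C (surf_cover x0 S).
  by apply: rst_trans rel0 _; apply: rst_trans rel1 _.
exists (surf_cover x0 S), (nf_piece FS kE), (nf_seg FS kE), (wseg S r); split.
- exact: rel.
- exact: nf_one_point V FS.
- by split; [exact: nf_piece_inj|exact: nf_piece_onto].
- move=> i; have := @cover_branched _ _ (surf_monodromy S) x0 (nf_piece FS kE i).
  by rewrite nf_deg.
split; [exact: nf_monogon|exact: nf_hub|].
apply: (nf_sphere V FS); exact: related_targets rel.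
Qed.
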